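(* Let $F_n=I_2(f_n)$ with $f_n\in\mathfrak{H}^{\odot2}$, $n\ge1$, and let $\kappa_j(F_n)$ denote the $j$th cumulant of $F_n$. (a) Let $r,\sigma>0$, $\theta\in\mathbb{R}$, let $Y$ be $VG_c(r,\theta,\sigma)$-distributed and assume that $\mathbb{E}[F_n^2]=2\|f_n\|^2_{\mathfrak{H}^{\otimes2}}\to r(\sigma^2+2\theta^2)$ as $n\to\infty$. Then there exist constants $C_1=C_1(r,\theta,\sigma)>0$ and $C_2=C_2(r,\theta,\sigma)>0$ such that for all $n$ $$\begin{aligned}d_W(F_n,Y)\le C_1\Big(&\tfrac1{120}\kappa_6(F_n)-\tfrac\theta6\kappa_5(F_n)+\tfrac13(2\theta^2-\sigma^2)\kappa_4(F_n)+(2-r)\theta\sigma^2\kappa_3(F_n)+\tfrac14(\kappa_3(F_n))^2\\&-2\theta\kappa_2(F_n)\kappa_3(F_n)+(\sigma^4+4r\theta^2\sigma^2)\kappa_2(F_n)+4\theta^2(\kappa_2(F_n))^2+r^2\theta^2\sigma^4\Big)^{1/2}\\&+C_2\big|r(\sigma^2+2\theta^2)-\kappa_2(F_n)\big|.\end{aligned}$$ (b) Let $\lambda,r>0$, let $Y$ be $\Gamma_s(\lambda,r)$-distributed and assume that $\mathbb{E}[F_n^2]=2\|f_n\|^2_{\mathfrak{H}^{\otimes2}}\to\frac{2r}{\lambda^2}$ as $n\to\infty$. Then there exist constants $C_1=C_1(\lambda,r)>0$ and $C_2=C_2(\lambda,r)>0$ such that for all $n$ $$d_W(F_n,Y)\le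 C_1\Big(\tfrac1{120}\kappa_6(F_n)-\tfrac1{6r}\kappa_4(F_n)\kappa_2(F_n)+\tfrac1{4r^2}\kappa_2(F_n)^3+\tfrac16\kappa_3(F_n)^2\Big)^{1/2}+C_2\Big|\frac{2r}{\lambda^2}-\kappa_2(F_n)\Big|.$$
   Context: $X=\{X(h)\}_{h\in\mathfrak{H}}$ is an isonormal Gaussian process over a real separable Hilbert space $\mathfrak{H}$ (a centred Gaussian family with $\mathbb{E}[X(h)X(g)]=\langle h,g\rangle_{\mathfrak{H}}$), defined on $(\Omega,\mathcal{F},\mathbb{P})$ with $\mathcal{F}=\sigma(X)$. $\mathfrak{H}^{\odot2}$ is the symmetric tensor square, and $I_2$ is the linear isometry from $\mathfrak{H}^{\odot2}$ (with norm $\sqrt2\,\|\cdot\|_{\mathfrak{H}^{\otimes2}}$) onto the second Wiener chaos, determined by $I_2(h\otimes h)=X(h)^2-1$ for $\|h\|=1$. Cumulants: $\kappa_j(F)=(-i)^j\frac{d^j}{dt^j}\log\mathbb{E}[e^{itF}]\big|_{t=0}$. Wasserstein distance: $d_W(U,V)=\sup|\mathbb{E}[h(U)]-\mathbb{E}[h(V)]|$, the supremum over all $h:\mathbb{R}\to\mathbb{R}$ with $|h(x)-h(y)|\le|x-y|$. Variance-Gamma distributions: $VG(r,\theta,\sigma,\mu)$ ($r,\sigma>0$, $\theta,\mu\in\mathbb{R}$) has Lebesgue density $$p(x)=\frac{1}{\sigma\sqrt\pi\,\Gamma(r/2)}e^{\frac{\theta}{\sigma^2}(x-\mu)}\Big(\frac{|x-\mu|}{2\sqrt{\theta^2+\sigma^2}}\Big)^{\frac{r-1}{2}}K_{\frac{r-1}{2}}\Big(\frac{\sqrt{\theta^2+\sigma^2}}{\sigma^2}|x-\mu|\Big),$$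 $K_\nu$ being the modified Bessel function of the second kind; its mean is $\mu+r\theta$ and its variance $r(\sigma^2+2\theta^2)$. The centred version is $VG_c(r,\theta,\sigma):=VG(r,\theta,\sigma,-r\theta)$, and the symmetrized Gamma distribution is $\Gamma_s(\lambda,r):=VG_c(2r,0,1/\lambda)$. *)

(* Defs.v *)
From HB Require Import structures.
From mathcomp Require Import all_boot all_order all_algebra.
From mathcomp Require Import sesquilinear.
From mathcomp Require Import complex.
From mathcomp Require Import all_classical all_reals all_analysis.

Set Implicit Arguments.
Unset Strict Implicit.
Unset Printing Implicit Defensive.

Import Order.TTheory GRing.Theory Num.Theory.
Import numFieldNormedType.Exports.

Local Open Scope classical_set_scope.
Local Open Scope ring_scope.

(** ** Hilbert spaces and the symmetric tensor square *)

Record hilbertSpace (R : realType) := HilbertSpace {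
  hilbert_sort :> completeNormedModType R;
  inner : {dot hilbert_sort for idfun};
  inner_norm : forall x, inner x x = `|x| ^+ 2 }.

Definition separable_space (T : topologicalType) :=
  exists2 D : set T, countable D & dense D.

Definition linear_span (R : realType) (V : lmodType R) (A : set V) : set V :=
  [set v | exists n (a : 'I_n -> R) (u : 'I_n -> V),
     (forall i, A (u i)) /\ v = \sum_(i < n) a i *: u i].

(* The Hilbert tensor square of H, given by the characterization that
   determines it up to a unique isometric isomorphism compatible with the
   elementary tensors. *)
Record tensorSquare (R : realType) (H : hilbertSpace R) := TensorSquare {
  tensor_sort :> hilbertSpace R;
  tensor : {bilinear H -> H -> tensor_sort};
  tensor_inner : forall a b c d : H,
    inner tensor_sort (tensor a b) (tensor c d)
      = inner H a c * inner H b d;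
  tensor_total :
    closure (linear_span [set tensor a b | a in setT & b in setT]) = setT }.

Definition symmetric_tensors (R : realType) (H : hilbertSpace R)
    (HH : tensorSquare H) : set HH :=
  closure (linear_span
    [set 2^-1 *: (tensor HH a b + tensor HH b a) | a in setT & b in setT]).
Arguments symmetric_tensors {R H} HH _.

(** ** Isonormal Gaussian processes and the double Wiener-Ito integral *)

Section isonormal.
Context {R : realType} (H : hilbertSpace R).
Context d (T : measurableType d) (P : probability T R).
Variable X : H -> {RV P >-> R}.

(* [normal_prob 0 0] is a junk value (uniform law on [0, 1]), hence the
   separate treatment of the degenerate Gaussian law. *)
Definition centred_gaussian (Z : T -> R) :=
  exists2 s : R, 0 <= s & forall A : set R, measurable A ->
    P (Z @^-1` A) = if s == 0 then \d_(0 : R) A else normal_prob 0 s A.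

Definition isonormal :=
  (forall n (a : 'I_n -> R) (h : 'I_n -> H),
     centred_gaussian (fun w => \sum_(i < n) a i * X (h i) w)) /\
  (forall h g : H, 'E_P[(fun w => X h w * X g w)%R] = (inner H h g)%:E)%E.

Definition generated_by :=
  (@measurable d T) =
  <<s \bigcup_h preimage_set_system setT (X h) measurable >>.

(* These properties determine [I2 f], up to P-a.s. equality, for every
   symmetric f (and leave it unspecified for the other tensors); they also
   force the range to be the second Wiener chaos, the L^2-closed span of the
   X(h)^2 - 1 with h of norm 1. *)
Definition double_wiener_integral (HH : tensorSquare H)
    (I2 : HH -> {RV P >-> R}) :=
  [/\ forall (c : R) (f g : HH),
        symmetric_tensors HH f -> symmetric_tensors HH g ->
        {ae P, forall w, I2 (c *: f + g) w = c * I2 f w + I2 g w},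
      forall f : HH, symmetric_tensors HH f ->
        ('E_P[(fun w => I2 f w ^+ 2)%R] = (2 * `|f| ^+ 2)%:E)%E &
      forall h : H, `|h| = 1 ->
        {ae P, forall w, I2 (tensor HH h h) w = X h w ^+ 2 - 1}].

End isonormal.

(** ** Cumulants *)

Section cumulant.
Context {R : realType} d (T : measurableType d) (P : probability T R).
Local Open Scope complex_scope.

(* E[exp(itF)], using exp(ix) = cos x + i sin x. *)
Definition char_fun (F : {RV P >-> R}) (t : R) : R[i] :=
  fine 'E_P[(fun w => cos (t * F w))%R]%E +i* fine 'E_P[(fun w => sin (t * F w))%R]%E.

(* Principal branch: for z off the half-line of nonpositive reals,
   Arg z = 2 atan (Im z / (|z| + Re z)). *)
Definition clog (z : R[i]) : R[i] :=
  let rho := Num.sqrt (complex.Re z ^+ 2 + complex.Im z ^+ 2) in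
  ln rho +i* (2 * atan (complex.Im z / (rho + complex.Re z))).

Definition cderive1n (j : nat) (g : R -> R[i]) (t : R) : R[i] :=
  derive1n j (fun s => complex.Re (g s)) t
  +i* derive1n j (fun s => complex.Im (g s)) t.

(* The real part only serves to land in R: cumulants of a real random variable
   are real. *)
Definition cumulant (F : {RV P >-> R}) (j : nat) : R :=
  complex.Re ((- 'i) ^+ j * cderive1n j (fun t => clog (char_fun F t)) 0).

End cumulant.

(** ** Wasserstein distance *)

Definition wasserstein (R : realType)
    d (T : measurableType d) (P : probability T R) (U : {RV P >-> R})
    d' (T' : measurableType d') (Q : probability T' R) (V : {RV Q >-> R})
    : \bar R :=
  ereal_sup [set `| 'E_P[(fun w => h (U w))%R] - 'E_Q[(fun w => h (V w))%R] |%E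
    | h in [set h : R -> R | forall x y, `|h x - h y| <= `|x - y|]].

(** ** Variance-Gamma laws *)

Section variance_gamma.
Context {R : realType}.
Local Notation mu := (@lebesgue_measure R).

Definition Gamma_fun (s : R) : R :=
  \int[mu]_(t in `]0, +oo[) (t `^ (s - 1) * expR (- t)).

Definition cosh (t : R) : R := (expR t + expR (- t)) / 2.

(* Modified Bessel function of the second kind, for x > 0. *)
Definition besselK (nu x : R) : R :=
  \int[mu]_(t in `[0, +oo[) (expR (- x * cosh t) * cosh (nu * t)).

Definition VG_density (r theta sigma m x : R) : R :=
  (sigma * Num.sqrt pi * Gamma_fun (r / 2))^-1
  * expR (theta / sigma ^+ 2 * (x - m))
  * (`|x - m| / (2 * Num.sqrt (theta ^+ 2 + sigma ^+ 2))) `^ ((r - 1) / 2)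
  * besselK ((r - 1) / 2)
      (Num.sqrt (theta ^+ 2 + sigma ^+ 2) / sigma ^+ 2 * `|x - m|).

Definition VG (r theta sigma m : R) (A : set R) : \bar R :=
  (\int[mu]_(x in A) (VG_density r theta sigma m x)%:E)%E.

Definition VGc (r theta sigma : R) : set R -> \bar R :=
  VG r theta sigma (- (r * theta)).

Definition Gamma_sym (lambda r : R) : set R -> \bar R :=
  VGc (2 * r) 0 lambda^-1.

Definition has_law d (T : measurableType d) (P : probability T R)
    (Y : {RV P >-> R}) (nu : set R -> \bar R) :=
  forall A : set R, measurable A -> distribution P Y A = nu A.

End variance_gamma.

(* Main.v *)
(** A random variable I2(f) is an L^2 limit of finite sums F of terms
    lam_i (X(e_i)^2 - 1) with (e_i) orthonormal, and the j-th cumulant of F is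
    2^(j-1) (j-1)! p_j, where p_j is the j-th power sum of the eigenvalues lam_i.
    In these terms the expression under the root in (a) is
      Delta = 2 sum lam_i^2 (sigma^2 + 4 theta lam_i - 4 lam_i^2)^2
              + (sigma^2 r theta + 4 theta p_2 - 4 p_3)^2.
    Stein's method is replaced by a rigidity argument.  Let a > 0 > b be the
    roots of sigma^2 + 4 theta x - 4 x^2.  If Delta and |Var Y - 2 p_2| are small,
    every eigenvalue is close to a, to b or to 0, and the values of p_2 and p_3
    force the numbers of eigenvalues close to a and to b to be both exactly r; in
    particular r is an integer.  Rounding the eigenvalues to a, b or 0 then gives
    a random variable with the law of Y at L^2 distance O(sqrt Delta) from F.
    Otherwise the bound E|F| + E|Y| suffices.  The law of the rounded sum is
    identified by its characteristic function, Y being a normal mean-variance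
    mixture over a Gamma law.  In (b), replacing sigma^2 by kappa_2 / (2 r) changes
    Delta by O((Var Y - kappa_2)^2) only.  The finite bounds pass to the
    limit along an ultrafilter on which all power sums converge; the characteristic
    function of the limit is the exponential of a power series in these limits,
    which yields the cumulants. *)

Require Import Defs.
From HB Require Import structures.
From mathcomp Require Import all_boot all_order all_algebra.
From mathcomp Require Import sesquilinear complex spectral.
From mathcomp Require Import all_classical all_reals all_analysis.
From mathcomp Require Import measurable_realfun ring lra.

Set Implicit Arguments.
Unset Strict Implicit.
Unset Printing Implicit Defensive.

Import Order.TTheory GRing.Theory Num.Theory.
Import numFieldNormedType.Exports.

Local Open Scope classical_set_scope.
Local Open Scope ring_scope.

(** * Calculus under the integral sign *)

Section calculus.
Context {R : realType}.
Local Notation mu := (@lebesgue_measure R).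
Implicit Types (f g F : R -> R).

(** The target law behaves like a chaos sum with eigenvalues a and b, each of multiplicity r: since
    a + b = theta and -4ab = sigma^2, one has (1 - 2iat)(1 - 2ibt) = 1 + sigma^2 t^2 - 2i theta t,
    and the power -r/2 of this is, up to centring, the characteristic function of Y. In a genuine
    chaos sum the multiplicities are integers. The value of p_2 gives only one equation for the two
    of them; the square containing p_3 supplies the second, and the determinant is nonzero because
    a, b and 0 are distinct. The distance from r to the integers therefore enters the constants. The
    constants are fixed before the probability spaces, so all estimates for finite sums are
    expressed through the eigenvalues and the parameters of Y. Complex powers and logarithms are
    avoided until cumulants are computed: a characteristic function is a pair of real integrals,
    written exp(L) cos A and exp(L) sin A with an argument A that is not reduced modulo 2 pi.
    Matching two laws then means checking two real identities. Independence of the Gaussian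
    coordinates enters only through the characteristic functions of their linear combinations. *)

Lemma der_eq f (x a b : R) : is_derive x 1 f a -> a = b -> is_derive x 1 f b.
Proof. by move=> df <-. Qed.

Lemma der_cst (c x : R) : is_derive x 1 (fun _ : R => c) 0.
Proof. exact: is_derive_cst. Qed.

Lemma der_id (x : R) : is_derive x 1 (fun y : R => y) 1.
Proof. exact: is_derive_id. Qed.

Lemma derN f (x a : R) : is_derive x 1 f a -> is_derive x 1 (fun y => - f y) (- a).
Proof. by move=> fa; exact: is_deriveN. Qed.

Lemma derD f g (x a b : R) : is_derive x 1 f a -> is_derive x 1 g b ->
  is_derive x 1 (fun y => f y + g y) (a + b).
Proof. by move=> fa gb; exact: is_deriveD. Qed.

Lemma derM f g (x a b : R) : is_derive x 1 f a -> is_derive x 1 g b ->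
  is_derive x 1 (fun y => f y * g y) (a * g x + f x * b).
Proof.
move=> fa gb; apply: (der_eq (is_deriveM fa gb)).
by rewrite /GRing.scale/= addrC mulrC; congr (_ + _); exact: mulrC.
Qed.

Lemma derX f n (x a : R) : is_derive x 1 f a ->
  is_derive x 1 (fun y => f y ^+ n) (n%:R * f x ^+ n.-1 * a).
Proof.
by move=> fa; have := is_deriveX n fa; rewrite exprfctE.
Qed.

Lemma der_expR f (x a : R) : is_derive x 1 f a ->
  is_derive x 1 (fun y => expR (f y)) (expR (f x) * a).
Proof. by move=> fx; have := @is_derive1_comp _ expR f x _ _ (is_derive_expR _) fx. Qed.

Lemma der_cos f (x a : R) : is_derive x 1 f a ->
  is_derive x 1 (fun y => cos (f y)) (- sin (f x) * a).
Proof. by move=> fx; have := @is_derive1_comp _ cos f x _ _ (is_derive_cos _) fx. Qed.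

Lemma der_sin f (x a : R) : is_derive x 1 f a ->
  is_derive x 1 (fun y => sin (f y)) (cos (f x) * a).
Proof. by move=> fx; have := @is_derive1_comp _ sin f x _ _ (is_derive_sin _) fx. Qed.

Lemma der_atan f (x a : R) : is_derive x 1 f a ->
  is_derive x 1 (fun y => atan (f y)) ((1 + f x ^+ 2)^-1 * a).
Proof. by move=> fx; have := @is_derive1_comp _ atan f x _ _ (is_derive1_atan _) fx. Qed.

Lemma der_ln f (x a : R) : is_derive x 1 f a -> 0 < f x ->
  is_derive x 1 (fun y => ln (f y)) ((f x)^-1 * a).
Proof. by move=> fx f0; have := @is_derive1_comp _ (@ln R) f x _ _ (is_derive1_ln f0) fx. Qed.

Lemma is_derive_continuous f (x df : R) :
  is_derive x 1 f df -> {for x, continuous f}.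
Proof. by move=> [fx _]; exact/differentiable_continuous/derivable1_diffP. Qed.

Lemma bounded_integrable d (T : measurableType d) (P : probability T R)
    (f : T -> R) (M : R) : measurable_fun setT f ->
  (forall x, `|f x| <= M) -> P.-integrable setT (EFin \o f).
Proof.
move=> mf fM; apply: (@le_integrable _ _ _ P setT measurableT _ (EFin \o cst M)) => //.
- exact/measurable_EFinP.
- by move=> x _ /=; rewrite lee_fin (le_trans (fM x))// ler_norm.
- exact: finite_measure_integrable_cst.
Qed.

Lemma intZ d (T : measurableType d) (m : {measure set T -> \bar R}) (f : T -> R) (r : R) :
  m.-integrable setT (EFin \o f) -> m.-integrable setT (EFin \o (fun x => r * f x)).
Proof.
move=> fi; have := @integrableZl _ _ _ m setT measurableT r _ fi.
by apply: eq_integrable => // x _ /=; rewrite EFinM.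
Qed.

Lemma intD d (T : measurableType d) (m : {measure set T -> \bar R}) (f g : T -> R) :
  m.-integrable setT (EFin \o f) -> m.-integrable setT (EFin \o g) ->
  m.-integrable setT (EFin \o (fun x => f x + g x)).
Proof.
by move=> fi gi; have := integrableD measurableT fi gi; apply: eq_integrable.
Qed.

Lemma intB d (T : measurableType d) (m : {measure set T -> \bar R}) (f g : T -> R) :
  m.-integrable setT (EFin \o f) -> m.-integrable setT (EFin \o g) ->
  m.-integrable setT (EFin \o (fun x => f x - g x)).
Proof.
by move=> fi gi; have := integrableB measurableT fi gi; apply: eq_integrable.
Qed.

Lemma int_sum d (T : measurableType d) (m : {measure set T -> \bar R})
    (I : Type) (r : seq I) (P : pred I) (f : I -> T -> R) :
  (forall i, m.-integrable setT (EFin \o f i)) ->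
  m.-integrable setT (EFin \o (fun x => \sum_(i <- r | P i) f i x)) /\
  \int[m]_x (\sum_(i <- r | P i) f i x) = \sum_(i <- r | P i) \int[m]_x f i x.
Proof.
move=> fi; elim: r => [|i r [IH1 IH2]].
  rewrite big_nil; under [in X in _ /\ X]eq_Rintegral do rewrite big_nil.
  split; last by rewrite Rintegral_cst// mul0r.
  by apply: eq_integrable (integrable0 m setT) => // x _ /=; rewrite big_nil.
have E x : \sum_(j <- i :: r | P j) f j x =
    (if P i then f i x else 0) + \sum_(j <- r | P j) f j x.
  by rewrite big_cons; case: ifP; rewrite ?add0r.
under [in X in _ /\ X]eq_Rintegral do rewrite E.
have -> : (fun x => \sum_(j <- i :: r | P j) f j x) = (fun x => (if P i then f i x else 0) + \sum_(j <- r | P j) f j x).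
  by apply/funext.
have i1 : m.-integrable setT (EFin \o (fun x => if P i then f i x else 0)).
  by case: (P i) => //; exact: integrable0.
rewrite RintegralD// IH2 big_cons; split; first exact: intD.
by case: (P i); rewrite ?Rintegral_cst// mul0r add0r.
Qed.

Lemma int_le d (T : measurableType d) (m : {measure set T -> \bar R}) (f g : T -> R) :
  measurable_fun setT f -> m.-integrable setT (EFin \o g) ->
  (forall x, `|f x| <= g x) -> m.-integrable setT (EFin \o f).
Proof.
move=> mf gi fg; apply: (le_integrable measurableT _ _ gi).
  exact/measurable_EFinP.
by move=> x _ /=; rewrite lee_fin (le_trans (fg x))// ler_norm.
Qed.

Lemma int_measurable d (T : measurableType d) (m : {measure set T -> \bar R}) (f : T -> R) :
  m.-integrable setT (EFin \o f) -> measurable_fun setT f.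
Proof. by move=> /(measurable_int m) /measurable_EFinP. Qed.

Lemma dominated_cvgR d (T : measurableType d) (m : {measure set T -> \bar R})
    (f_ : (T -> R)^nat) (f g : T -> R) :
  (forall n, measurable_fun setT (f_ n)) -> m.-integrable setT (EFin \o g) ->
  (forall x, f_ n x @[n --> \oo] --> f x) ->
  (forall n x, `|f_ n x| <= g x) ->
  m.-integrable setT (EFin \o f) /\
  (\int[m]_x f_ n x) @[n --> \oo] --> \int[m]_x f x.
Proof.
move=> mf ig cf fg.
have mlim : measurable_fun setT f.
  apply: (@measurable_fun_cvg _ _ _ _ f_) => // x _; exact: cf.
have [|||||i1 i2 i3] := @dominated_convergence _ _ _ m setT measurableT
   (fun n => EFin \o f_ n) (EFin \o f) (EFin \o g).
- by move=> n; exact/measurable_EFinP.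
- exact/measurable_EFinP.
- by apply: aeW => x _ /=; apply: cvg_EFin; [near=> n|exact: cf].
- exact: ig.
- by apply: aeW => x n _ /=; rewrite lee_fin.
- split => //.
  apply: fine_cvg => /=; rewrite fineK//; last exact: integrable_fin_num.
Unshelve. all: by end_near. Qed.

(** The fundamental theorem of calculus on the intervals from -(n+1) to n+1, followed by dominated
    convergence with [|f|] as majorant. The integrations by parts on the line below are instances,
    [F] being the boundary term. *)
Lemma integral_derive0 F f : (forall x : R, is_derive x 1 F (f x)) -> continuous f ->
  F x @[x --> +oo] --> (0:R) -> F x @[x --> -oo] --> (0:R) ->
  mu.-integrable setT (EFin \o f) -> \int[mu]_x f x = 0.
Proof.
move=> dF cf Fy FNy fi.
pose f_ (n : nat) := f \_ `[- n.+1%:R, n.+1%:R]%classic.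
have mf : measurable_fun setT f by exact: continuous_measurable_fun.
have [||||_ +] := @dominated_cvgR _ _ mu f_ f (fun x => `|f x|).
- move=> n; apply/(measurable_restrictT _ _).1 => //.
  exact: measurable_funTS.
- exact: integrable_norm fi.
- move=> x; apply: cvg_near_cst; near=> n; rewrite /f_ patchE ifT// inE/= in_itv/=.
  rewrite -ler_norml; apply: (@le_trans _ _ n%:R); last by rewrite ler_nat.
  near: n; exact: nbhs_infty_ger.
- by move=> n x; rewrite /f_ patchE; case: ifP => // _; rewrite normr0.
- have -> : (fun n => \int[mu]_x f_ n x) = (fun n => F n.+1%:R - F (- n.+1%:R)).
    apply/funext => n; rewrite /f_ -Rintegral_mkcond /Rintegral.
    rewrite (@continuous_FTC2 _ f F) //.
    + by rewrite gtrN// ltr0n.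
    + by apply: continuous_subspaceT.
    + split.
      * by move=> x _; have [] := dF x.
      * apply: cvg_at_right_filter; exact: is_derive_continuous (dF _).
      * apply: cvg_at_left_filter; exact: is_derive_continuous (dF _).
    + by move=> x _; rewrite derive1E; have [_ ->] := dF x.
  have ny : n.+1%:R @[n --> \oo] --> (+oo : set_system R).
    by rewrite (_ : (fun n => _) = (fun n => n%:R) \o (addn 1))//; apply: cvg_comp; [exact: cvg_addnl|exact: cvgr_idn].
  move=> I1; have I2 : (F n.+1%:R - F (- n.+1%:R)) @[n --> \oo] --> (0 : R).
    rewrite -[X in _ --> X](subrr 0); apply: cvgB.
      exact: (cvg_comp (fun n => n.+1%:R : R) F ny Fy).
    move: FNy; rewrite cvgNy_compNP => FNy.
    exact: (cvg_comp (fun n => n.+1%:R : R) (F \o -%R) ny FNy).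
  exact: cvg_unique I1 I2.
Unshelve. all: by end_near. Qed.

Lemma is_derive_under_integral d (Y : measurableType d)
    (m : {measure set Y -> \bar R}) (f f' : R -> Y -> R) (G : Y -> R) (a : R) :
  (forall (x : R) y, is_derive x 1 (f ^~ y) (f' x y)) ->
  (forall x, m.-integrable setT (EFin \o f x)) ->
  m.-integrable setT (EFin \o G) ->
  (forall x y, `|f' x y| <= G y) ->
  is_derive a 1 (fun x => \int[m]_y f x y) (\int[m]_y f' a y).
Proof.
move=> df fi Gi fG.
have d1 x y : partial1of2 f x y = f' x y.
  by rewrite partial1of2E; have [_ ->] := df x y.
have aI : `](a - 1), (a + 1)[%classic a.
  by rewrite /= in_itv/=; apply/andP; split; lra.
have G0 y : 0 <= G y by apply: le_trans (fG a y).
have H1 x y : `](a - 1), (a + 1)[%classic x -> [set: Y] y -> derivable (f ^~ y) x 1.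
  by move=> _ _; have [] := df x y.
have H2 x y : `](a - 1), (a + 1)[%classic x -> [set: Y] y -> `|partial1of2 f x y| <= G y.
  by move=> _ _; rewrite d1.
have H3 x : `](a - 1), (a + 1)[%classic x -> m.-integrable setT (EFin \o f x) by [].
split.
  exact: (derivable_under_integral measurableT aI H3 H1 G0 Gi H2).
rewrite -derive1E (differentiation_under_integral measurableT aI H3 H1 G0 Gi H2).
by apply: eq_Rintegral => y _; rewrite d1.
Qed.

End calculus.

(** The function is decomposed by its syntax and its derivative is built along the way, without
    instance resolution. Constants are matched before anything else, hypotheses giving a derivative
    at every point serve as leaves, and positivity goals from logarithms are handed back. [der_tac]
    leaves the comparison of the computed derivative with the announced one. *)
Ltac der :=
  lazymatch goal with
  | |- is_derive ?x _ ?F _ => lazymatch F with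
    | (fun _ => ?c) => simple notypeclasses refine (der_cst c x)
    | (fun y => y) => simple notypeclasses refine (der_id x)
    | id => simple notypeclasses refine (der_id x)
    | (fun y => - @?f y) => simple notypeclasses refine (@derN _ f x _ _); der
    | (fun y => @?f y + @?g y) => simple notypeclasses refine (@derD _ f g x _ _ _ _); der
    | (fun y => @?f y * @?g y) => simple notypeclasses refine (@derM _ f g x _ _ _ _); der
    | (fun y => @?f y ^+ ?n) => simple notypeclasses refine (@derX _ f n x _ _); der
    | (fun y => expR (@?f y)) => simple notypeclasses refine (@der_expR _ f x _ _); der
    | (fun y => cos (@?f y)) => simple notypeclasses refine (@der_cos _ f x _ _); der
    | (fun y => sin (@?f y)) => simple notypeclasses refine (@der_sin _ f x _ _); der
    | (fun y => atan (@?f y)) => simple notypeclasses refine (@der_atan _ f x _ _); der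
    | (fun y => ln (@?f y)) => simple notypeclasses refine (@der_ln _ f x _ _ _); der
    | (fun y => ?h y) => match goal with H : forall _, is_derive _ _ h _ |- _ => simple notypeclasses refine (H x) end
    | _ => match goal with H : forall _, is_derive _ _ F _ |- _ => simple notypeclasses refine (H x) end
    end
  | _ => idtac
  end.

Ltac der_tac := simple notypeclasses refine (der_eq _ _); [ | der; cbv beta | cbv beta].

(** * Gaussian and Gamma characteristic functions *)

Section polar.
Context {R : realType}.

(** [prho k y] and [pang k y] are the modulus and the continuous argument of (1 - i y)^(-k). *)
Definition prho (k y : R) := expR (- (k / 2) * ln (1 + y ^+ 2)).
Definition pang (k y : R) := k * atan y.

Lemma sqr1_gt0 (y : R) : 0 < 1 + y ^+ 2.
Proof. by rewrite ltr_pwDl// sqr_ge0. Qed.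

(* With [phi = A + i B], the hypotheses say [phi' = i k phi / (c - i s)]. *)
Lemma polar_ode (k c : R) (A B C S : R -> R) : 0 < c ->
  (forall s : R, is_derive s 1 A (- S s)) -> (forall s : R, is_derive s 1 B (C s)) ->
  (forall s, k * A s = c * C s + s * S s) ->
  (forall s, k * B s = c * S s - s * C s) -> B 0 = 0 ->
  forall s, A s = A 0 * prho k (s / c) * cos (pang k (s / c)) /\
            B s = A 0 * prho k (s / c) * sin (pang k (s / c)).
Proof.
move=> c0 dA dB kA kB B0.
have cn0 : c != 0 by rewrite gt_eqF.
(* Here m exp(- i al) = (1 - i s / c)^k. The constants found in [UE] and [VE] are the real and
   imaginary parts of phi (1 - i s / c)^k, whose derivative vanishes by the equation for phi. *)
pose m s := expR (k / 2 * ln (1 + (s / c) ^+ 2)).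
pose al s := k * atan (s / c).
have D0 (s : R) : c ^+ 2 + s ^+ 2 != 0.
  by rewrite gt_eqF// ltr_pwDl// ?sqr_ge0// exprn_gt0.
have D1 (s : R) : 1 + (s / c) ^+ 2 != 0 by rewrite gt_eqF// sqr1_gt0.
have dm (s : R) : is_derive s 1 m (m s * (k * s / (c ^+ 2 + s ^+ 2))).
  rewrite /m; der_tac; first exact: sqr1_gt0.
   congr (_ * _); rewrite expr1; field; by rewrite ?cn0 ?D0 ?D1.
have dal (s : R) : is_derive s 1 al (k * c / (c ^+ 2 + s ^+ 2)).
  rewrite /al; der_tac.
  field; by rewrite ?cn0 ?D0 ?D1.
have SE s : S s = k * (s * A s + c * B s) / (c ^+ 2 + s ^+ 2).
  apply: (canRL (mulfK (D0 s))); transitivity (s * (k * A s) + c * (k * B s)); last by ring.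
  by rewrite kA kB; ring.
have CE s : C s = k * (c * A s - s * B s) / (c ^+ 2 + s ^+ 2).
  apply: (canRL (mulfK (D0 s))); transitivity (c * (k * A s) - s * (k * B s)); last by ring.
  by rewrite kA kB; ring.
have al0 : al 0 = 0 by rewrite /al mul0r atan0 mulr0.
have UE s : m s * (A s * cos (al s) + B s * sin (al s)) = A 0.
  have -> : A 0 = m 0 * (A 0 * cos (al 0) + B 0 * sin (al 0)).
    by rewrite B0 al0 cos0 /m mul0r expr0n addr0 ln1 mulr0 expR0; ring.
  apply: (@is_derive_0_is_cst _ (fun s => m s * (A s * cos (al s) + B s * sin (al s)))) => x.
  der_tac.
  rewrite SE CE; field; exact: D0.
have VE s : m s * (B s * cos (al s) - A s * sin (al s)) = 0.
  transitivity (m 0 * (B 0 * cos (al 0) - A 0 * sin (al 0))); last first.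
    by rewrite B0 al0 sin0; ring.
  apply: (@is_derive_0_is_cst _ (fun s => m s * (B s * cos (al s) - A s * sin (al s)))) => x.
  der_tac.
  rewrite SE CE; field; exact: D0.
move=> s; have {}UE := UE s; have {}VE := VE s.
have ms : m s * prho k (s / c) = 1 by rewrite /m /prho -expRD mulNr subrr expR0.
have m0 : m s != 0 by rewrite gt_eqF// expR_gt0.
move/eqP: VE; rewrite mulf_eq0 (negPf m0)/= => /eqP VE.
have AB : A s * cos (al s) + B s * sin (al s) = A 0 * prho k (s / c).
  by rewrite -UE; transitivity ((A s * cos (al s) + B s * sin (al s)) * (m s * prho k (s / c))); [rewrite ms mulr1|ring].
have cs := cos2Dsin2 (al s).
rewrite -AB /pang -/(al s); split.
  transitivity (A s * (cos (al s) ^+ 2 + sin (al s) ^+ 2) + sin (al s) * (B s * cos (al s) - A s * sin (al s))).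
    by rewrite cs VE; ring.
  by ring.
transitivity (B s * (cos (al s) ^+ 2 + sin (al s) ^+ 2) - cos (al s) * (B s * cos (al s) - A s * sin (al s))).
  by rewrite cs VE; ring.
by ring.
Qed.
End polar.

(** * Decay at infinity and quadratic growth bounds *)

Section vanish.
Context {R : realType}.
Local Notation mu := (@lebesgue_measure R).

Lemma cvg0_decay (F : R -> R) (K : R) : (forall x, `|x| * `|F x| <= K) ->
  F x @[x --> +oo] --> (0:R) /\ F x @[x --> -oo] --> (0:R).
Proof.
move=> FK; have K0 : 0 <= K by apply: le_trans (FK 0); rewrite mulr_ge0.
have small e x : 0 < e -> (K + 1) / e < `|x| -> `|F x| <= e.
  move=> e0 ex; have x0 : 0 < `|x| by apply: le_lt_trans ex; rewrite divr_ge0// ?addr_ge0// ltW.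
  rewrite -(ler_pM2l x0) (le_trans (FK x))//.
  by move: ex; rewrite ltr_pdivrMr//; nra.
split; apply/cvgrPdist_le => e e0; near=> x; rewrite sub0r normrN.
  by apply: small => //; rewrite (lt_le_trans _ (ler_norm x))//; near: x; apply: nbhs_pinfty_gt; exact: num_real.
apply: small => //; rewrite -normrN (lt_le_trans _ (ler_norm _))// ltrNr; near: x.
by apply: nbhs_ninfty_lt; exact: num_real.
Unshelve. all: by end_near. Qed.

Lemma le1Dsqr (x : R) : `|x| <= 1 + x ^+ 2.
Proof. by rewrite -real_normK ?num_real//; set y := `|x|; nra. Qed.

(** With w = 1 / s^2 and u, v a sine and a cosine, this bound and the next are the growth conditions
    under which Stein's identity for a normal law of variance s^2 applies to trigonometric test
    functions. *)
Lemma moment_bound1 (t w u x : R) : 0 <= w -> `|u| <= 1 ->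
  `|x| * `|u| <= (1 + `|t| + w) * (1 + x ^+ 2).
Proof.
move=> w0 u1; apply: (@le_trans _ _ (1 + x ^+ 2)).
  by rewrite (le_trans _ (le1Dsqr x))// ler_piMr.
by rewrite ler_peMl ?addr_ge0 ?sqr_ge0// -addrA lerDl addr_ge0.
Qed.

Lemma moment_bound2 (t w u v x : R) : 0 <= w -> `|u| <= 1 -> `|v| <= 1 ->
  `|t * v - x * w * u| <= (1 + `|t| + w) * (1 + x ^+ 2).
Proof.
move=> w0 u1 v1; rewrite (le_trans (ler_normB _ _))// !normrM (ger0_norm w0).
apply: (@le_trans _ _ (`|t| * (1 + x ^+ 2) + w * (1 + x ^+ 2))).
  apply: lerD; first by rewrite ler_wpM2l// (le_trans v1)// lerDl sqr_ge0.
  by rewrite (mulrC `|x|) -mulrA ler_wpM2l// (le_trans _ (le1Dsqr x))// ler_piMr.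
by rewrite -mulrDl ler_wpM2r ?addr_ge0 ?sqr_ge0// lerD2r lerDr.
Qed.

End vanish.

(** * Integration against a density *)

Section density.
Local Open Scope ereal_scope.
Context d (T : measurableType d) (R : realType).
Variables (m nu : {measure set T -> \bar R}) (p : T -> R).
Hypotheses (mp : measurable_fun setT p) (p0 : forall x, (0 <= p x)%R).
Hypothesis nuE : forall A, measurable A -> nu A = \int[m]_(x in A) (p x)%:E.

Import HBNNSimple.

Let integral_indic_density E : measurable E ->
  \int[nu]_x (\1_E x)%:E = \int[m]_x ((\1_E x)%:E * (p x)%:E).
Proof.
move=> mE; rewrite integral_indic// setIT nuE// integral_mkcond.
apply: eq_integral => x _; rewrite patchE indicE.
by case: (x \in E); rewrite ?mul1e ?mul0e.
Qed.

Let integral_nnsfun_density (h : {nnsfun T >-> R}) :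
  \int[nu]_x (h x)%:E = \int[m]_x ((h x)%:E * (p x)%:E).
Proof.
under [LHS]eq_integral do rewrite fimfunE -fsumEFin//.
rewrite [LHS]ge0_integral_fsum//; last 2 first.
  - by move=> r; exact/measurable_EFinP/measurableT_comp.
  - by move=> n x _; rewrite EFinM nnfun_muleindic_ge0.
under [RHS]eq_integral.
  move=> x xD; rewrite fimfunE -fsumEFin// ge0_mule_fsuml; last first.
    by move=> r; rewrite EFinM nnfun_muleindic_ge0.
  over.
rewrite [RHS]ge0_integral_fsum//; last 2 first.
  - by move=> r; apply: emeasurable_funM => //; apply/measurable_EFinP/measurableT_comp.
  - by move=> n x _; apply: mule_ge0; rewrite ?lee_fin// -lee_fin EFinM nnfun_muleindic_ge0.
apply: eq_fsbigr => r _.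
rewrite integralZl_indic_nnsfun// integral_indic_density//.
have [r0|r0] := ltP r 0%R.
  rewrite !integral0_eq ?mule0// => x _; rewrite preimage_nnfun0// indic0 ?mulr0 ?mul0e//.
rewrite -ge0_integralZl//.
- by apply: eq_integral => x _; rewrite EFinM muleA.
- by apply: emeasurable_funM => //; exact/measurable_EFinP.
- by move=> x _; rewrite mule_ge0// lee_fin.
Qed.

Lemma ge0_integral_density (f : T -> \bar R) : measurable_fun setT f ->
  (forall x, 0 <= f x) -> \int[nu]_x f x = \int[m]_x (f x * (p x)%:E).
Proof.
move=> mf f0; pose f_ := nnsfun_approx measurableT mf.
have ndf x : {homo (fun n => (f_ n x)%:E) : a b / (a <= b)%N >-> a <= b}.
  by move=> a b ab; rewrite lee_fin//; exact/lefP/nd_nnsfun_approx.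
have cf x : (f_ n x)%:E @[n --> \oo] --> f x by apply: cvg_nnsfun_approx.
transitivity (limn (fun n => \int[nu]_x (f_ n x)%:E)).
  rewrite -monotone_convergence//=.
  - apply: eq_integral => x _; apply/esym/cvg_lim => //=; exact: cf.
  - by move=> n; exact/measurable_EFinP.
  - by move=> n x _; rewrite lee_fin.
rewrite (_ : \int[m]_x _ = limn (fun n => \int[m]_x ((f_ n x)%:E * (p x)%:E))).
  by congr (limn _); apply/funext => n; exact: integral_nnsfun_density.
rewrite -monotone_convergence//=.
- apply: eq_integral => x _; apply/esym/cvg_lim => //=.
  by apply: cvgeZr => //; exact: cf.
- by move=> n; apply: emeasurable_funM => //; exact/measurable_EFinP.
- by move=> n x _; rewrite mule_ge0// lee_fin.
- by move=> x _ a b ab; rewrite lee_wpmul2r ?lee_fin//; have := ndf x a b ab; rewrite lee_fin.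
Qed.

Lemma integral_density (h : T -> R) : measurable_fun setT h ->
  m.-integrable setT (EFin \o (fun x => h x * p x)%R) ->
  nu.-integrable setT (EFin \o h) /\
  (\int[nu]_x h x = \int[m]_x (h x * p x))%R.
Proof.
move=> mh hi; have mhE : measurable_fun setT (EFin \o h) by exact/measurable_EFinP.
split.
  apply/integrableP; split => //.
  rewrite ge0_integral_density//; last exact: measurableT_comp.
  move/integrableP: hi => [_]; apply: le_lt_trans; rewrite le_eqVlt; apply/orP; left; apply/eqP.
  by apply: eq_integral => x _ /=; rewrite -EFinM normrM [`|p x|%R]ger0_norm.
rewrite /Rintegral; congr fine; rewrite integralE [RHS]integralE.
rewrite ge0_integral_density//; last exact: measurable_funepos.
rewrite ge0_integral_density//; last exact: measurable_funeneg.
congr (_ - _); apply: eq_integral => x _.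
  rewrite !funeposE/= -!EFin_max -EFinM maxr_pMl// mul0r//.
by rewrite !funenegE/= -!EFin_max -EFinM maxr_pMl// mul0r// mulNr.
Qed.

End density.

(** * Gaussian integrals and Stein's identity *)

Section gaussian.
Context {R : realType}.
Local Notation mu := (@lebesgue_measure R).
Variable s : R.
Hypothesis s0 : s != 0.
Local Notation p := (normal_pdf 0 s).

Let s2 : 0 < s ^+ 2. Proof. by rewrite exprn_even_gt0. Qed.

Lemma normal_pdf0E x : p x = normal_peak s * expR (- (x ^+ 2 / (s ^+ 2 *+ 2))).
Proof. by rewrite normal_pdfE// /normal_fun subr0 mulNr. Qed.

Lemma der_normal_pdf (x : R) : is_derive x 1 p (- (x / s ^+ 2) * p x).
Proof.
rewrite (_ : p = fun x => normal_peak s * expR (- (x ^+ 2 / (s ^+ 2 *+ 2)))); last first.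
  by apply/funext => y; rewrite normal_pdf0E.
by der_tac; field.
Qed.

(** Half of the Gaussian exponent absorbs the quadratic factor: with y = x^2 / (4 s^2), exp y >= 1 +
    y gives (1 + x^2) exp(- y) <= 1 + 4 s^2. The other half is the exponent of the normal law of
    standard deviation sqrt 2 s, so integrability of functions of quadratic growth reduces to that
    of a normal density. *)
Lemma normal_pdf_moment (x : R) :
  (1 + x ^+ 2) * p x <= (1 + 4 * s ^+ 2) * Num.sqrt 2 * normal_pdf 0 (Num.sqrt 2 * s) x.
Proof.
have q0 : Num.sqrt 2 * s != 0 :> R by rewrite mulf_neq0// gt_eqF// sqrtr_gt0.
rewrite normal_pdf0E normal_pdfE// /normal_fun subr0 exprMn sqr_sqrtr//.
have pk : Num.sqrt 2 * normal_peak (Num.sqrt 2 * s) = normal_peak s.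
  rewrite /normal_peak exprMn sqr_sqrtr// (_ : 2 * s ^+ 2 * pi *+ 2 = 2 * (s ^+ 2 * pi *+ 2)); last by ring.
  by rewrite sqrtrM// invfM mulrA divff ?mul1r// gt_eqF// sqrtr_gt0.
set y := x ^+ 2 / (4 * s ^+ 2).
have -> : - x ^+ 2 / (2 * s ^+ 2 *+ 2) = - y by rewrite /y; field.
have -> : - (x ^+ 2 / (s ^+ 2 *+ 2)) = - y + - y by rewrite /y; field.
have y0 : 0 <= y by rewrite divr_ge0 ?sqr_ge0// mulr_ge0// ltW.
have e1 : (1 + x ^+ 2) * expR (- y) <= 1 + 4 * s ^+ 2.
  have -> : x ^+ 2 = 4 * s ^+ 2 * y by rewrite /y; field.
  rewrite expRN ler_pdivrMr ?expR_gt0//.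
  have := expR_ge1Dx y; have := ltW s2; nra.
rewrite expRD -pk.
have -> (a b c u : R) : a * (u * b * (c * c)) = (a * c) * (u * (b * c)) by ring.
by rewrite -[leRHS]mulrA ler_wpM2r// !mulr_ge0 ?expR_ge0 ?normal_peak_ge0 ?sqrtr_ge0.
Qed.

Lemma gauss_integrable (h : R -> R) (C : R) : measurable_fun setT h ->
  (forall x, `|h x| <= C * (1 + x ^+ 2)) -> mu.-integrable setT (EFin \o (fun x => h x * p x)).
Proof.
move=> mh hC.
have C0 : 0 <= C by apply: le_trans (_ : C * (1 + 0 ^+ 2) <= C); rewrite ?(le_trans _ (hC 0))// expr0n addr0 mulr1.
apply: (@le_integrable _ _ _ mu setT measurableT _
  (fun x => (C * ((1 + 4 * s ^+ 2) * Num.sqrt 2))%:E * (normal_pdf 0 (Num.sqrt 2 * s) x)%:E)%E).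
- by apply/measurable_EFinP; apply: measurable_funM => //; exact: measurable_normal_pdf.
- move=> x _ /=; rewrite lee_fin normrM [`|p x|]ger0_norm ?normal_pdf_ge0//.
  rewrite (le_trans _ (ler_norm _))// -mulrA (le_trans (ler_wpM2r (normal_pdf_ge0 _ _ _) (hC x)))//.
  by rewrite -mulrA ler_wpM2l// normal_pdf_moment.
- by apply: integrableZl => //; exact: integrable_normal_pdf.
Qed.

Lemma normal_integral (h : R -> R) (C : R) : measurable_fun setT h ->
  (forall x, `|h x| <= C * (1 + x ^+ 2)) ->
  (normal_prob 0 s).-integrable setT (EFin \o h) /\
  \int[normal_prob 0 s]_x h x = \int[mu]_x (h x * p x).
Proof.
move=> mh hC; apply: integral_density => //.
- exact: measurable_normal_pdf.
- exact: normal_pdf_ge0.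
- exact: gauss_integrable hC.
Qed.

(** Stein's identity for the normal law: [integral_derive0] applied to g times the density, whose
    logarithmic derivative is - x / s^2. *)
Lemma normal_integral_derive0 (g g' : R -> R) (C : R) :
  (forall x : R, is_derive x 1 g (g' x)) ->
  continuous (fun x => g' x - x / s ^+ 2 * g x) ->
  (forall x, `|x| * `|g x| <= C * (1 + x ^+ 2)) ->
  (forall x, `|g' x - x / s ^+ 2 * g x| <= C * (1 + x ^+ 2)) ->
  \int[mu]_x ((g' x - x / s ^+ 2 * g x) * p x) = 0.
Proof.
move=> dg cg gC g'C.
have dgp (x : R) : is_derive x 1 (fun x => g x * p x) ((g' x - x / s ^+ 2 * g x) * p x).
  have dp := der_normal_pdf.
  der_tac. by ring.
have C0 : 0 <= C.
  by have := gC 0; rewrite normr0 mul0r expr0n addr0 mulr1.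
have [Fy FNy] : (fun x => g x * p x) x @[x --> +oo] --> (0:R) /\ (fun x => g x * p x) x @[x --> -oo] --> (0:R).
  apply: (@cvg0_decay _ _ (C * ((1 + 4 * s ^+ 2) * Num.sqrt 2 * normal_peak (Num.sqrt 2 * s)))) => x.
  rewrite normrM [`|p x|]ger0_norm ?normal_pdf_ge0// [leLHS]mulrA.
  rewrite (le_trans (ler_wpM2r (normal_pdf_ge0 _ _ _) (gC x)))// -[leLHS]mulrA ler_wpM2l//.
  rewrite (le_trans (normal_pdf_moment x))// ler_wpM2l//.
    by rewrite mulr_ge0// addr_ge0// mulr_ge0// ltW.
  by apply: normal_pdf_ub; rewrite mulf_neq0// gt_eqF// sqrtr_gt0.
apply: (integral_derive0 dgp) => //.
- move=> x; apply: (@continuousM _ _ (fun x => g' x - x / s ^+ 2 * g x) p); first exact: cg.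
  exact: continuous_normal_pdf.
- exact: gauss_integrable (continuous_measurable_fun cg) g'C.
Qed.

Lemma le_1_1Dsqr (x : R) : 1 <= 1 + x ^+ 2.
Proof. by rewrite lerDl sqr_ge0. Qed.

Lemma normal_integral1 : \int[mu]_x p x = 1.
Proof. by rewrite /Rintegral integral_normal_pdf. Qed.

Lemma normal_variance : \int[mu]_x (x ^+ 2 * p x) = s ^+ 2.
Proof.
have mi : mu.-integrable setT (EFin \o (fun x => x ^+ 2 * p x)).
  apply: (@gauss_integrable _ 1) => [|x]; first exact: measurable_funX.
  by rewrite mul1r ger0_norm ?sqr_ge0// lerDr.
have := @normal_integral_derive0 id (fun=> 1) (1 + (s ^+ 2)^-1).
have -> : (fun x : R => (1 - x / s ^+ 2 * id x) * p x) = (fun x => p x - (s ^+ 2)^-1 * (x ^+ 2 * p x)).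
  by apply/funext => x /=; ring.
rewrite RintegralB//; [|exact: integrable_normal_pdf|by apply: intZ].
rewrite RintegralZl// normal_integral1 => H.
have {}H : 1 - (s ^+ 2)^-1 * \int[mu]_x (x ^+ 2 * p x) = 0.
  have i0 : 0 <= (s ^+ 2)^-1 by rewrite invr_ge0 ltW.
  apply: H => [x|x|x] /=.
  - apply: cvgB; first exact: cvg_cst.
    by apply: cvgM => //; apply: cvgM => //; exact: cvg_cst.
  - by rewrite -expr2 real_normK ?num_real//; have := sqr_ge0 x; nra.
  - rewrite (le_trans (ler_normB _ _))// normr1 mulrAC -expr2 normrM [`|_^-1|]ger0_norm//.
    by rewrite [`|x ^+ 2|]ger0_norm ?sqr_ge0//; have := sqr_ge0 x; nra.
move/subr0_eq: H => /(congr1 ( *%R (s ^+ 2))); rewrite mulr1 mulrA divff ?mul1r ?gt_eqF//.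
Qed.

Let A (t : R) := \int[mu]_x (cos (t * x) * p x).
Let B (t : R) := \int[mu]_x (sin (t * x) * p x).

Let ccos t : continuous (fun x : R => cos (t * x)).
Proof. by move=> x; apply: is_derive_continuous; der. Qed.
Let csin t : continuous (fun x : R => sin (t * x)).
Proof. by move=> x; apply: is_derive_continuous; der. Qed.
Let mcos t : measurable_fun setT (fun x : R => cos (t * x)).
Proof. exact: continuous_measurable_fun. Qed.
Let msin t : measurable_fun setT (fun x : R => sin (t * x)).
Proof. exact: continuous_measurable_fun. Qed.
Let icos t : mu.-integrable setT (EFin \o (fun x => cos (t * x) * p x)).
Proof.
by apply: (@gauss_integrable _ 1) => // x; rewrite mul1r (le_trans (cos_max _))// le_1_1Dsqr.
Qed.
Let isin t : mu.-integrable setT (EFin \o (fun x => sin (t * x) * p x)).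
Proof.
by apply: (@gauss_integrable _ 1) => // x; rewrite mul1r (le_trans (sin_max _))// le_1_1Dsqr.
Qed.
Let ixcos t : mu.-integrable setT (EFin \o (fun x => x * cos (t * x) * p x)).
Proof.
apply: (@gauss_integrable _ 1) => [|x]; first exact: measurable_funM.
by rewrite mul1r normrM (le_trans _ (le1Dsqr x))// ler_piMr// cos_max.
Qed.
Let ixsin t : mu.-integrable setT (EFin \o (fun x => x * sin (t * x) * p x)).
Proof.
apply: (@gauss_integrable _ 1) => [|x]; first exact: measurable_funM.
by rewrite mul1r normrM (le_trans _ (le1Dsqr x))// ler_piMr// sin_max.
Qed.
Let iabs : mu.-integrable setT (EFin \o (fun x => `|x| * p x)).
Proof.
apply: (@gauss_integrable _ 1) => [|x]; first exact: continuous_measurable_fun (@norm_continuous _ R).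
by rewrite mul1r normr_id le1Dsqr.
Qed.

Let dA (t : R) : is_derive t 1 A (\int[mu]_x (- x * sin (t * x) * p x)).
Proof.
have d1 (u x : R) : is_derive u 1 (fun u => cos (u * x) * p x) (- x * sin (u * x) * p x).
  by der_tac; ring.
have d2 u x : `|- x * sin (u * x) * p x| <= `|x| * p x.
  rewrite !normrM ?normrN [`|p x|]ger0_norm ?normal_pdf_ge0//.
  by rewrite ler_wpM2r ?normal_pdf_ge0// ler_piMr// sin_max.
exact: (@is_derive_under_integral _ _ _ mu (fun t x => cos (t * x) * p x) (fun t x => - x * sin (t * x) * p x) _ t d1 icos iabs d2).
Qed.

Let dB (t : R) : is_derive t 1 B (\int[mu]_x (x * cos (t * x) * p x)).
Proof.
have d1 (u x : R) : is_derive u 1 (fun u => sin (u * x) * p x) (x * cos (u * x) * p x).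
  by der_tac; ring.
have d2 u x : `|x * cos (u * x) * p x| <= `|x| * p x.
  rewrite !normrM ?normrN [`|p x|]ger0_norm ?normal_pdf_ge0//.
  by rewrite ler_wpM2r ?normal_pdf_ge0// ler_piMr// cos_max.
exact: (@is_derive_under_integral _ _ _ mu (fun t x => sin (t * x) * p x) (fun t x => x * cos (t * x) * p x) _ t d1 isin iabs d2).
Qed.

Let xsinE t : \int[mu]_x (- x * sin (t * x) * p x) = - (s ^+ 2 * t) * A t.
Proof.
have := @normal_integral_derive0 (fun x => sin (t * x)) (fun x => t * cos (t * x)) (1 + `|t| + (s ^+ 2)^-1).
have -> : (fun x : R => (t * cos (t * x) - x / s ^+ 2 * sin (t * x)) * p x) =
   (fun x => t * (cos (t * x) * p x) - (s ^+ 2)^-1 * (x * sin (t * x) * p x)).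
  by apply/funext => x /=; ring.
rewrite RintegralB//; [|exact: intZ|exact: intZ].
rewrite !RintegralZl// -/(A t) => H.
have {}H : t * A t - (s ^+ 2)^-1 * \int[mu]_x (x * sin (t * x) * p x) = 0.
  have i0 : 0 <= (s ^+ 2)^-1 by rewrite invr_ge0 ltW.
  apply: H => [x|x|x|x] /=.
  - by der_tac; ring.
  - apply: is_derive_continuous; der.
  - by apply: moment_bound1 => //; exact: sin_max.
  - exact: (@moment_bound2 _ t (s ^+ 2)^-1 (sin (t * x)) (cos (t * x)) x i0 (sin_max _) (cos_max _)).
under eq_Rintegral do rewrite mulNr mulNr -mulN1r.
rewrite RintegralZl// mulN1r.
have -> : \int[mu]_x (x * sin (t * x) * p x) = s ^+ 2 * (t * A t).
  by rewrite (subr0_eq H) mulrA divff ?mul1r// gt_eqF.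
ring.
Qed.

Let xcosE t : \int[mu]_x (x * cos (t * x) * p x) = - (s ^+ 2 * t) * B t.
Proof.
have := @normal_integral_derive0 (fun x => cos (t * x)) (fun x => - (t * sin (t * x))) (1 + `|t| + (s ^+ 2)^-1).
have -> : (fun x : R => (- (t * sin (t * x)) - x / s ^+ 2 * cos (t * x)) * p x) =
   (fun x => (- t) * (sin (t * x) * p x) - (s ^+ 2)^-1 * (x * cos (t * x) * p x)).
  by apply/funext => x /=; ring.
rewrite RintegralB//; [|exact: intZ|exact: intZ].
rewrite !RintegralZl// -/(B t) => H.
have {}H : - t * B t - (s ^+ 2)^-1 * \int[mu]_x (x * cos (t * x) * p x) = 0.
  have i0 : 0 <= (s ^+ 2)^-1 by rewrite invr_ge0 ltW.
  apply: H => [x|x|x|x] /=.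
  - by der_tac; ring.
  - apply: is_derive_continuous; der.
  - by apply: moment_bound1 => //; exact: cos_max.
  - rewrite -mulrN; have sm : `|- sin (t * x)| <= 1 by rewrite normrN sin_max.
    exact: (@moment_bound2 _ t (s ^+ 2)^-1 (cos (t * x)) (- sin (t * x)) x i0 (cos_max _) sm).
have -> : \int[mu]_x (x * cos (t * x) * p x) = s ^+ 2 * (- t * B t).
  by rewrite (subr0_eq H) mulrA divff ?mul1r// gt_eqF.
ring.
Qed.

(** Stein's identity with a sine as test function turns the derivative in t into - s^2 t times the
    integral itself, so the product with exp(s^2 t^2 / 2) is constant. *)
Lemma gauss_cos t : \int[mu]_x (cos (t * x) * p x) = expR (- (s ^+ 2 * t ^+ 2 / 2)).
Proof.
rewrite -/(A t); have dA' := dA.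
suff : expR (s ^+ 2 * t ^+ 2 / 2) * A t = 1.
  by move=> /(canRL (mulKf _)) => ->; rewrite ?expRN ?mulr1// gt_eqF// expR_gt0.
have A0 : A 0 = 1.
  rewrite -normal_integral1; apply: eq_Rintegral => x _.
  by rewrite mul0r cos0 mul1r.
transitivity (expR (s ^+ 2 * 0 ^+ 2 / 2) * A 0); last first.
  by rewrite expr0n/= mulr0 mul0r expR0 A0 mulr1.
apply: (@is_derive_0_is_cst _ (fun t => expR (s ^+ 2 * t ^+ 2 / 2) * A t)) => x.
by der_tac; rewrite xsinE; field.
Qed.

Lemma gauss_sin t : \int[mu]_x (sin (t * x) * p x) = 0.
Proof.
rewrite -/(B t); have dB' := dB.
suff : expR (s ^+ 2 * t ^+ 2 / 2) * B t = 0.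
  by move/eqP; rewrite mulf_eq0 gt_eqF ?expR_gt0//= => /eqP.
have B0 : B 0 = 0.
  rewrite /B; under eq_Rintegral do rewrite mul0r sin0 mul0r.
  by rewrite Rintegral_cst// mul0r.
transitivity (expR (s ^+ 2 * 0 ^+ 2 / 2) * B 0); last first.
  by rewrite B0 mulr0.
apply: (@is_derive_0_is_cst _ (fun t => expR (s ^+ 2 * t ^+ 2 / 2) * B t)) => x.
by der_tac; rewrite xcosE; field.
Qed.

End gaussian.

(** * The square of a standard Gaussian *)

Section gaussian_square.
Context {R : realType}.
Local Notation mu := (@lebesgue_measure R).
Local Notation p := (normal_pdf (0 : R) 1).

Let n10 : (1 : R) != 0. Proof. exact: oner_neq0. Qed.

Let cc u : continuous (fun x : R => cos (u * x ^+ 2)).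
Proof. by move=> x; apply: is_derive_continuous; der. Qed.
Let cs u : continuous (fun x : R => sin (u * x ^+ 2)).
Proof. by move=> x; apply: is_derive_continuous; der. Qed.
Let mc u : measurable_fun setT (fun x : R => cos (u * x ^+ 2)).
Proof. exact: continuous_measurable_fun. Qed.
Let ms u : measurable_fun setT (fun x : R => sin (u * x ^+ 2)).
Proof. exact: continuous_measurable_fun. Qed.

Let icos u : mu.-integrable setT (EFin \o (fun x => cos (u * x ^+ 2) * p x)).
Proof.
by apply: (@gauss_integrable _ _ n10 _ 1) => // x; rewrite mul1r (le_trans (cos_max _))// le_1_1Dsqr.
Qed.
Let isin u : mu.-integrable setT (EFin \o (fun x => sin (u * x ^+ 2) * p x)).
Proof.
by apply: (@gauss_integrable _ _ n10 _ 1) => // x; rewrite mul1r (le_trans (sin_max _))// le_1_1Dsqr.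
Qed.
Let ixcos u : mu.-integrable setT (EFin \o (fun x => x ^+ 2 * cos (u * x ^+ 2) * p x)).
Proof.
apply: (@gauss_integrable _ _ n10 _ 1) => [|x]; first by apply: measurable_funM => //; exact: measurable_funX.
by rewrite mul1r normrM [`|x ^+ 2|]ger0_norm ?sqr_ge0// (le_trans _ (_ : x ^+ 2 <= _)) ?lerDr// ler_piMr ?sqr_ge0// cos_max.
Qed.
Let ixsin u : mu.-integrable setT (EFin \o (fun x => x ^+ 2 * sin (u * x ^+ 2) * p x)).
Proof.
apply: (@gauss_integrable _ _ n10 _ 1) => [|x]; first by apply: measurable_funM => //; exact: measurable_funX.
by rewrite mul1r normrM [`|x ^+ 2|]ger0_norm ?sqr_ge0// (le_trans _ (_ : x ^+ 2 <= _)) ?lerDr// ler_piMr ?sqr_ge0// sin_max.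
Qed.
Let isqr : mu.-integrable setT (EFin \o (fun x => x ^+ 2 * p x)).
Proof.
apply: (@gauss_integrable _ _ n10 _ 1) => [|x]; first exact: measurable_funX.
by rewrite mul1r [`|x ^+ 2|]ger0_norm ?sqr_ge0// lerDr.
Qed.

Let A u := \int[mu]_x (cos (u * x ^+ 2) * p x).
Let B u := \int[mu]_x (sin (u * x ^+ 2) * p x).
Let C u := \int[mu]_x (x ^+ 2 * cos (u * x ^+ 2) * p x).
Let S u := \int[mu]_x (x ^+ 2 * sin (u * x ^+ 2) * p x).

Let dA (u : R) : is_derive u 1 A (- S u).
Proof.
have d1 (v x : R) : is_derive v 1 (fun v => cos (v * x ^+ 2) * p x) (- (x ^+ 2 * sin (v * x ^+ 2) * p x)).
  by der_tac; ring.
have d2 v x : `|- (x ^+ 2 * sin (v * x ^+ 2) * p x)| <= x ^+ 2 * p x.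
  rewrite normrN normrM [`|p x|]ger0_norm ?normal_pdf_ge0// normrM [`|x ^+ 2|]ger0_norm ?sqr_ge0//.
  by rewrite ler_wpM2r ?normal_pdf_ge0// ler_piMr ?sqr_ge0// sin_max.
have := (@is_derive_under_integral _ _ _ mu (fun u x => cos (u * x ^+ 2) * p x) (fun u x => - (x ^+ 2 * sin (u * x ^+ 2) * p x)) _ u d1 icos isqr d2).
by under [X in is_derive _ _ _ X]eq_Rintegral do rewrite -mulN1r; rewrite RintegralZl// mulN1r.
Qed.

Let dB (u : R) : is_derive u 1 B (C u).
Proof.
have d1 (v x : R) : is_derive v 1 (fun v => sin (v * x ^+ 2) * p x) (x ^+ 2 * cos (v * x ^+ 2) * p x).
  by der_tac; ring.
have d2 v x : `|x ^+ 2 * cos (v * x ^+ 2) * p x| <= x ^+ 2 * p x.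
  rewrite normrM [`|p x|]ger0_norm ?normal_pdf_ge0// normrM [`|x ^+ 2|]ger0_norm ?sqr_ge0//.
  by rewrite ler_wpM2r ?normal_pdf_ge0// ler_piMr ?sqr_ge0// cos_max.
exact: (@is_derive_under_integral _ _ _ mu (fun u x => sin (u * x ^+ 2) * p x) (fun u x => x ^+ 2 * cos (u * x ^+ 2) * p x) _ u d1 isin isqr d2).
Qed.

Let bnd1 (x v u : R) : `|v| <= 1 -> `|x| * `|x * v| <= (2 + 2 * `|u|) * (1 + x ^+ 2).
Proof.
move=> v1; rewrite normrM mulrA -expr2 real_normK ?num_real//.
have := normr_ge0 u; have := sqr_ge0 x; set w := `|v| in v1 *; set z := `|u|; set y := x ^+ 2 => y0 z0.
by apply: (@le_trans _ _ y); [rewrite ler_piMr|nra].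
Qed.

Let bnd2 (x v w u : R) : `|v| <= 1 -> `|w| <= 1 ->
  `|v - 2 * u * (x ^+ 2 * w) - x ^+ 2 * v| <= (2 + 2 * `|u|) * (1 + x ^+ 2).
Proof.
move=> v1 w1; rewrite (le_trans (ler_normB _ _))// (le_trans (lerD (ler_normB _ _) (lexx _)))//.
rewrite normrM [`|2 * u|]normrM ![`|x ^+ 2 * _|]normrM ![`|x ^+ 2|]ger0_norm ?sqr_ge0// [`|2|]ger0_norm//.
have x0 := sqr_ge0 x; have u0 := normr_ge0 u.
have h1 : x ^+ 2 * `|w| <= x ^+ 2 by rewrite ler_piMr.
have h2 : x ^+ 2 * `|v| <= x ^+ 2 by rewrite ler_piMr.
have h3 : 2 * `|u| * (x ^+ 2 * `|w|) <= 2 * `|u| * x ^+ 2 by rewrite ler_wpM2l// mulr_ge0.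
by nra.
Qed.

(** Stein's identity with test function x cos(u x^2); the factor x produces the x^2 in both
    resulting terms. With [kB], the same for the sine, this is the system of [polar_ode] with k = c
    = 1/2, the Gamma parameters of a squared standard Gaussian. *)
Let kA u : 2^-1 * A u = 2^-1 * C u + u * S u.
Proof.
have := @normal_integral_derive0 _ _ n10 (fun x => x * cos (u * x ^+ 2))
  (fun x => cos (u * x ^+ 2) - 2 * u * (x ^+ 2 * sin (u * x ^+ 2))) (2 + 2 * `|u|).
have -> : (fun x : R => (cos (u * x ^+ 2) - 2 * u * (x ^+ 2 * sin (u * x ^+ 2)) - x / 1 ^+ 2 * (x * cos (u * x ^+ 2))) * p x) =
  (fun x => cos (u * x ^+ 2) * p x - 2 * u * (x ^+ 2 * sin (u * x ^+ 2) * p x) - x ^+ 2 * cos (u * x ^+ 2) * p x).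
  by apply/funext => x; field.
rewrite RintegralB//; last by apply: intB => //; exact: intZ.
rewrite RintegralB//; last exact: intZ.
rewrite RintegralZl// -/(A u) -/(C u) -/(S u) => H.
suff : A u - 2 * u * S u - C u = 0 by lra.
apply: H => [x|x|x|x].
- by der_tac; ring.
- by apply: is_derive_continuous; der.
- by apply: bnd1; exact: cos_max.
- have -> : x / 1 ^+ 2 * (x * cos (u * x ^+ 2)) = x ^+ 2 * cos (u * x ^+ 2) by field.
  by apply: bnd2; [exact: cos_max|exact: sin_max].
Qed.

Let kB u : 2^-1 * B u = 2^-1 * S u - u * C u.
Proof.
have := @normal_integral_derive0 _ _ n10 (fun x => x * sin (u * x ^+ 2))
  (fun x => sin (u * x ^+ 2) - 2 * u * (x ^+ 2 * - cos (u * x ^+ 2))) (2 + 2 * `|u|).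
have -> : (fun x : R => (sin (u * x ^+ 2) - 2 * u * (x ^+ 2 * - cos (u * x ^+ 2)) - x / 1 ^+ 2 * (x * sin (u * x ^+ 2))) * p x) =
  (fun x => sin (u * x ^+ 2) * p x - - (2 * u) * (x ^+ 2 * cos (u * x ^+ 2) * p x) - x ^+ 2 * sin (u * x ^+ 2) * p x).
  by apply/funext => x; field.
rewrite RintegralB//; last by apply: intB => //; exact: intZ.
rewrite RintegralB//; last exact: intZ.
rewrite RintegralZl// -/(B u) -/(C u) -/(S u) => H.
suff : B u - - (2 * u) * C u - S u = 0 by lra.
apply: H => [x|x|x|x].
- by der_tac; ring.
- by apply: is_derive_continuous; der.
- by apply: bnd1; exact: sin_max.
- have -> : x / 1 ^+ 2 * (x * sin (u * x ^+ 2)) = x ^+ 2 * sin (u * x ^+ 2) by field.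
  by apply: bnd2; [exact: sin_max|rewrite normrN cos_max].
Qed.

Lemma gauss_square u :
  \int[mu]_x (cos (u * x ^+ 2) * p x) = prho 2^-1 (2 * u) * cos (pang 2^-1 (2 * u)) /\
  \int[mu]_x (sin (u * x ^+ 2) * p x) = prho 2^-1 (2 * u) * sin (pang 2^-1 (2 * u)).
Proof.
have c0 : (0 : R) < 2^-1 by rewrite invr_gt0.
have B0 : B 0 = 0.
  rewrite /B; under eq_Rintegral do rewrite mul0r sin0 mul0r.
  by rewrite Rintegral_cst// mul0r.
have A0 : A 0 = 1.
  rewrite -(normal_integral1 1); apply: eq_Rintegral => x _.
  by rewrite mul0r cos0 mul1r.
have [] := polar_ode c0 dA dB kA kB B0 u.
by rewrite A0 mul1r invrK (mulrC u).
Qed.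

End gaussian_square.

(** * Exponential decay and translations of the line *)

Section exp_abs.
Context {R : realType}.
Local Notation mu := (@lebesgue_measure R).

Lemma integrable_exp_abs (k : R) : 0 < k ->
  mu.-integrable setT (EFin \o (fun w => expR (- (k * `|w|)))).
Proof.
move=> k0; have cE : continuous (fun w : R => expR (- (k * `|w|))).
  move=> x; apply: (cvg_comp (fun w : R => - (k * `|w|)) expR); last exact: continuous_expR.
  by apply: cvgN; apply: cvgM; [exact: cvg_cst|exact: norm_continuous].
apply/integrableP; split; first by apply/measurable_EFinP; exact: continuous_measurable_fun.
under eq_integral do rewrite /= ger0_norm ?expR_ge0//.
rewrite (ge0_symfun_integralT (f := fun w => expR (- (k * `|w|))))//; last first.
  by move=> x /=; rewrite normrN.
apply: lte_mul_pinfty => //.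
have mD : measurable [set x : R | 0 <= x].
  by rewrite (_ : [set _ | _] = `[0, +oo[%classic) // ; apply/seteqP; split => x /=; rewrite in_itv/= andbT.
rewrite [X in (X < _)%E](_ : _ = \int[mu]_(x in [set x | (0 <= x)%R]) ((k^-1)%:E * (exponential_pdf k x)%:E))%E; last first.
  apply: eq_integral => x; rewrite inE/= => x0.
  by rewrite exponential_pdfE// -EFinM mulrA mulVf ?gt_eqF// mul1r ger0_norm// mulNr.
have i0 := integrable_exponential_pdf k0.
rewrite integralZl//; last exact: integrableS i0.
apply: lte_mul_pinfty => //; first by rewrite lee_fin invr_ge0 ltW.
have : mu.-integrable [set x : R | 0 <= x] (EFin \o exponential_pdf k) by exact: integrableS i0.
move=> /integrableP[_]; apply: le_lt_trans; rewrite ge0_le_integral//=.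
- by move=> x _; rewrite lee_fin exponential_pdf_ge0// ltW.
- by apply/measurable_EFinP/measurable_funTS; exact: measurable_exponential_pdf.
- by apply/measurable_EFinP/measurable_funTS; apply: measurableT_comp => //; exact: measurable_exponential_pdf.
- by move=> x _; rewrite lee_fin ler_norm.
Qed.

Lemma ge0_integral_translation (G : R -> R) (a : R) : continuous G -> (forall x, 0 <= G x) ->
  (\int[mu]_x (G (x + a))%:E = \int[mu]_x (G x)%:E)%E.
Proof.
move=> cG G0; have dF (x : R) : is_derive x 1 (fun x : R => x + a) 1.
  by der_tac; rewrite addr0.
have F1 : (fun x : R => x + a)^`()%classic = cst 1.
  by apply/funext => x; rewrite derive1E; have [_ ->] := dF x.
rewrite (@increasing_ge0_integration_by_substitutionT _ (fun x => x + a) G)//.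
- by apply: eq_integral => x _; rewrite F1 !fctE/= mulr1.
- by move=> x y; rewrite ltrD2r.
- by rewrite F1; move=> x; exact: cvg_cst.
- by rewrite F1; exact: is_cvg_cst.
- by rewrite F1; exact: is_cvg_cst.
- by apply: cvg_addrr_Ny.
- by apply: cvg_addrr.
Qed.

End exp_abs.

(** * Gamma integrals in logarithmic coordinates *)

Section gamma.
Context {R : realType}.
Local Notation mu := (@lebesgue_measure R).

(** The unnormalized Gamma law x^(k-1) exp(- c x) dx after the substitution x = exp w. The kernel is
    smooth on the whole line, without the singularity at 0 that occurs for k < 1, and decays at both
    ends. *)
Definition gamma_kernel (k c w : R) := expR (k * w - c * expR w).

Lemma gamma_kernel_bound (k c : R) : 0 < k -> 0 < c ->
  exists M, forall w, gamma_kernel k c w <= M * expR (- (k * `|w|)).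
Proof.
(* The tangent to c exp w at [a] has slope 2k. As it lies below the curve, an exponent - k w remains
   for w >= 0. *)
move=> k0 c0; pose a := ln (2 * k / c).
exists (expR `|2 * k * (a - 1)|) => w.
rewrite -expRD ler_expR; have [w0|w0] := leP 0 w.
  rewrite [`|w|]ger0_norm//.
  have ca : c * expR a = 2 * k.
    by rewrite /a lnK ?posrE ?divr_gt0 ?mulr_gt0//; field; rewrite gt_eqF.
  have -> : c * expR w = 2 * k * expR (w - a).
    by rewrite -ca -mulrA -expRD addrC subrK.
  have e1 : 2 * k * (1 + (w - a)) <= 2 * k * expR (w - a).
    by rewrite ler_wpM2l ?expR_ge1Dx// mulr_ge0// ltW.
  have := ler_norm (2 * k * (a - 1)); lra.
rewrite [`|w|]ltr0_norm// mulrN opprK.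
by rewrite lerBlDr addrAC lerDr addr_ge0// mulr_ge0 ?expR_ge0// ltW.
Qed.

Lemma continuous_gamma_kernel k c : continuous (gamma_kernel k c).
Proof. by move=> x; apply: is_derive_continuous; rewrite /gamma_kernel; der. Qed.

Lemma integrable_gamma_kernel (k c : R) (h : R -> R) (C : R) : 0 < k -> 0 < c ->
  measurable_fun setT h -> (forall w, `|h w| <= C) ->
  mu.-integrable setT (EFin \o (fun w => h w * gamma_kernel k c w)).
Proof.
move=> k0 c0 mh hC; have [M HM] := gamma_kernel_bound k0 c0.
have mg : measurable_fun setT (gamma_kernel k c).
  by apply: continuous_measurable_fun; exact: continuous_gamma_kernel.
apply: (@int_le _ _ _ mu (fun w => h w * gamma_kernel k c w) (fun w => C * M * expR (- (k * `|w|)))).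
- exact: measurable_funM.
- by apply: intZ; exact: integrable_exp_abs.
- move=> w; rewrite normrM [`|gamma_kernel _ _ _|]ger0_norm ?expR_ge0// -mulrA.
  by apply: ler_pM => //; rewrite expR_ge0.
Qed.

Definition gamma_int (k c : R) := \int[mu]_w gamma_kernel k c w.

Lemma integrable_gamma_kernel1 (k c : R) : 0 < k -> 0 < c ->
  mu.-integrable setT (EFin \o gamma_kernel k c).
Proof.
move=> k0 c0; have := @integrable_gamma_kernel k c (cst 1) 1 k0 c0.
rewrite (_ : (fun w => cst 1 w * gamma_kernel k c w) = gamma_kernel k c); last first.
  by apply/funext => w; rewrite mul1r.
by apply => // w; rewrite normr1.
Qed.

Lemma gamma_kernelS k c w : expR w * gamma_kernel k c w = gamma_kernel (k + 1) c w.
Proof. by rewrite /gamma_kernel -expRD; congr expR; ring. Qed.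

Lemma gamma_int_scale (k c : R) : 0 < k -> 0 < c ->
  gamma_int k c = expR (- k * ln (2 * c)) * gamma_int k 2^-1.
Proof.
move=> k0 c0; rewrite /gamma_int -RintegralZl//; last first.
  by apply: integrable_gamma_kernel1 => //; rewrite invr_gt0.
rewrite /Rintegral.
rewrite -(@ge0_integral_translation _ _ (- ln (2 * c)))//; last 2 first.
- exact: continuous_gamma_kernel.
- by move=> w; exact: expR_ge0.
congr fine; apply: eq_integral => w _; congr EFin.
rewrite /gamma_kernel -expRD; congr expR.
rewrite expRD expRN lnK ?posrE ?mulr_gt0//; field.
by rewrite gt_eqF.
Qed.

Section cf.
Variables k c : R.
Hypotheses (k0 : 0 < k) (c0 : 0 < c).
Local Notation E := (gamma_kernel k c).
Local Notation E1 := (gamma_kernel (k + 1) c).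

Let k10 : 0 < k + 1. Proof. by rewrite addr_gt0. Qed.

Let cc s : continuous (fun w : R => cos (s * expR w)).
Proof. by move=> x; apply: is_derive_continuous; der. Qed.
Let cs s : continuous (fun w : R => sin (s * expR w)).
Proof. by move=> x; apply: is_derive_continuous; der. Qed.
Let mc s : measurable_fun setT (fun w : R => cos (s * expR w)).
Proof. exact: continuous_measurable_fun. Qed.
Let ms s : measurable_fun setT (fun w : R => sin (s * expR w)).
Proof. exact: continuous_measurable_fun. Qed.

Let icos k' s : 0 < k' -> mu.-integrable setT (EFin \o (fun w => cos (s * expR w) * gamma_kernel k' c w)).
Proof. by move=> k'0; apply: (@integrable_gamma_kernel _ _ _ 1) => // w; exact: cos_max. Qed.
Let isin k' s : 0 < k' -> mu.-integrable setT (EFin \o (fun w => sin (s * expR w) * gamma_kernel k' c w)).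
Proof. by move=> k'0; apply: (@integrable_gamma_kernel _ _ _ 1) => // w; exact: sin_max. Qed.

Let A s := \int[mu]_w (cos (s * expR w) * E w).
Let B s := \int[mu]_w (sin (s * expR w) * E w).
Let C s := \int[mu]_w (cos (s * expR w) * E1 w).
Let S s := \int[mu]_w (sin (s * expR w) * E1 w).

Let dA (s : R) : is_derive s 1 A (- S s).
Proof.
have d1 (v w : R) : is_derive v 1 (fun v => cos (v * expR w) * E w) (- (sin (v * expR w) * E1 w)).
  by der_tac; rewrite -gamma_kernelS; ring.
have d2 v w : `|- (sin (v * expR w) * E1 w)| <= E1 w.
  by rewrite normrN normrM [`|E1 _|]ger0_norm ?expR_ge0// ler_piMl ?expR_ge0// sin_max.
have := (@is_derive_under_integral _ _ _ mu (fun s w => cos (s * expR w) * E w) (fun s w => - (sin (s * expR w) * E1 w)) _ s d1 (fun s => icos s k0) (integrable_gamma_kernel1 k10 c0) d2).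
by under [X in is_derive _ _ _ X]eq_Rintegral do rewrite -mulN1r; rewrite RintegralZl// ?mulN1r//; exact: isin.
Qed.

Let dB (s : R) : is_derive s 1 B (C s).
Proof.
have d1 (v w : R) : is_derive v 1 (fun v => sin (v * expR w) * E w) (cos (v * expR w) * E1 w).
  by der_tac; rewrite -gamma_kernelS; ring.
have d2 v w : `|cos (v * expR w) * E1 w| <= E1 w.
  by rewrite normrM [`|E1 _|]ger0_norm ?expR_ge0// ler_piMl ?expR_ge0// cos_max.
exact: (@is_derive_under_integral _ _ _ mu (fun s w => sin (s * expR w) * E w) (fun s w => cos (s * expR w) * E1 w) _ s d1 (fun s => isin s k0) (integrable_gamma_kernel1 k10 c0) d2).
Qed.

Let vanish (h : R -> R) : (forall w, `|h w| <= 1) ->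
  (fun w => h w * E w) w @[w --> +oo] --> (0:R) /\ (fun w => h w * E w) w @[w --> -oo] --> (0:R).
Proof.
move=> h1; have [M HM] := gamma_kernel_bound k0 c0.
apply: (@cvg0_decay _ _ (M / k)) => w.
have M0 : 0 <= M.
  by have := HM 0; rewrite normr0 mulr0 oppr0 expR0 mulr1; apply: le_trans; rewrite expR_ge0.
rewrite normrM [`|E _|]ger0_norm ?expR_ge0//.
apply: (@le_trans _ _ (`|w| * (M * expR (- (k * `|w|))))).
  by rewrite ler_wpM2l// (le_trans _ (HM w))// ler_piMl ?expR_ge0.
rewrite mulrCA ler_wpM2l// expRN ler_pdivrMr ?expR_gt0// ler_pdivlMl//.
by rewrite (le_trans _ (expR_ge1Dx _))// lerDr.
Qed.

Let kA s : k * A s = c * C s + s * S s.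
Proof.
have dF (w : R) : is_derive w 1 (fun w => cos (s * expR w) * E w)
   (k * (cos (s * expR w) * E w) - c * (cos (s * expR w) * E1 w) - s * (sin (s * expR w) * E1 w)).
  rewrite -gamma_kernelS /gamma_kernel; der_tac.
  by ring.
have [Fy FNy] := vanish (fun w => cos_max (s * expR w)).
have := integral_derive0 dF _ Fy FNy _.
rewrite RintegralB//; [|by apply: intB; apply: intZ; exact: icos|by apply: intZ; exact: isin].
rewrite RintegralB//; [|by apply: intZ; exact: icos|by apply: intZ; exact: icos].
rewrite !RintegralZl//; [|exact: isin|exact: icos|exact: icos].
rewrite -/(A s) -/(C s) -/(S s) => H.
suff : k * A s - c * C s - s * S s = 0 by lra.
apply: H; last by apply: intB; [apply: intB; apply: intZ; exact: icos|apply: intZ; exact: isin].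
by move=> w; apply: is_derive_continuous; rewrite /gamma_kernel; der.
Qed.

Let kB s : k * B s = c * S s - s * C s.
Proof.
have dF (w : R) : is_derive w 1 (fun w => sin (s * expR w) * E w)
   (k * (sin (s * expR w) * E w) - c * (sin (s * expR w) * E1 w) - (- s) * (cos (s * expR w) * E1 w)).
  rewrite -gamma_kernelS /gamma_kernel; der_tac.
  by ring.
have [Fy FNy] := vanish (fun w => sin_max (s * expR w)).
have := integral_derive0 dF _ Fy FNy _.
rewrite RintegralB//; [|by apply: intB; apply: intZ; exact: isin|by apply: intZ; exact: icos].
rewrite RintegralB//; [|by apply: intZ; exact: isin|by apply: intZ; exact: isin].
rewrite !RintegralZl//; [|exact: icos|exact: isin|exact: isin].
rewrite -/(B s) -/(C s) -/(S s) => H.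
suff : k * B s - c * S s - - s * C s = 0 by lra.
apply: H; last by apply: intB; [apply: intB; apply: intZ; exact: isin|apply: intZ; exact: icos].
by move=> w; apply: is_derive_continuous; rewrite /gamma_kernel; der.
Qed.

(** Differentiating under the integral multiplies the kernel by exp w, that is, raises k by one;
    integrating the derivative of the kernel times cos(s exp w) or sin(s exp w) expresses the new
    integrals through the old ones. In complex form the result is the total mass times (1 - i s /
    c)^(-k). *)
Lemma gamma_cf s :
  \int[mu]_w (cos (s * expR w) * E w) =
    gamma_int k c * prho k (s / c) * cos (pang k (s / c)) /\
  \int[mu]_w (sin (s * expR w) * E w) =
    gamma_int k c * prho k (s / c) * sin (pang k (s / c)).
Proof.
have B0 : B 0 = 0.
  rewrite /B; under eq_Rintegral do rewrite mul0r sin0 mul0r.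
  by rewrite Rintegral_cst// mul0r.
have A0 : A 0 = gamma_int k c.
  by apply: eq_Rintegral => w _; rewrite mul0r cos0 mul1r.
by have [] := polar_ode c0 dA dB kA kB B0 s; rewrite A0.
Qed.

End cf.
End gamma.

(** * Fourier uniqueness *)

Section fubini.
Context {R : realType}.

Lemma Rintegral_Fubini d1 d2 (T1 : measurableType d1) (T2 : measurableType d2)
    (m1 : {sigma_finite_measure set T1 -> \bar R})
    (m2 : {sigma_finite_measure set T2 -> \bar R}) (f : T1 * T2 -> R) (C : T1 -> R) :
  measurable_fun setT f ->
  (forall x, m2.-integrable setT (EFin \o (fun y => f (x, y)))) ->
  (forall y, m1.-integrable setT (EFin \o (fun x => f (x, y)))) ->
  (forall x, \int[m2]_y `|f (x, y)| <= C x) ->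
  m1.-integrable setT (EFin \o C) ->
  \int[m1]_x \int[m2]_y f (x, y) = \int[m2]_y \int[m1]_x f (x, y).
Proof.
move=> mf i2 i1 fC iC.
have mfE : measurable_fun setT (EFin \o f) by exact/measurable_EFinP.
have fi : (m1 \x m2)%E.-integrable setT (EFin \o f).
  apply/integrable12ltyP => //.
  move/integrableP: iC => [mC]; apply: le_lt_trans.
  have ma : measurable_fun setT (fun z => `|(EFin \o f) z|%E) by exact: measurableT_comp.
  apply: ge0_le_integral => //.
  - by move=> x _; apply: integral_ge0.
  - exact: (@measurable_fun_fubini_tonelli_F _ _ _ _ _ m2 _ ma).
  - exact: measurableT_comp.
  - move=> x _ /=; have := fC x; rewrite /Rintegral => h.
    have i2x := i2 x.
    rewrite -(@fineK _ (\int[m2]_y _)%E); last first.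
      by apply: (integrable_fin_num measurableT); apply: integrable_abse (i2 x).
    by rewrite lee_fin (le_trans h)// ler_norm.
have := @Fubini _ _ _ _ _ m1 m2 _ fi.
rewrite /Rintegral => H; congr fine.
transitivity (\int[m1]_x \int[m2]_y (EFin \o f) (x, y))%E.
  by apply: eq_integral => x _; rewrite fineK//; exact: (integrable_fin_num measurableT (i2 x)).
by rewrite H; apply: eq_integral => y _; rewrite fineK//; exact: (integrable_fin_num measurableT (i1 y)).
Qed.

Lemma ge0_integrable_Rintegral d (T : measurableType d) (m : {measure set T -> \bar R})
    (f : T -> R) : measurable_fun setT f -> (forall x, 0 <= f x) ->
  \int[m]_x f x != 0 -> m.-integrable setT (EFin \o f).
Proof.
move=> mf f0 i0; apply/integrableP; split; first exact/measurable_EFinP.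
under eq_integral do rewrite /= ger0_norm//.
by move: i0; rewrite /Rintegral; case: (integral _ _ _) => //= [r|]; rewrite ?ltry ?eqxx.
Qed.

End fubini.

(** * Smoothing by a Gaussian kernel *)

Section fourier.
Context {R : realType}.
Local Notation mu := (@lebesgue_measure R).
Local Notation p := (normal_pdf (0 : R) 1).

Let n10 : (1 : R) != 0. Proof. exact: oner_neq0. Qed.
Let mp : measurable_fun setT p. Proof. exact: measurable_normal_pdf. Qed.

Let pE (x : R) : p x = normal_peak 1 * \int[mu]_u (cos (x * u) * p u).
Proof.
by rewrite gauss_cos// (normal_pdf0E n10); congr (_ * expR _); field.
Qed.

Let ip : mu.-integrable setT (EFin \o p). Proof. exact: integrable_normal_pdf. Qed.

Let ibp (h : R -> R) (M : R) : measurable_fun setT h -> (forall x, `|h x| <= M) ->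
  mu.-integrable setT (EFin \o (fun x => h x * p x)).
Proof.
move=> mh hM; apply: (gauss_integrable n10 (C := M)) => // x.
have M0 : 0 <= M by apply: le_trans (hM 0).
by rewrite (le_trans (hM x))// ler_peMr// le_1_1Dsqr.
Qed.

Let continuous_affine_comp (g : R -> R) (a b : R) : continuous g ->
  continuous (fun y => g (a + b * y)).
Proof.
move=> cg y; have c1 : {for y, continuous (fun y => a + b * y)}.
  by apply: is_derive_continuous; der.
exact: (@continuous_comp _ _ _ (fun y => a + b * y) g y c1 (cg _)).
Qed.

Section one_space.
Context d (T : measurableType d) (P : probability T R).
Variables (W Z : T -> R) (M : R).
Hypotheses (mW : measurable_fun setT W) (mZ : measurable_fun setT Z).
Hypothesis WM : forall w, `|W w| <= M.

Let M0 : 0 <= M.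
Proof.
have [w _] : exists w : T, setT w.
  apply: contrapT => /forallNP h; have := @probability_setT _ _ _ P.
  rewrite (_ : setT = set0); last by apply/seteqP; split => // w; have := h w.
  by rewrite measure0 => /eqP; rewrite eqe eq_sym oner_eq0.
by apply: le_trans (WM w).
Qed.

(** The standard normal density is, up to the factor [normal_peak 1], its own Fourier transform.
    Writing the kernel as an integral of cosines and exchanging the integrals leaves only the
    characteristic function of Z weighted by W. *)
Lemma smoothed_kernel (a y : R) :
  \int[P]_w (W w * p ((y - Z w) * a)) =
  \int[mu]_u (normal_peak 1 * (cos (u * a * y) * (\int[P]_w (W w * cos (u * a * Z w)))
     + sin (u * a * y) * (\int[P]_w (W w * sin (u * a * Z w)))) * p u).
Proof.
have mcZ u : measurable_fun setT (fun w => cos (u * a * Z w)).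
  apply: (measurableT_comp (f := cos)); first exact: continuous_measurable_fun (@continuous_cos R).
  exact: measurable_funM.
have msZ u : measurable_fun setT (fun w => sin (u * a * Z w)).
  apply: (measurableT_comp (f := sin)); first exact: continuous_measurable_fun (@continuous_sin R).
  exact: measurable_funM.
have iWc u : P.-integrable setT (EFin \o (fun w => W w * cos (u * a * Z w))).
  apply: (@bounded_integrable _ _ _ _ _ M); first exact: measurable_funM.
  by move=> w; rewrite normrM (le_trans _ (WM w))// ler_piMr// cos_max.
have iWs u : P.-integrable setT (EFin \o (fun w => W w * sin (u * a * Z w))).
  apply: (@bounded_integrable _ _ _ _ _ M); first exact: measurable_funM.
  by move=> w; rewrite normrM (le_trans _ (WM w))// ler_piMr// sin_max.
pose f (z : T * R) := normal_peak 1 * (W z.1 * cos ((y - Z z.1) * a * z.2) * p z.2).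
have mf : measurable_fun setT f.
  apply: measurable_funM => //; apply: measurable_funM.
    apply: measurable_funM; first exact: (measurableT_comp mW).
    apply: (measurableT_comp (f := cos)); first exact: continuous_measurable_fun (@continuous_cos R).
    apply: measurable_funM => //; apply: measurable_funM => //; apply: measurable_funB => //.
    exact: (measurableT_comp mZ).
  exact: (measurableT_comp mp).
have fb w x : `|f (w, x)| <= normal_peak 1 * (M * p x).
  rewrite /f/= normrM [`|normal_peak _|]ger0_norm ?normal_peak_ge0// ler_wpM2l ?normal_peak_ge0//.
  rewrite normrM [`|p x|]ger0_norm ?normal_pdf_ge0// ler_wpM2r ?normal_pdf_ge0//.
  by rewrite normrM (le_trans _ (WM w))// ler_piMr// cos_max.
have ib : mu.-integrable setT (EFin \o (fun x => normal_peak 1 * (M * p x))).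
  by apply: intZ; apply: intZ.
have i2 w : mu.-integrable setT (EFin \o (fun x => f (w, x))).
  apply: (@int_le _ _ _ mu _ _ _ ib (fb w)).
  exact: measurableT_comp mf (pair1_measurable w).
have i1 x : P.-integrable setT (EFin \o (fun w => f (w, x))).
  apply: (@bounded_integrable _ _ _ _ _ (normal_peak 1 * (M * p x))) => [|w]; last exact: fb.
  exact: measurableT_comp mf (pair2_measurable x).
have := @Rintegral_Fubini _ _ _ _ _ P mu f (cst (\int[mu]_x (normal_peak 1 * (M * p x)))) mf i2 i1.
have -> : \int[P]_w \int[mu]_x f (w, x) = \int[P]_w (W w * p ((y - Z w) * a)).
  apply: eq_Rintegral => w _; rewrite pE mulrCA -RintegralZl//; last first.
    apply: (ibp _ (M := 1)) => [|x]; last exact: cos_max.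
    by apply: continuous_measurable_fun => x; apply: is_derive_continuous; der.
  rewrite -RintegralZl//; last first.
    apply: intZ; apply: (ibp _ (M := 1)) => [|x]; last exact: cos_max.
    by apply: continuous_measurable_fun => x; apply: is_derive_continuous; der.
  by apply: eq_Rintegral => x _; rewrite /f/=; ring.
move=> ->; first last.
- exact: finite_measure_integrable_cst.
- move=> w /=; apply: le_Rintegral => //; exact: (integrable_norm (i2 w)).
apply: eq_Rintegral => u _.
rewrite -!RintegralZl// -RintegralD//; [|exact: intZ|exact: intZ].
rewrite -mulrA -RintegralZr//; last by apply: intD; exact: intZ.
rewrite -RintegralZl//; last first.
  have iz : P.-integrable setT (EFin \o (fun w => p u * (cos (u * a * y) * (W w * cos (u * a * Z w)) +
    sin (u * a * y) * (W w * sin (u * a * Z w))))).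
    by apply: intZ; apply: intD; exact: intZ.
  by apply: eq_integrable iz => // w _ /=; rewrite mulrC.
apply: eq_Rintegral => w _; rewrite /f/=.
have -> : (y - Z w) * a * u = u * a * y - u * a * Z w by ring.
by rewrite cosB; ring.
Qed.

Definition smooth (g : R -> R) (e x : R) := \int[mu]_y (g (x + e * y) * p y).

(** The change of variables is made in the integral of a nonnegative function. This is the origin of
    the sign condition on g, which [fourier_unique] removes by adding a constant. *)
Lemma smoothE (g : R -> R) (e x : R) : 0 < e -> continuous g -> (forall x, 0 <= g x) ->
  smooth g e x = \int[mu]_y (g y * (e^-1 * p ((y - x) * e^-1))).
Proof.
move=> e0 cg g0; rewrite /smooth /Rintegral; congr fine.
have dF (y : R) : is_derive y 1 (fun y => (y - x) * e^-1) e^-1.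
  by der_tac; ring.
have F1 : (fun y => (y - x) * e^-1)^`()%classic = cst e^-1.
  by apply/funext => y; rewrite derive1E; have [_ ->] := dF y.
rewrite (@increasing_ge0_integration_by_substitutionT _ (fun y => (y - x) * e^-1) (fun y => g (x + e * y) * p y))//.
- apply: eq_integral => y _; rewrite F1 !fctE/=; congr EFin.
  have -> : x + e * ((y - x) / e) = y by field; rewrite gt_eqF.
  by ring.
- by move=> u v uv; rewrite ltr_pM2r ?invr_gt0// ltrD2r.
- by rewrite F1; move=> z; exact: cvg_cst.
- by rewrite F1; exact: is_cvg_cst.
- by rewrite F1; exact: is_cvg_cst.
- by apply/gt0_cvgMlNy; rewrite ?invr_gt0//; exact: cvg_addrr_Ny.
- by apply/gt0_cvgMly; rewrite ?invr_gt0//; exact: cvg_addrr.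
- move=> y; apply: cvgM; last exact: continuous_normal_pdf.
  exact: continuous_affine_comp.
- by move=> y; rewrite mulr_ge0 ?normal_pdf_ge0.
Qed.

Lemma smooth_cvg (g : R -> R) (K x : R) : continuous g -> (forall x, `|g x| <= K) ->
  smooth g n.+1%:R^-1 x @[n --> \oo] --> g x.
Proof.
move=> cg gK.
have [||||_] := @dominated_cvgR _ _ _ mu (fun n y => g (x + n.+1%:R^-1 * y) * p y) (fun y => g x * p y) (fun y => K * p y).
- move=> n; apply: measurable_funM => //; apply: continuous_measurable_fun.
  exact: continuous_affine_comp.
- exact: intZ.
- move=> y; apply: cvgM; last exact: cvg_cst.
  apply: (cvg_comp (fun n => x + n.+1%:R^-1 * y) g); last exact: cg.
  have : (x + n.+1%:R^-1 * y) @[n --> \oo] --> x + 0 * y.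
    apply: cvgD; first exact: cvg_cst.
    by apply: cvgM; [exact: cvg_harmonic|exact: cvg_cst].
  by rewrite mul0r addr0.
- move=> n y; rewrite normrM [`|p y|]ger0_norm ?normal_pdf_ge0//.
  by rewrite ler_wpM2r ?normal_pdf_ge0.
by rewrite RintegralZl// normal_integral1 mulr1.
Qed.

Lemma smooth_bound (g : R -> R) (K e x : R) : continuous g -> (forall x, `|g x| <= K) ->
  `|smooth g e x| <= K.
Proof.
move=> cg gK; have mg : measurable_fun setT (fun y => g (x + e * y)).
  by apply: continuous_measurable_fun; exact: continuous_affine_comp.
have i1 : mu.-integrable setT (EFin \o (fun y => g (x + e * y) * p y)) by apply: ibp mg _.
apply: (le_trans (le_normr_Rintegral _ i1)) => //.
rewrite -[leRHS]mulr1 -[X in _ <= _ * X](normal_integral1 1) -RintegralZl//.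
apply: le_Rintegral => //; [exact: (integrable_norm i1)|exact: intZ|].
by move=> y _; rewrite normrM [`|p y|]ger0_norm ?normal_pdf_ge0// ler_wpM2r ?normal_pdf_ge0.
Qed.

Lemma measurable_smooth (g : R -> R) (e : R) : continuous g -> (forall x, 0 <= g x) ->
  measurable_fun setT (smooth g e).
Proof.
move=> cg g0.
pose f (z : R * R) := g (z.1 + e * z.2) * p z.2.
have mf : measurable_fun setT (EFin \o f).
  apply/measurable_EFinP; apply: measurable_funM; last exact: (measurableT_comp mp).
  apply: (measurableT_comp (f := g)); first exact: continuous_measurable_fun.
  by apply: measurable_funD => //; apply: measurable_funM.
have f0 z : (0 <= (EFin \o f) z)%E by rewrite lee_fin mulr_ge0 ?normal_pdf_ge0.
have := @measurable_fun_fubini_tonelli_F _ _ _ _ _ mu _ mf f0.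
by move=> h; exact: (measurableT_comp (fine_measurable measurableT) h).
Qed.

Lemma smooth_expectation (g : R -> R) (K e : R) : 0 < e -> continuous g ->
  (forall x, 0 <= g x) -> (forall x, `|g x| <= K) ->
  \int[P]_w (W w * smooth g e (Z w)) =
  \int[mu]_y (g y * e^-1 * \int[P]_w (W w * p ((y - Z w) * e^-1))).
Proof.
move=> e0 cg g0 gK; have K0 : 0 <= K by apply: le_trans (gK 0).
pose f (z : T * R) := W z.1 * (g z.2 * (e^-1 * p ((z.2 - Z z.1) * e^-1))).
have mg : measurable_fun setT g by exact: continuous_measurable_fun.
have mf : measurable_fun setT f.
  apply: measurable_funM; first exact: (measurableT_comp mW).
  apply: measurable_funM; first exact: (measurableT_comp mg).
  apply: measurable_funM => //; apply: (measurableT_comp mp).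
  by apply: measurable_funM => //; apply: measurable_funB => //; exact: (measurableT_comp mZ).
have k0 y w : 0 <= e^-1 * p ((y - Z w) * e^-1).
  by rewrite mulr_ge0 ?invr_ge0 ?normal_pdf_ge0// ltW.
have k1 w : \int[mu]_y (e^-1 * p ((y - Z w) * e^-1)) = 1.
  have c1 : continuous (cst 1 : R -> R) by move=> x; exact: cvg_cst.
  have := @smoothE (cst 1) e (Z w) e0 c1 (fun=> ler01); rewrite /smooth.
  under eq_Rintegral do rewrite mul1r.
  rewrite normal_integral1 => h; apply: etrans (esym h).
  by apply: eq_Rintegral => y _; rewrite mul1r.
have ki w : mu.-integrable setT (EFin \o (fun y => e^-1 * p ((y - Z w) * e^-1))).
  apply: (@ge0_integrable_Rintegral _ _ _ mu (fun y => e^-1 * p ((y - Z w) * e^-1))) => //.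
    apply: measurable_funM => //; apply: (measurableT_comp mp).
    by apply: measurable_funM => //; apply: measurable_funB.
  by rewrite k1 oner_neq0.
have fb w y : `|f (w, y)| <= M * K * (e^-1 * p ((y - Z w) * e^-1)).
  rewrite /f/= normrM normrM [`|e^-1 * _|]ger0_norm// mulrA ler_wpM2r//.
  by apply: ler_pM.
have i2 w : mu.-integrable setT (EFin \o (fun y => f (w, y))).
  apply: (@int_le _ _ _ mu _ _ _ (intZ _ (ki w)) (fb w)).
  exact: measurableT_comp mf (pair1_measurable w).
have i1 y : P.-integrable setT (EFin \o (fun w => f (w, y))).
  apply: (@bounded_integrable _ _ _ _ _ (M * K * (e^-1 * normal_peak 1))).
    exact: measurableT_comp mf (pair2_measurable y).
  move=> w; rewrite (le_trans (fb w y))// ler_wpM2l ?mulr_ge0//.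
  by apply: ler_wpM2l; [rewrite invr_ge0 ltW|exact: normal_pdf_ub].
have := @Rintegral_Fubini _ _ _ _ _ P mu f (cst (M * K)) mf i2 i1.
have -> : \int[P]_w \int[mu]_x f (w, x) = \int[P]_w (W w * smooth g e (Z w)).
  apply: eq_Rintegral => w _; rewrite smoothE// -RintegralZl//.
  apply: (@int_le _ _ _ mu _ _ _ (intZ K (ki w))).
    apply: measurable_funM => //; exact: (measurable_EFinP _ _).1 (measurable_int mu (ki w)).
  by move=> y; rewrite normrM [`|e^-1 * _|]ger0_norm// ler_wpM2r.
move=> ->; first last.
- exact: finite_measure_integrable_cst.
- move=> w /=; rewrite -[leRHS]mulr1 -[X in _ <= _ * X](k1 w) -RintegralZl//.
  by apply: le_Rintegral => //; [exact: (integrable_norm (i2 w))|exact: intZ].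
apply: eq_Rintegral => y _; rewrite -RintegralZl//; last first.
  apply: (@bounded_integrable _ _ _ _ _ (M * normal_peak 1)).
    apply: measurable_funM => //; apply: (measurableT_comp mp).
    by apply: measurable_funM => //; apply: measurable_funB.
  move=> w; rewrite normrM [`|p _|]ger0_norm ?normal_pdf_ge0//.
  by apply: ler_pM => //; rewrite ?normal_pdf_ge0// normal_pdf_ub.
by apply: eq_Rintegral => w _; rewrite /f/=; ring.
Qed.

Lemma smooth_expectation_cvg (g : R -> R) (K : R) : continuous g ->
  (forall x, 0 <= g x) -> (forall x, `|g x| <= K) ->
  (\int[P]_w (W w * smooth g n.+1%:R^-1 (Z w))) @[n --> \oo] --> \int[P]_w (W w * g (Z w)).
Proof.
move=> cg g0 gK.
have [||||] // := @dominated_cvgR _ _ _ P (fun n w => W w * smooth g n.+1%:R^-1 (Z w)) (fun w => W w * g (Z w)) (cst (M * K)).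
- move=> n; apply: measurable_funM => //; apply: measurableT_comp => //; exact: measurable_smooth.
- exact: finite_measure_integrable_cst.
- move=> w; apply: cvgM; first exact: cvg_cst.
  exact: smooth_cvg cg gK.
- by move=> n w; rewrite normrM; apply: ler_pM => //; exact: smooth_bound.
Qed.

End one_space.

(** The expectation of the smoothed g is an integral of g against the kernel of [smoothed_kernel],
    hence determined by the weighted characteristic functions; the smoothing parameter then tends to
    0. The weight may change sign, which makes it possible to treat one coordinate while the others
    are stored in the weight. *)
Lemma fourier_unique d (T : measurableType d) (P : probability T R) (W Z : T -> R)
    d' (T' : measurableType d') (P' : probability T' R) (W' Z' : T' -> R) (M : R) :
  measurable_fun setT W -> measurable_fun setT Z -> (forall w, `|W w| <= M) ->
  measurable_fun setT W' -> measurable_fun setT Z' -> (forall w, `|W' w| <= M) ->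
  (forall t, \int[P]_w (W w * cos (t * Z w)) = \int[P']_w (W' w * cos (t * Z' w))) ->
  (forall t, \int[P]_w (W w * sin (t * Z w)) = \int[P']_w (W' w * sin (t * Z' w))) ->
  forall (g : R -> R) (K : R), continuous g -> (forall x, `|g x| <= K) ->
  \int[P]_w (W w * g (Z w)) = \int[P']_w (W' w * g (Z' w)).
Proof.
move=> mW mZ WM mW' mZ' WM' hc hs.
(* Adding the bound K makes g nonnegative. The added terms agree because the cosine hypothesis at t
   = 0 equates the integrals of the weights. *)
suff pos (g : R -> R) (K : R) : continuous g -> (forall x, 0 <= g x) -> (forall x, `|g x| <= K) ->
  \int[P]_w (W w * g (Z w)) = \int[P']_w (W' w * g (Z' w)).
  move=> g K cg gK.
  have [ci i] : \int[P]_w (W w * K) = \int[P']_w (W' w * K) /\ True.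
    split=> //; have iW : P.-integrable setT (EFin \o W) by exact: bounded_integrable WM.
    have iW' : P'.-integrable setT (EFin \o W') by exact: bounded_integrable WM'.
    rewrite !RintegralZr//; congr (_ * _); have := hc 0.
    under eq_Rintegral do rewrite mul0r cos0 mulr1.
    by under [X in _ = X -> _]eq_Rintegral do rewrite mul0r cos0 mulr1.
  have mg : measurable_fun setT g by exact: continuous_measurable_fun.
  have K0 : 0 <= K by apply: le_trans (gK 0).
  have := pos (fun x => g x + K) (K + K).
  have E (d0 : measure_display) (T0 : measurableType d0) (P0 : probability T0 R) (W0 Z0 : T0 -> R) :
    measurable_fun setT W0 -> measurable_fun setT Z0 -> (forall w, `|W0 w| <= M) ->
    \int[P0]_w (W0 w * (g (Z0 w) + K)) = \int[P0]_w (W0 w * g (Z0 w)) + \int[P0]_w (W0 w * K).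
    move=> mW0 mZ0 W0M; rewrite -RintegralD//.
    - by apply: eq_Rintegral => w _; rewrite mulrDr.
    - apply: (@bounded_integrable _ _ _ _ _ (M * K)).
        by apply: measurable_funM => //; exact: measurableT_comp.
      by move=> w; rewrite normrM; apply: ler_pM.
    - apply: (@bounded_integrable _ _ _ _ _ (M * K)); first exact: measurable_funM.
      by move=> w; rewrite normrM; apply: ler_pM => //; rewrite ger0_norm.
  rewrite !E// ci => H; apply: (addIr (\int[P']_w (W' w * K))); apply: H.
  - by move=> x; apply: cvgD; [exact: cg|exact: cvg_cst].
  - by move=> x; have := gK x; rewrite ler_norml => /andP[+ _]; lra.
  - by move=> x; rewrite (le_trans (ler_normD _ _))// lerD// ger0_norm.
move=> cg g0 gK.
have c1 := smooth_expectation_cvg (P := P) mW mZ WM cg g0 gK.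
have c2 := smooth_expectation_cvg (P := P') mW' mZ' WM' cg g0 gK.
apply: (cvg_unique _ c1) => //.
suff -> : (fun n => \int[P]_w (W w * smooth g n.+1%:R^-1 (Z w))) =
   (fun n => \int[P']_w (W' w * smooth g n.+1%:R^-1 (Z' w))) by [].
apply/funext => n.
rewrite (smooth_expectation P mW mZ WM _ cg g0 gK) ?invr_gt0//.
rewrite (smooth_expectation P' mW' mZ' WM' _ cg g0 gK) ?invr_gt0//.
apply: eq_Rintegral => y _; congr (_ * _).
rewrite (smoothed_kernel P mW mZ WM) (smoothed_kernel P' mW' mZ' WM').
by apply: eq_Rintegral => u _; rewrite hc hs.
Qed.

End fourier.

(** * Finite chaos sums *)

Section law.
Context {R : realType} d (T : measurableType d) (P : probability T R).
Local Notation mu := (@lebesgue_measure R).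

Section density_of_law.
Variables (Z : T -> R) (p : R -> R).
Hypotheses (mZ : measurable_fun setT Z) (mp : measurable_fun setT p).
Hypothesis p0 : forall x, 0 <= p x.
Hypothesis pE : forall A : set R, measurable A ->
  (P (Z @^-1` A) = \int[mu]_(x in A) (p x)%:E)%E.

Let mZ' : measurable_fun setT (Z : T -> measurableTypeR R). Proof. exact: mZ. Qed.
Let Z' : {RV P >-> measurableTypeR R} :=
  HB.pack (Z : T -> measurableTypeR R) (isMeasurableFun.Build _ _ _ _ _ mZ').

Lemma law_density (f : R -> R) : measurable_fun setT f ->
  mu.-integrable setT (EFin \o (fun x => f x * p x)) ->
  P.-integrable setT (EFin \o (fun w => f (Z w))) /\
  \int[P]_w f (Z w) = \int[mu]_x (f x * p x).
Proof.
move=> mf fi.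
have [i1 i2] := @integral_density _ _ _ mu (distribution P Z') p mp p0 pE f mf fi.
have mfE : measurable_fun setT (EFin \o (f : measurableTypeR R -> R)) by exact/measurable_EFinP.
have i3 : P.-integrable setT (EFin \o (fun w => f (Z w))).
  apply/integrableP; split; first by apply: (measurableT_comp mfE).
  move/integrableP: i1 => [_]; rewrite (ge0_integral_distribution Z')//.
  exact: measurableT_comp.
split => //; by rewrite -i2 /Rintegral (@integral_distribution _ _ _ _ _ P Z' _ mfE i3).
Qed.

Lemma ge0_law_density (f : R -> R) : measurable_fun setT f -> (forall x, 0 <= f x) ->
  (\int[P]_w (f (Z w))%:E = \int[mu]_x (f x * p x)%:E)%E.
Proof.
move=> mf f0.
have mfE : measurable_fun setT (EFin \o (f : measurableTypeR R -> R)) by exact/measurable_EFinP.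
have := @ge0_integral_density _ _ _ mu (distribution P Z') p mp p0 pE _ mfE.
rewrite (ge0_integral_distribution Z')// => H.
by apply: H => x; rewrite lee_fin.
Qed.

End density_of_law.

(** For the degenerate law, Z vanishes almost surely and all integrals are values at 0. Otherwise
    the second moment identifies s^2 with v, so the existential s disappears from the conclusion. *)
Lemma centred_gaussian_cf (Z : T -> R) (v : R) : measurable_fun setT Z ->
  centred_gaussian P Z -> \int[P]_w (Z w ^+ 2) = v ->
  \int[P]_w cos (Z w) = expR (- (v / 2)) /\ \int[P]_w sin (Z w) = 0.
Proof.
move=> mZ [s s0 ZE] Zv.
pose Z' : {RV P >-> R} := HB.pack Z (isMeasurableFun.Build _ _ _ _ Z mZ).
have mc : measurable_fun setT (@cos R) by exact: continuous_measurable_fun (@continuous_cos R).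
have msn : measurable_fun setT (@sin R) by exact: continuous_measurable_fun (@continuous_sin R).
have [s00|sn0] := eqVneq s 0.
  have Z0 : {ae P, forall w, Z w = 0}.
    exists (~` (Z @^-1` [set 0])); split.
    - rewrite preimage_setC; apply: (measurable_funPTI Z').
      by apply: measurableC; exact: measurable_set1.
    - rewrite preimage_setC ZE ?s00 ?eqxx//; last by apply: measurableC; exact: measurable_set1.
      by rewrite /= diracE memNset//= => /(_ erefl).
    - by move=> w /= h1 h2; apply: h1.
  have ZR (f : R -> R) : measurable_fun setT f -> \int[P]_w f (Z w) = f 0.
    move=> mf; rewrite -[RHS]mulr1 -[X in _ * X]/(fine 1%:E) -(@probability_setT _ _ _ P).
    rewrite -(Rintegral_cst P measurableT) /Rintegral; congr fine.
    apply: ae_eq_integral => //.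
    - by apply/measurable_EFinP; exact: measurableT_comp.
    - by apply: filterS Z0 => w /= -> _.
  rewrite (ZR _ mc) (ZR _ msn) cos0 sin0; split=> //.
  move: Zv; rewrite (ZR (fun x => x ^+ 2))// => <-.
  by rewrite expr0n mul0r oppr0 expR0.
have dE (A : set R) : measurable A -> (P (Z @^-1` A) = \int[mu]_(x in A) (normal_pdf 0 s x)%:E)%E.
  by move=> mA; rewrite ZE// (negPf sn0).
have L := @law_density Z _ mZ (measurable_normal_pdf 0 s) (normal_pdf_ge0 0 s) dE.
have ic : mu.-integrable setT (EFin \o (fun x => cos x * normal_pdf 0 s x)).
  by apply: (gauss_integrable sn0 (C := 1)) => // x; rewrite mul1r (le_trans (cos_max _))// le_1_1Dsqr.
have is' : mu.-integrable setT (EFin \o (fun x => sin x * normal_pdf 0 s x)).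
  by apply: (gauss_integrable sn0 (C := 1)) => // x; rewrite mul1r (le_trans (sin_max _))// le_1_1Dsqr.
have iq : mu.-integrable setT (EFin \o (fun x => x ^+ 2 * normal_pdf 0 s x)).
  apply: (gauss_integrable sn0 (C := 1)); first exact: measurable_funX.
  by move=> x; rewrite mul1r ger0_norm ?sqr_ge0// lerDr.
have [_ E1] := L _ mc ic; have [_ E2] := L _ msn is'.
have [|_ E3] := L (fun x => x ^+ 2) _ iq; first exact: measurable_funX.
move: E3; rewrite /= Zv normal_variance// => ->.
split.
  rewrite E1; have := gauss_cos sn0 1; rewrite expr1n mulr1 => <-.
  by apply: eq_Rintegral => x _; rewrite mul1r.
rewrite E2; apply: etrans (gauss_sin sn0 1).
by apply: eq_Rintegral => x _; rewrite mul1r.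
Qed.

End law.

(** * Standard Gaussian families *)

Section standard_family.
Context {R : realType} d (T : measurableType d) (P : probability T R).
Local Notation mu := (@lebesgue_measure R).
Local Notation p := (normal_pdf (0 : R) 1).

(** The joint law of the first k coordinates is prescribed through the characteristic functions of
    their linear combinations. Independence is not stated separately: everything about the joint law
    is drawn from these integrals. *)
Definition std_gauss (k : nat) (X : nat -> T -> R) := forall a : nat -> R,
  \int[P]_w cos (\sum_(0 <= i < k) a i * X i w) = expR (- ((\sum_(0 <= i < k) a i ^+ 2) / 2)) /\
  \int[P]_w sin (\sum_(0 <= i < k) a i * X i w) = 0.

Variables (k : nat) (X : nat -> T -> R).
Hypotheses (mX : forall i, measurable_fun setT (X i)) (gX : std_gauss k X).

Let n10 : (1 : R) != 0. Proof. exact: oner_neq0. Qed.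
Let mc : measurable_fun setT (@cos R). Proof. exact: continuous_measurable_fun (@continuous_cos R). Qed.
Let msn : measurable_fun setT (@sin R). Proof. exact: continuous_measurable_fun (@continuous_sin R). Qed.

Lemma measurable_fun_sum_nat (f : nat -> T -> R) m n : (forall i, measurable_fun setT (f i)) ->
  measurable_fun setT (fun w => \sum_(m <= i < n) f i w).
Proof. by move=> mf; apply: measurable_sum. Qed.

(* The Gaussian coordinates are replaced one at a time; [fourier_unique] with
   weight [cos A] or [sin A] handles the coordinate being replaced. *)
Lemma gauss_family_cf (th : nat -> R -> R) (rho al : nat -> R) :
  (forall i, continuous (th i)) ->
  (forall i, \int[mu]_x (cos (th i x) * p x) = rho i * cos (al i)) ->
  (forall i, \int[mu]_x (sin (th i x) * p x) = rho i * sin (al i)) ->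
  forall j, (j <= k)%N -> forall t : nat -> R,
  let A w := \sum_(0 <= i < j) th i (X i w) + \sum_(j <= i < k) t i * X i w in
  let M := (\prod_(0 <= i < j) rho i) * expR (- ((\sum_(j <= i < k) t i ^+ 2) / 2)) in
  \int[P]_w cos (A w) = M * cos (\sum_(0 <= i < j) al i) /\
  \int[P]_w sin (A w) = M * sin (\sum_(0 <= i < j) al i).
Proof.
move=> cth hc hs; elim=> [_ t A0 M0|j IH jk t A0 M0].
  rewrite /A0 /M0 !(@big_geq _ _ _ 0 0)// cos0 sin0 mul1r mulr1 mulr0; have [g1 g2] := gX t.
  by split; [apply: etrans g1|apply: etrans g2]; apply: eq_Rintegral => w _; rewrite (@big_geq _ _ _ 0 0)// add0r.
pose A w := \sum_(0 <= i < j) th i (X i w) + \sum_(j.+1 <= i < k) t i * X i w.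
pose M := (\prod_(0 <= i < j) rho i) * expR (- ((\sum_(j.+1 <= i < k) t i ^+ 2) / 2)).
pose b := \sum_(0 <= i < j) al i.
have mA : measurable_fun setT A.
  apply: measurable_funD; apply: measurable_fun_sum_nat => i.
    by apply: measurableT_comp => //; exact: continuous_measurable_fun.
  exact: measurable_funM.
have mcA : measurable_fun setT (cos \o A) by exact: measurableT_comp.
have msA : measurable_fun setT (sin \o A) by exact: measurableT_comp.
(* The induction hypothesis with frequency u on coordinate j, which A leaves out. *)
have IHu (u : R) : \int[P]_w cos (A w + u * X j w) = M * expR (- (u ^+ 2 / 2)) * cos b /\
    \int[P]_w sin (A w + u * X j w) = M * expR (- (u ^+ 2 / 2)) * sin b.
  pose t' i := if i == j then u else t i.
  have e1 w : \sum_(0 <= i < j) th i (X i w) + \sum_(j <= i < k) t' i * X i w = A w + u * X j w.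
    rewrite /A (big_ltn jk) /t' eqxx -addrA [in RHS](addrC (\sum_(j.+1 <= i < k) _)); congr (_ + (_ + _)).
    by apply: eq_big_nat => i /andP[ji _]; rewrite gtn_eqF.
  have e2 : \sum_(j <= i < k) t' i ^+ 2 = u ^+ 2 + \sum_(j.+1 <= i < k) t i ^+ 2.
    rewrite (big_ltn jk) /t' eqxx; congr (_ + _).
    by apply: eq_big_nat => i /andP[ji _]; rewrite gtn_eqF.
  have := IH (ltnW jk) t'; cbv zeta; rewrite e2 mulrDl opprD expRD.
  under eq_Rintegral do rewrite e1; move=> [-> h]; split; first by rewrite /M -/b; ring.
  by move: h; under eq_Rintegral do rewrite e1; move=> ->; rewrite /M -/b; ring.
have bc (f : T -> R) : measurable_fun setT f -> P.-integrable setT (EFin \o (fun w => cos (f w))).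
  move=> mf; apply: (@bounded_integrable _ _ _ _ _ 1) => [|w]; last exact: cos_max.
  exact: measurableT_comp.
have bs (f : T -> R) : measurable_fun setT f -> P.-integrable setT (EFin \o (fun w => sin (f w))).
  move=> mf; apply: (@bounded_integrable _ _ _ _ _ 1) => [|w]; last exact: sin_max.
  exact: measurableT_comp.
have mAu u : measurable_fun setT (fun w => A w + u * X j w).
  by apply: measurable_funD => //; exact: measurable_funM.
(* Product-to-sum formulas combine [IHu] at u and at -u. The right-hand sides there are even in u,
   so the integrals containing sin(u X_j) vanish. *)
have E1 u : \int[P]_w (cos (A w) * cos (u * X j w)) = M * cos b * expR (- (u ^+ 2 / 2)).
  transitivity (\int[P]_w (2^-1 * (cos (A w + u * X j w) + cos (A w + (- u) * X j w)))).
    by apply: eq_Rintegral => w _; rewrite mulNr; move: (A w) (u * X j w) => a v; rewrite cosB cosD; field.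
  rewrite RintegralZl//; last by apply: intD; exact: bc.
  rewrite RintegralD//; [|exact: bc|exact: bc].
  by rewrite (IHu u).1 (IHu (- u)).1 sqrrN; field.
have E2 u : \int[P]_w (cos (A w) * sin (u * X j w)) = 0.
  transitivity (\int[P]_w (2^-1 * (sin (A w + u * X j w) - sin (A w + (- u) * X j w)))).
    by apply: eq_Rintegral => w _; rewrite mulNr; move: (A w) (u * X j w) => a v; rewrite sinB sinD; field.
  rewrite RintegralZl//; last by apply: intB; exact: bs.
  rewrite RintegralB//; [|exact: bs|exact: bs].
  by rewrite (IHu u).2 (IHu (- u)).2 sqrrN; field.
have E3 u : \int[P]_w (sin (A w) * cos (u * X j w)) = M * sin b * expR (- (u ^+ 2 / 2)).
  transitivity (\int[P]_w (2^-1 * (sin (A w + u * X j w) + sin (A w + (- u) * X j w)))).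
    by apply: eq_Rintegral => w _; rewrite mulNr; move: (A w) (u * X j w) => a v; rewrite sinB sinD; field.
  rewrite RintegralZl//; last by apply: intD; exact: bs.
  rewrite RintegralD//; [|exact: bs|exact: bs].
  by rewrite (IHu u).2 (IHu (- u)).2 sqrrN; field.
have E4 u : \int[P]_w (sin (A w) * sin (u * X j w)) = 0.
  transitivity (\int[P]_w (2^-1 * (cos (A w + (- u) * X j w) - cos (A w + u * X j w)))).
    by apply: eq_Rintegral => w _; rewrite mulNr; move: (A w) (u * X j w) => a v; rewrite cosB cosD; field.
  rewrite RintegralZl//; last by apply: intB; exact: bc.
  rewrite RintegralB//; [|exact: bc|exact: bc].
  by rewrite (IHu u).1 (IHu (- u)).1 sqrrN; field.
(* Weighted by W, the coordinate X_j has the same characteristic function as a standard normal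
   variable with constant weight c. Hence the weighted expectations agree for bounded continuous g,
   in particular for the cosine and sine of [th j]. *)
have key (W : T -> R) (c : R) : measurable_fun setT W -> (forall w, `|W w| <= 1) ->
    (forall u, \int[P]_w (W w * cos (u * X j w)) = c * expR (- (u ^+ 2 / 2))) ->
    (forall u, \int[P]_w (W w * sin (u * X j w)) = 0) ->
    forall g : R -> R, continuous g -> (forall x, `|g x| <= 1) ->
    \int[P]_w (W w * g (X j w)) = c * \int[mu]_x (g x * p x).
  move=> mW W1 Wc Ws g cg g1.
  have N (h : R -> R) : continuous h -> (forall x, `|h x| <= 1) ->
     \int[normal_prob 0 1]_x (cst c x * h x) = c * \int[mu]_x (h x * p x).
    move=> ch h1; have mh : measurable_fun setT h by exact: continuous_measurable_fun.
    have [|i <-] := @normal_integral _ _ n10 _ 1 mh.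
      by move=> x; rewrite mul1r (le_trans (h1 x))// le_1_1Dsqr.
    by rewrite -RintegralZl.
  rewrite -N//.
  apply: (@fourier_unique _ _ T P W (X j) _ _ (normal_prob 0 1) (cst c) id (1 + `|c|)) => //.
  - by move=> w; rewrite (le_trans (W1 w))// lerDl.
  - by move=> w; rewrite /= lerDr.
  - move=> u; rewrite Wc N; first by rewrite gauss_cos// expr1n mul1r.
      by move=> x; apply: is_derive_continuous; der.
    by move=> x; exact: cos_max.
  - move=> u; rewrite Ws N; first by rewrite gauss_sin// mulr0.
      by move=> x; apply: is_derive_continuous; der.
    by move=> x; exact: sin_max.
have cc : continuous (fun x => cos (th j x)).
  move=> x; apply: (@continuous_comp _ _ _ (th j) cos); [exact: cth|exact: continuous_cos].
have cs : continuous (fun x => sin (th j x)).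
  move=> x; apply: (@continuous_comp _ _ _ (th j) sin); [exact: cth|exact: continuous_sin].
have b1 x : `|cos (th j x)| <= 1 by exact: cos_max.
have b2 x : `|sin (th j x)| <= 1 by exact: sin_max.
have bcA w : `|(cos \o A) w| <= 1 by exact: cos_max.
have bsA w : `|(sin \o A) w| <= 1 by exact: sin_max.
have K1 := key _ _ mcA bcA E1 E2 _ cc b1.
have K2 := key _ _ mcA bcA E1 E2 _ cs b2.
have K3 := key _ _ msA bsA E3 E4 _ cc b1.
have K4 := key _ _ msA bsA E3 E4 _ cs b2.
move: K1 K2 K3 K4; rewrite hc hs => K1 K2 K3 K4.
have AE w : \sum_(0 <= i < j.+1) th i (X i w) + \sum_(j.+1 <= i < k) t i * X i w =
    A w + th j (X j w).
  by rewrite big_nat_recr//= /A; ring.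
have mth : measurable_fun setT (fun w => th j (X j w)).
  by apply: measurableT_comp => //; exact: continuous_measurable_fun.
have bp (f g : R -> R) : measurable_fun setT f -> measurable_fun setT g ->
    (forall x, `|f x| <= 1) -> (forall x, `|g x| <= 1) ->
    P.-integrable setT (EFin \o (fun w => f (A w) * g (th j (X j w)))).
  move=> mf mg f1 g1; apply: (@bounded_integrable _ _ _ _ _ 1).
    by apply: measurable_funM; exact: measurableT_comp.
  by move=> w; rewrite normrM mulr_ile1.
rewrite /M0 /A0 big_nat_recr//= [X in cos X](_ : _ = b + al j); last by rewrite big_nat_recr.
rewrite [X in sin X](_ : _ = b + al j); last by rewrite big_nat_recr.
split.
- transitivity (\int[P]_w (cos (A w) * cos (th j (X j w)) - sin (A w) * sin (th j (X j w)))).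
    by apply: eq_Rintegral => w _; rewrite AE; move: (A w) (th j _) => a v; rewrite cosD.
  rewrite RintegralB//; [|by apply: bp => // x; exact: cos_max|by apply: bp => // x; exact: sin_max].
  by move: K1 K4 => /= -> ->; rewrite cosD /M; ring.
- transitivity (\int[P]_w (sin (A w) * cos (th j (X j w)) + cos (A w) * sin (th j (X j w)))).
    by apply: eq_Rintegral => w _; rewrite AE; move: (A w) (th j _) => a v; rewrite sinD.
  rewrite RintegralD//; [|by apply: bp => // x; rewrite ?cos_max ?sin_max|by apply: bp => // x; rewrite ?cos_max ?sin_max].
  by move: K2 K3 => /= -> ->; rewrite sinD /M; ring.
Qed.

End standard_family.

(** * The characteristic function of a finite chaos sum *)

Section chaos_cf.
Context {R : realType} d (T : measurableType d) (P : probability T R).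
Local Notation mu := (@lebesgue_measure R).
Local Notation p := (normal_pdf (0 : R) 1).

Lemma gauss_centred_square (u : R) :
  \int[mu]_x (cos (u * (x ^+ 2 - 1)) * p x) = prho 2^-1 (2 * u) * cos (pang 2^-1 (2 * u) - u) /\
  \int[mu]_x (sin (u * (x ^+ 2 - 1)) * p x) = prho 2^-1 (2 * u) * sin (pang 2^-1 (2 * u) - u).
Proof.
have n10 : (1 : R) != 0 by exact: oner_neq0.
have [E1 E2] := gauss_square u.
have ic : mu.-integrable setT (EFin \o (fun x => cos (u * x ^+ 2) * p x)).
  apply: (gauss_integrable n10 (C := 1)).
    by apply: continuous_measurable_fun => x; apply: is_derive_continuous; der.
  by move=> x; rewrite mul1r (le_trans (cos_max _))// le_1_1Dsqr.
have is' : mu.-integrable setT (EFin \o (fun x => sin (u * x ^+ 2) * p x)).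
  apply: (gauss_integrable n10 (C := 1)).
    by apply: continuous_measurable_fun => x; apply: is_derive_continuous; der.
  by move=> x; rewrite mul1r (le_trans (sin_max _))// le_1_1Dsqr.
split.
- transitivity (\int[mu]_x (cos u * (cos (u * x ^+ 2) * p x) + sin u * (sin (u * x ^+ 2) * p x))).
    by apply: eq_Rintegral => x _; rewrite mulrBr mulr1 cosB; ring.
  rewrite RintegralD//; [|exact: intZ|exact: intZ].
  by rewrite !RintegralZl// E1 E2 cosB; ring.
- transitivity (\int[mu]_x (cos u * (sin (u * x ^+ 2) * p x) - sin u * (cos (u * x ^+ 2) * p x))).
    by apply: eq_Rintegral => x _; rewrite mulrBr mulr1 sinB; ring.
  rewrite RintegralB//; [|exact: intZ|exact: intZ].
  by rewrite !RintegralZl// E1 E2 sinB; ring.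
Qed.

(** Each term contributes the factor (1 - 2 i t lam_i)^(-1/2) exp(- i t lam_i). L sums the
    logarithms of the moduli and A the unreduced arguments, so both are additive over the
    eigenvalues. *)
Lemma chaos_cf (k : nat) (X : nat -> T -> R) (lam : nat -> R) (t : R) :
  (forall i, measurable_fun setT (X i)) -> std_gauss P k X ->
  let F w := \sum_(0 <= i < k) lam i * (X i w ^+ 2 - 1) in
  let L := - (4^-1 * \sum_(0 <= i < k) ln (1 + (2 * (t * lam i)) ^+ 2)) in
  let A := \sum_(0 <= i < k) (2^-1 * atan (2 * (t * lam i)) - t * lam i) in
  \int[P]_w cos (t * F w) = expR L * cos A /\ \int[P]_w sin (t * F w) = expR L * sin A.
Proof.
move=> mX gX F L A.
pose th i (x : R) := t * lam i * (x ^+ 2 - 1).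
pose rho i := prho 2^-1 (2 * (t * lam i)).
pose al i := pang 2^-1 (2 * (t * lam i)) - t * lam i.
have cth i : continuous (th i).
  by move=> x; apply: is_derive_continuous; rewrite /th; der.
have := @gauss_family_cf _ _ _ P k X mX gX th rho al cth (fun i => (gauss_centred_square _).1)
  (fun i => (gauss_centred_square _).2) k (leqnn k) (fun=> 0).
cbv zeta; rewrite ![\sum_(k <= i < k) _]big_geq// mul0r oppr0 expR0 mulr1.
have rE : \prod_(0 <= i < k) rho i = expR L.
  rewrite /L -mulNr mulr_sumr expR_sum; apply: eq_bigr => i _.
  by rewrite /rho /prho; congr expR; field.
rewrite rE -/A => -[<- <-].
by split; apply: eq_Rintegral => w _; rewrite (@big_geq _ _ _ k k)// addr0 /F mulr_sumr;
  congr (_ _); apply: eq_bigr => i _; rewrite /th mulrA.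
Qed.

End chaos_cf.

(** * Orthonormal vectors give standard Gaussian families *)

Section isonormal_std.
Context {R : realType} (H : hilbertSpace R) d (T : measurableType d) (P : probability T R).
Variable X : H -> {RV P >-> R}.
Hypothesis iX : isonormal X.

Lemma isonormal_integrable_sqr h : P.-integrable setT (EFin \o (fun w => X h w ^+ 2)).
Proof.
have := iX.2 h h; rewrite unlock => E.
apply/integrableP; split.
  by apply/measurable_EFinP; apply: measurable_funX; exact: measurable_funPT.
under eq_integral do rewrite /= ger0_norm ?sqr_ge0// expr2.
by rewrite E ltry.
Qed.

Lemma isonormal_integrable h g : P.-integrable setT (EFin \o (fun w => X h w * X g w)).
Proof.
apply: (int_le _ (intD (isonormal_integrable_sqr h) (isonormal_integrable_sqr g))).
  by apply: measurable_funM; exact: measurable_funPT.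
move=> w; rewrite normrM -[X h w ^+ 2]real_normK ?num_real// -[X g w ^+ 2]real_normK ?num_real//.
by have := sqr_ge0 (`|X h w| - `|X g w|); set a := `|X h w|; set b := `|X g w|; nra.
Qed.

Lemma isonormal_inner h g : \int[P]_w (X h w * X g w) = inner H h g.
Proof. by have := iX.2 h g; rewrite unlock /Rintegral => ->. Qed.

Lemma isonormal_std_gauss (k : nat) (e : nat -> H) :
  (forall i j, (i < k)%N -> (j < k)%N -> inner H (e i) (e j) = (i == j)%:R) ->
  std_gauss P k (fun i => X (e i)).
Proof.
move=> on a.
have mZ : measurable_fun setT (fun w => \sum_(0 <= i < k) a i * X (e i) w).
  by apply: measurable_fun_sum_nat => i; apply: measurable_funM => //; exact: measurable_funPT.
apply: centred_gaussian_cf => //.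
  have := iX.1 k (fun i => a i) (fun i => e i).
  by under eq_fun do rewrite -(big_mkord xpredT (fun i => a i * X (e i) _)).
transitivity (\int[P]_w (\sum_(0 <= i < k) \sum_(0 <= j < k) a i * a j * (X (e i) w * X (e j) w))).
  apply: eq_Rintegral => w _; rewrite expr2 mulr_suml; apply: eq_bigr => i _.
  by rewrite mulr_sumr; apply: eq_bigr => j _; ring.
have S1 i := @int_sum _ _ _ P nat (index_iota 0 k) xpredT
    (fun j w => a i * a j * (X (e i) w * X (e j) w)) (fun j => intZ _ (isonormal_integrable _ _)).
have [_ ->] := int_sum (index_iota 0 k) xpredT (fun i => (S1 i).1).
rewrite big_nat [RHS]big_nat; apply: eq_bigr => i /andP[_ ik].
rewrite (S1 i).2 (bigD1_seq i) ?mem_index_iota ?iota_uniq//= ?ik// big_nat_cond big1.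
  rewrite addr0 RintegralZl//; last exact: isonormal_integrable.
  by rewrite isonormal_inner on// eqxx mulr1 expr2.
move=> j /andP[/andP[_ jk] ji].
rewrite RintegralZl//; last exact: isonormal_integrable.
by rewrite isonormal_inner on// eq_sym (negPf ji) mulr0.
Qed.

End isonormal_std.

(** * Variance-Gamma laws as normal mixtures *)

Section reflection.
Context {R : realType}.
Local Notation mu := (@lebesgue_measure R).

Lemma ge0_integral_reflect (f : R -> \bar R) : measurable_fun [set: R] f ->
  (forall r, 0 <= f r)%E -> (\int[mu]_x f (- x)%R = \int[mu]_x f x)%E.
Proof.
move=> mf f0; transitivity (\int[pushforward mu (-%R : _ -> measurableTypeR R)]_x f x)%E.
  by rewrite ge0_integral_pushforward//=.
by apply: eq_measure_integral => //= A mA _; exact: lebesgue_measureN.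
Qed.

(** Averaging over t and -t replaces exp(nu t) by cosh(nu t), and the integral of the resulting even
    function is twice that over the half-line. *)
Lemma besselKE (nu z : R) :
  \int[mu]_t expR (- z * cosh t + nu * t) = 2 * besselK nu z.
Proof.
pose f (nu t : R) := expR (- z * cosh t + nu * t).
have cf n : continuous (f n).
  by move=> x; apply: is_derive_continuous; rewrite /f /cosh; der.
have mf n : measurable_fun setT (EFin \o f n).
  by apply/measurable_EFinP; exact: continuous_measurable_fun.
have f0 n x : (0 <= (EFin \o f n) x)%E by rewrite lee_fin expR_ge0.
have coshN (x : R) : cosh (- x) = cosh x by rewrite /cosh opprK addrC.
pose g t := expR (- z * cosh t) * cosh (nu * t).
have gE t : g t = 2^-1 * (f nu t + f (- nu) t).
  by rewrite /g /f; move: (cosh t) => c; rewrite /cosh !expRD (mulNr nu t); field.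
have g0 x : 0 <= g x.
  by rewrite gE mulr_ge0 ?addr_ge0 ?expR_ge0// invr_ge0.
have cg : continuous g.
  move=> x; apply: is_derive_continuous; rewrite /g /cosh; der.
have gev : g =1 g \o -%R by move=> x; rewrite /g /= coshN mulrN coshN.
have := ge0_symfun_integralT g0 cg gev.
have -> : (\int[mu]_x (g x)%:E = \int[mu]_x (f nu x)%:E)%E.
  under eq_integral do rewrite gE EFinM EFinD.
  rewrite ge0_integralZl//; last 2 first.
  - by apply: emeasurable_funD; exact: mf.
  - by move=> x _; rewrite adde_ge0// lee_fin expR_ge0.
  rewrite ge0_integralD//; last 4 first.
  - by move=> x _; rewrite lee_fin expR_ge0.
  - exact: mf.
  - by move=> x _; rewrite lee_fin expR_ge0.
  - exact: mf.
  have -> : (\int[mu]_x (f (- nu) x)%:E = \int[mu]_x (f nu x)%:E)%E.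
    rewrite -(ge0_integral_reflect (mf (- nu)) (f0 (- nu))).
    by apply: eq_integral => x _; rewrite /= /f coshN mulrNN.
  rewrite -mule2n -mule_natl muleA -EFinM mulVf// mul1e//.
move=> h; rewrite /Rintegral h /besselK /Rintegral -set_itvcy.
(* [fine] sends both infinities to 0, so the identity also holds for an infinite integral. *)
case: (integral _ _ _) => [u||] //=.
- by rewrite mulry gtr0_sg// mul1e/= mulr0.
- by rewrite mulrNy gtr0_sg// mul1e/= mulr0.
Qed.

End reflection.

(** * The mixture representation of the Variance-Gamma density *)

Section vg.
Context {R : realType}.
Local Notation mu := (@lebesgue_measure R).
Variables (r theta sigma m : R).
Hypotheses (r0 : 0 < r) (sigma0 : 0 < sigma).

Let D := Num.sqrt (theta ^+ 2 + sigma ^+ 2).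
Let nu := (r - 1) / 2.
Let k := r / 2.
Let gk w := gamma_kernel k 2^-1 w.

Let D0 : 0 < D. Proof. by rewrite sqrtr_gt0 ltr_wpDl ?sqr_ge0// exprn_gt0. Qed.
Let D2 : D ^+ 2 = theta ^+ 2 + sigma ^+ 2.
Proof. by rewrite sqr_sqrtr// addr_ge0 ?sqr_ge0. Qed.
Let k0 : 0 < k. Proof. by rewrite divr_gt0. Qed.
Let h0 : 0 < 2^-1 :> R. Proof. by rewrite invr_gt0. Qed.

(** Given the mixing variable G = exp w, of Gamma law with shape r/2 and rate 1/2, the law is normal
    with mean m + theta G and variance sigma^2 G. These are the conditional mean and standard
    deviation. *)
Definition vg_mean w := m + theta * expR w.
Definition vg_sd w := sigma * expR (w / 2).

Lemma vg_sd_neq0 w : vg_sd w != 0.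
Proof. by rewrite gt_eqF// mulr_gt0 ?expR_gt0. Qed.

Lemma vg_sd2 w : vg_sd w ^+ 2 = sigma ^+ 2 * expR w.
Proof. by rewrite exprMn expr2 [X in _ * X]expr2 -expRD; congr (_ * expR _); field. Qed.

Definition vg_joint (x w : R) := normal_pdf (vg_mean w) (vg_sd w) x * gamma_kernel (r / 2) 2^-1 w.

Let pk := (sigma * Num.sqrt (2 * pi))^-1.

Lemma vg_jointE x w : vg_joint x w = pk * expR (theta / sigma ^+ 2 * (x - m)) *
  expR (- ((x - m) ^+ 2 / (2 * sigma ^+ 2) * expR (- w)) - D ^+ 2 / (2 * sigma ^+ 2) * expR w + nu * w).
Proof.
have sn0 : sigma != 0 by rewrite gt_eqF.
rewrite /vg_joint normal_pdfE ?vg_sd_neq0// /normal_fun /gamma_kernel /normal_peak vg_sd2.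
have -> : Num.sqrt (sigma ^+ 2 * expR w * pi *+ 2) = sigma * Num.sqrt (2 * pi) * expR (w / 2).
  have -> : sigma ^+ 2 * expR w * pi *+ 2 = (sigma * expR (w / 2)) ^+ 2 * (2 * pi).
    by rewrite -/(vg_sd w) vg_sd2; ring.
  by rewrite sqrtrM ?sqr_ge0// sqrtr_sqr ger0_norm ?mulr_ge0 ?expR_ge0 ?ltW//; ring.
have lem (q a b c d e : R) : a + b + c = d + e -> q * expR a * expR b * expR c = q * expR d * expR e.
  by move=> h; rewrite -!mulrA -!expRD addrA h.
rewrite invfM -/pk -expRN; apply: lem; rewrite /vg_mean /nu D2.
have ew : expR w != 0 by rewrite gt_eqF// expR_gt0.
by rewrite expRN; field; rewrite sn0 ew.
Qed.

Lemma continuous_vg_joint x : continuous (vg_joint x).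
Proof.
have -> : vg_joint x = _ := funext (vg_jointE x).
by move=> w; apply: is_derive_continuous; der.
Qed.

Lemma vg_joint_ge0 x w : 0 <= vg_joint x w.
Proof. by rewrite mulr_ge0 ?normal_pdf_ge0 ?expR_ge0. Qed.

(** What remains of the prefactor of the density once the normal peak is taken out. It has to be the
    reciprocal of the total mass of the Gamma kernel; instead of evaluating [Gamma_fun],
    [VG_normalization] deduces this from the total mass 1 of the law. *)
Definition vg_const := (sigma * Num.sqrt pi * Gamma_fun (r / 2))^-1 * 2 `^ (- nu) / (2 * pk).

Lemma vg_const_ge0 : 0 <= vg_const.
Proof.
rewrite /vg_const /pk divr_ge0 ?mulr_ge0 ?powR_ge0 ?invr_ge0//.
- rewrite !mulr_ge0 ?sqrtr_ge0 ?(ltW sigma0)//.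
  by apply: Rintegral_ge0 => t _; rewrite mulr_ge0 ?powR_ge0 ?expR_ge0.
- by rewrite mulr_ge0 ?sqrtr_ge0 ?(ltW sigma0).
Qed.

(* Translating w by ln (|x - m| / D) turns the mixture integral into the cosh form
   of the Bessel function. *)
Lemma VG_density_mixture x : x != m ->
  VG_density r theta sigma m x = vg_const * \int[mu]_w vg_joint x w.
Proof.
move=> xm; set a := `|x - m|.
have a0 : 0 < a by rewrite normr_gt0 subr_eq0.
have sn0 : sigma != 0 by rewrite gt_eqF.
have s20 : 0 < 2 * sigma ^+ 2 by rewrite mulr_gt0// exprn_gt0.
have xa : (x - m) ^+ 2 = a ^+ 2 by rewrite real_normK ?num_real.
pose z := D / sigma ^+ 2 * a.
have -> : \int[mu]_w vg_joint x w =
   pk * expR (theta / sigma ^+ 2 * (x - m)) * (a / D) `^ nu * (2 * besselK nu z).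
  rewrite -besselKE /Rintegral.
  rewrite -(@ge0_integral_translation _ _ (ln (a / D)) (@continuous_vg_joint x) (vg_joint_ge0 x)).
  have E w : vg_joint x (w + ln (a / D)) =
    pk * expR (theta / sigma ^+ 2 * (x - m)) * (a / D) `^ nu * expR (- z * cosh w + nu * w).
    rewrite vg_jointE /powR gt_eqF ?divr_gt0// -[RHS]mulrA -expRD; congr (_ * expR _).
    have el : expR (ln (a / D)) = a / D by rewrite lnK ?posrE ?divr_gt0.
    rewrite xa opprD !expRD expRN el expRN el /z /cosh mulrDr expRN.
    have ew : expR w != 0 by rewrite gt_eqF// expR_gt0.
    by field; rewrite ew sn0 !gt_eqF.
  rewrite [X in fine X = _](_ : _ = \int[mu]_w ((pk * expR (theta / sigma ^+ 2 * (x - m)) * (a / D) `^ nu)%:E *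
    (expR (- z * cosh w + nu * w))%:E))%E; last first.
    by apply: eq_integral => w _; rewrite -EFinM; congr EFin; exact: E.
  rewrite ge0_integralZl//.
  - set I := integral _ _ _; set c := _ * _ `^ nu.
    have c0 : 0 < c by rewrite !mulr_gt0 ?expR_gt0 ?powR_gt0 ?divr_gt0// /pk invr_gt0 mulr_gt0// sqrtr_gt0 mulr_gt0// pi_gt0.
    case: I => [u||] //=; first by rewrite mulry gtr0_sg// mul1e/= mulr0.
    by rewrite mulrNy gtr0_sg// mul1e/= mulr0.
  - apply/measurable_EFinP; apply: continuous_measurable_fun => w.
    by apply: is_derive_continuous; rewrite /cosh; der.
  - by rewrite lee_fin !mulr_ge0 ?expR_ge0 ?powR_ge0// /pk invr_ge0 mulr_ge0 ?sqrtr_ge0// ltW.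
rewrite /VG_density -/a -/D -/nu -/z.
have -> : (a / (2 * D)) `^ nu = 2 `^ (- nu) * (a / D) `^ nu.
  have -> : a / (2 * D) = 2^-1 * (a / D) by field; rewrite gt_eqF.
  rewrite powRM ?divr_ge0 ?ltW// powRN; congr (_ * _).
  by rewrite -[2^-1]powR_inv1// -powRrM mulN1r powRN.
rewrite /vg_const.
have pk0 : pk != 0 by rewrite /pk invr_neq0// mulf_neq0// gt_eqF// sqrtr_gt0 mulr_gt0// pi_gt0.
have lem (G e v w b q : R) : q != 0 ->
  G * e * (v * w) * b = G * v / (2 * q) * (q * e * w * (2 * b)) by move=> q0; field.
exact: lem.
Qed.

(** The exponent nu = (r - 1) / 2 falls short of that of a Gamma kernel with parameter r / 2 by 1/2.
    The factor exp(- w / 2), unbounded as w tends to minus infinity, is absorbed by exp(- b exp(-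
    w)), where b > 0 because x differs from m. *)
Lemma integrable_vg_joint x : x != m -> mu.-integrable setT (EFin \o vg_joint x).
Proof.
move=> xm; pose b := (x - m) ^+ 2 / (2 * sigma ^+ 2).
have s20 : 0 < 2 * sigma ^+ 2 by rewrite mulr_gt0// exprn_gt0.
have b0 : 0 < b by rewrite divr_gt0// exprn_even_gt0// subr_eq0.
have q0 : 0 < D ^+ 2 / (2 * sigma ^+ 2) by rewrite divr_gt0// exprn_gt0.
have pk0 : 0 <= pk by rewrite /pk invr_ge0 mulr_ge0 ?sqrtr_ge0// ltW.
pose C := pk * expR (theta / sigma ^+ 2 * (x - m)).
apply: (@int_le _ _ _ mu (vg_joint x) (fun w => C * (1 + b^-1) * gamma_kernel k (D ^+ 2 / (2 * sigma ^+ 2)) w)).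
- by apply: continuous_measurable_fun; exact: continuous_vg_joint.
- by apply: intZ; exact: integrable_gamma_kernel1.
move=> w; rewrite ger0_norm ?vg_joint_ge0// vg_jointE -/C -/b -[leRHS]mulrA ler_wpM2l ?mulr_ge0 ?expR_ge0//.
have -> : - (b * expR (- w)) - D ^+ 2 / (2 * sigma ^+ 2) * expR w + nu * w =
   (- (b * expR (- w)) - w / 2) + (k * w - D ^+ 2 / (2 * sigma ^+ 2) * expR w).
  by rewrite /k /nu; set u := _ * expR w; field.
rewrite expRD ler_wpM2r ?expR_ge0// expRD.
rewrite (expRN (b * _)) ler_pdivrMl ?expR_gt0//.
set v := expR (- w); have v0 : 0 < v by exact: expR_gt0.
have e2 : expR (- (w / 2)) ^+ 2 = v.
  by rewrite expr2 -expRD; congr expR; field.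
have e1 : expR (- (w / 2)) <= 1 + v.
  by rewrite -e2; move: (expR _) => y; have := sqr_ge0 (y - 2^-1); nra.
rewrite (le_trans e1)//.
have e3 := expR_ge1Dx (b * v).
apply: (@le_trans _ _ ((1 + b * v) * (1 + b^-1))); last first.
  by rewrite ler_wpM2r// addr_ge0// invr_ge0 ltW.
have -> : (1 + b * v) * (1 + b^-1) = 1 + v + b^-1 + b * v by field; rewrite gt_eqF.
have i0 : 0 <= b^-1 by rewrite invr_ge0 ltW.
have i1 : 0 <= b * v by rewrite mulr_ge0// ltW.
by move: i0 i1; move: (b^-1) (b * v) => y1 y2; lra.
Qed.

Let vgjm : R * R -> R := fun z => pk * expR (theta / sigma ^+ 2 * (z.1 - m)) *
  expR (- ((z.1 - m) ^+ 2 / (2 * sigma ^+ 2) * expR (- z.2)) - D ^+ 2 / (2 * sigma ^+ 2) * expR z.2 + nu * z.2).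

Lemma measurable_vg_joint : measurable_fun setT (fun z : R * R => vg_joint z.1 z.2).
Proof.
have -> : (fun z : R * R => vg_joint z.1 z.2) = vgjm.
  by apply/funext => z; rewrite vg_jointE.
have m1 : measurable_fun setT (fun z : R * R => z.1 - m) by exact: measurable_funB.
have mN : measurable_fun setT (fun z : R * R => - z.2) by exact: measurableT_comp.
have mE (f : R * R -> R) : measurable_fun setT f -> measurable_fun setT (fun z => expR (f z)).
  by move=> mf; exact: measurableT_comp.
apply: measurable_funM; first by apply: measurable_funM => //; apply: (mE _ _); exact: measurable_funM.
apply: (mE _ _); apply: measurable_funD; last exact: measurable_funM.
apply: measurable_funB; last by apply: measurable_funM => //; exact: (mE _ _).
apply: measurableT_comp => //; apply: measurable_funM; last exact: (mE _ _).
by apply: measurable_funM => //; exact: measurable_funX.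
Qed.

Definition vg_mix x := \int[mu]_w vg_joint x w.

Lemma measurable_vg_mix : measurable_fun setT vg_mix.
Proof.
have mf : measurable_fun setT (EFin \o (fun z : R * R => vg_joint z.1 z.2)).
  by apply/measurable_EFinP; exact: measurable_vg_joint.
have f0 z : (0 <= (EFin \o (fun z : R * R => vg_joint z.1 z.2)) z)%E by rewrite lee_fin vg_joint_ge0.
have h := @measurable_fun_fubini_tonelli_F _ _ _ _ _ mu _ mf f0.
exact: (measurableT_comp (fine_measurable measurableT) h).
Qed.

Lemma VG_densityE : VG_density r theta sigma m =
  fun x => if x == m then VG_density r theta sigma m m else vg_const * vg_mix x.
Proof.
by apply/funext => x; case: eqVneq => [->//|xm]; rewrite VG_density_mixture.
Qed.

Lemma measurable_VG_density : measurable_fun setT (VG_density r theta sigma m).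
Proof.
rewrite VG_densityE; apply: measurable_fun_ifT => //.
  by apply: measurable_fun_eqr.
by apply: measurable_funM => //; exact: measurable_vg_mix.
Qed.

Lemma besselK_ge0 (n z : R) : 0 <= besselK n z.
Proof.
by apply: Rintegral_ge0 => t _; rewrite mulr_ge0 ?expR_ge0// /cosh divr_ge0// addr_ge0 ?expR_ge0.
Qed.

Lemma VG_density_ge0 x : 0 <= VG_density r theta sigma m x.
Proof.
rewrite /VG_density !mulr_ge0 ?expR_ge0 ?powR_ge0 ?besselK_ge0//.
rewrite invr_ge0 !mulr_ge0 ?sqrtr_ge0 ?(ltW sigma0)//.
by apply: Rintegral_ge0 => t _; rewrite mulr_ge0 ?powR_ge0 ?expR_ge0.
Qed.

Lemma mul_fineA (a c : R) (I : \bar R) : I \is a fin_num ->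
  (a * (c * fine I))%:E = ((c * a)%:E * I)%E.
Proof. by case: I => // u _; rewrite -EFinM; congr EFin; rewrite /= mulrCA mulrA. Qed.

(** Tonelli's theorem for the mixture. All integrands are nonnegative and the integrals take
    extended values, so no integrability of h has to be known. *)
Lemma VG_tonelli (h : R -> R) : measurable_fun setT h -> (forall x, 0 <= h x) ->
  (\int[mu]_x (h x * VG_density r theta sigma m x)%:E =
   \int[mu]_w ((vg_const * gamma_kernel (r / 2) 2^-1 w)%:E *
      \int[mu]_x (h x * normal_pdf (vg_mean w) (vg_sd w) x)%:E))%E.
Proof.
move=> mh h00.
pose f (z : R * R) := vg_const * (h z.1 * vg_joint z.1 z.2).
have mf : measurable_fun setT (EFin \o f).
  apply/measurable_EFinP; apply: measurable_funM => //; apply: measurable_funM.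
    exact: (measurableT_comp mh).
  exact: measurable_vg_joint.
have f0 z : (0 <= (EFin \o f) z)%E.
  by rewrite lee_fin; apply: mulr_ge0; [exact: vg_const_ge0|apply: mulr_ge0; [exact: h00|exact: vg_joint_ge0]].
have := @fubini_tonelli _ _ _ _ _ mu mu _ mf f0.
move=> FT; apply: (etrans _ (etrans FT _)); last first.
  apply: eq_integral => w _.
  have mg : measurable_fun setT (fun x : R => (h x * normal_pdf (vg_mean w) (vg_sd w) x)%:E).
    apply/measurable_EFinP; exact: (measurable_funM mh (measurable_normal_pdf _ _)).
  have g0 (x : R) : setT x -> (0 <= (h x * normal_pdf (vg_mean w) (vg_sd w) x)%:E)%E.
    by move=> _; rewrite lee_fin; apply: mulr_ge0; [exact: h00|exact: normal_pdf_ge0].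
  have c0 : (0 <= (vg_const * gamma_kernel (r / 2) 2^-1 w)%:E)%E.
    by rewrite lee_fin; apply: mulr_ge0; [exact: vg_const_ge0|exact: expR_ge0].
  apply: etrans (@ge0_integralZl _ _ _ mu _ measurableT _ mg _ g0 c0).
  by apply: eq_integral => x _; rewrite -EFinM; congr EFin; rewrite /f /vg_joint/=; ring.
have mL : measurable_fun setT (fun x : R => (h x * VG_density r theta sigma m x)%:E).
  by apply/measurable_EFinP; exact: (measurable_funM mh measurable_VG_density).
have mR := @measurable_fun_fubini_tonelli_F _ _ _ _ _ mu _ mf f0.
apply: (@ae_eq_integral _ _ _ mu setT _ _ measurableT mL mR).
(* The mixture formula holds for x different from m, and the single point m is a null set. *)
exists [set m]; split; [exact: measurable_set1|exact: lebesgue_measure_set1|].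
move=> x /= nx; apply: contrapT => xm; apply: nx => _.
have {}xm : x != m by apply/eqP.
have c0 : (0 <= (vg_const * h x)%:E)%E.
  by rewrite lee_fin; apply: mulr_ge0; [exact: vg_const_ge0|exact: h00].
have mj : measurable_fun setT (fun w : R => (vg_joint x w)%:E).
  by apply/measurable_EFinP; apply: continuous_measurable_fun; exact: continuous_vg_joint.
have j0 (w : R) : setT w -> (0 <= (vg_joint x w)%:E)%E by move=> _; rewrite lee_fin vg_joint_ge0.
have Z := @ge0_integralZl _ _ _ mu _ measurableT _ mj _ j0 c0.
have -> : fubini_F mu (EFin \o f) x = (\int[mu]_w ((vg_const * h x)%:E * (vg_joint x w)%:E))%E.
  by apply: eq_integral => w _; rewrite /f/= -EFinM; congr EFin; ring.
rewrite Z (VG_density_mixture xm).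
exact: (mul_fineA _ _ (integrable_fin_num measurableT (integrable_vg_joint xm))).
Qed.

End vg.

(** * Gaussian integrals with arbitrary mean *)

Section shifted_gaussian.
Context {R : realType}.
Local Notation mu := (@lebesgue_measure R).

Lemma shifted_gaussian_integral (M s : R) (h : R -> R) (C : R) : s != 0 -> continuous h ->
  (forall x, 0 <= h x) -> (forall x, h (x + M) <= C * (1 + x ^+ 2)) ->
  (\int[mu]_x (h x * normal_pdf M s x)%:E = (\int[mu]_x (h (x + M) * normal_pdf 0 s x))%:E)%E.
Proof.
move=> s0 ch h0 hC.
have cG : continuous (fun x => h x * normal_pdf M s x).
  have cp : continuous (normal_pdf M s) := @continuous_normal_pdf _ M s s0.
  by move=> x; apply: cvgM; [exact: ch|exact: cp].
have G0 x : 0 <= h x * normal_pdf M s x by rewrite mulr_ge0 ?normal_pdf_ge0.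
rewrite -(@ge0_integral_translation _ _ M cG G0) /Rintegral.
have mh : measurable_fun setT (fun x : R => h (x + M)).
  apply: (measurableT_comp (continuous_measurable_fun ch)).
  exact: measurable_funD.
have hC' x : `|h (x + M)| <= C * (1 + x ^+ 2) by rewrite ger0_norm.
have E x : (h (x + M) * normal_pdf M s (x + M))%:E = (h (x + M) * normal_pdf 0 s x)%:E.
  by rewrite !normal_pdfE// /normal_fun addrK subr0.
have fi := integrable_fin_num measurableT (gauss_integrable s0 mh hC').
by apply: (etrans _ (esym (fineK fi))); apply: eq_integral => x _; exact: E.
Qed.

Lemma shifted_gaussian1 (M s : R) : s != 0 ->
  (\int[mu]_x (1 * normal_pdf M s x)%:E = 1%:E)%E.
Proof.
move=> s0; rewrite (@shifted_gaussian_integral M s (cst 1) 1 s0)//; first last.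
- by move=> x /=; rewrite mul1r lerDl sqr_ge0.
- exact: cst_continuous.
congr EFin; under eq_Rintegral do rewrite mul1r.
exact: normal_integral1.
Qed.

Lemma shifted_gaussian_sqr (M s : R) : s != 0 ->
  (\int[mu]_x ((1 + x ^+ 2) * normal_pdf M s x)%:E = (1 + s ^+ 2 + M ^+ 2)%:E)%E.
Proof.
move=> s0; rewrite (@shifted_gaussian_integral M s (fun x => 1 + x ^+ 2) (1 + 2 * M ^+ 2 + 2) s0)//; first last.
- move=> x /=; have := sqr_ge0 (x - M); have := sqr_ge0 x; have := sqr_ge0 M.
  by have := sqr_ge0 (M * x); nra.
- by move=> x; rewrite addr_ge0// sqr_ge0.
- by move=> x; apply: is_derive_continuous; der.
congr EFin.
pose p := normal_pdf (0 : R) s.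
have i1 : mu.-integrable setT (EFin \o (fun x : R => 1 * p x)).
  by apply: (@gauss_integrable _ s s0 (cst 1) 1) => // x; rewrite normr1 mul1r lerDl sqr_ge0.
have i2 : mu.-integrable setT (EFin \o (fun x : R => x ^+ 2 * p x)).
  apply: (@gauss_integrable _ s s0 (fun x => x ^+ 2) 1) => //.
  by move=> x; rewrite ger0_norm ?sqr_ge0// mul1r lerDr.
have ab (x : R) : `|x| <= 1 + x ^+ 2.
  by rewrite -[x ^+ 2]real_normK ?num_real//; have := normr_ge0 x; nra.
have i3 : mu.-integrable setT (EFin \o (fun x : R => x * p x)).
  apply: (@gauss_integrable _ s s0 id 1) => //.
  by move=> x; rewrite mul1r; exact: ab.
have z : \int[mu]_x (x * p x) = 0.
  have s2 : 0 < s ^+ 2 by rewrite exprn_even_gt0.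
  have i0 : 0 <= (s ^+ 2)^-1 by rewrite invr_ge0 ltW.
  have := @normal_integral_derive0 _ s s0 (fun=> 1) (fun=> 0) (1 + (s ^+ 2)^-1).
  have -> : (fun x : R => (0 - x / s ^+ 2 * 1) * normal_pdf 0 s x) = (fun x => - (s ^+ 2)^-1 * (x * p x)).
    by apply/funext => x; rewrite /p; ring.
  rewrite RintegralZl// => H.
  have {}H : - (s ^+ 2)^-1 * \int[mu]_x (x * p x) = 0.
    apply: H => [x|x|x].
    - apply: cvgB; first exact: cvg_cst.
      by apply: cvgM; [apply: cvgM => //|]; exact: cvg_cst.
    - by rewrite normr1 mulr1 (le_trans (ab x))// ler_peMl ?addr_ge0 ?sqr_ge0// lerDl.
    - rewrite sub0r normrN mulr1 normrM (ger0_norm i0) mulrC ler_pM// lerDr//.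
  move/eqP: H; rewrite mulf_eq0 oppr_eq0 invr_eq0 gt_eqF//= => /eqP.
  by [].
transitivity (\int[mu]_x ((1 + M ^+ 2) * (1 * p x) + ((2 * M) * (x * p x) + x ^+ 2 * p x))).
  by apply: eq_Rintegral => x _; rewrite -/(p x); ring.
rewrite RintegralD//; [|exact: intZ|by apply: intD => //; exact: intZ].
rewrite RintegralD//; last exact: intZ.
rewrite RintegralZl// RintegralZl// z normal_variance//.
rewrite (_ : \int[mu]_x (1 * p x) = 1); first by ring.
by under eq_Rintegral do rewrite mul1r; exact: normal_integral1.
Qed.

(** The added constant 1 keeps the integrand nonnegative, as the mixture formula requires. Its
    contribution is cancelled in [VG_cf] by means of the normalization. *)
Lemma shifted_gaussian_cos (M s t : R) : s != 0 ->
  (\int[mu]_x ((1 + cos (t * x)) * normal_pdf M s x)%:E =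
   (1 + expR (- (s ^+ 2 * t ^+ 2 / 2)) * cos (t * M))%:E)%E.
Proof.
move=> s0; rewrite (@shifted_gaussian_integral M s (fun x => 1 + cos (t * x)) 2 s0)//; first last.
- by move=> x /=; have := cos_le1 (t * (x + M)); have := sqr_ge0 x; move: (cos _) (x ^+ 2) => u v; lra.
- by move=> x; apply: is_derive_continuous; der.
congr EFin.
pose p := normal_pdf (0 : R) s.
have ib (h : R -> R) : continuous h -> (forall x, `|h x| <= 1) ->
    mu.-integrable setT (EFin \o (fun x : R => h x * p x)).
  move=> ch hb; apply: (@gauss_integrable _ s s0 h 1); first exact: continuous_measurable_fun.
  by move=> x; rewrite mul1r (le_trans (hb x))// lerDl sqr_ge0.
have i1 : mu.-integrable setT (EFin \o (fun x : R => 1 * p x)).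
  by apply: (ib (cst 1)) => [|x]; [exact: cst_continuous|rewrite normr1].
have i2 : mu.-integrable setT (EFin \o (fun x : R => cos (t * x) * p x)).
  apply: (ib (fun x => cos (t * x))) => x; last exact: cos_max.
  by apply: is_derive_continuous; der.
have i3 : mu.-integrable setT (EFin \o (fun x : R => sin (t * x) * p x)).
  apply: (ib (fun x => sin (t * x))) => x; last exact: sin_max.
  by apply: is_derive_continuous; der.
transitivity (\int[mu]_x (1 * p x + (cos (t * M) * (cos (t * x) * p x) - sin (t * M) * (sin (t * x) * p x)))).
  by apply: eq_Rintegral => x _; rewrite -/(p x) mulrDr cosD; ring.
rewrite RintegralD//; last by apply: intB; exact: intZ.
rewrite RintegralB//; [|exact: intZ|exact: intZ].
rewrite RintegralZl// RintegralZl// gauss_cos// gauss_sin//.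
rewrite (_ : \int[mu]_x (1 * p x) = 1); first by ring.
by under eq_Rintegral do rewrite mul1r; exact: normal_integral1.
Qed.

Lemma shifted_gaussian_sin (M s t : R) : s != 0 ->
  (\int[mu]_x ((1 + sin (t * x)) * normal_pdf M s x)%:E =
   (1 + expR (- (s ^+ 2 * t ^+ 2 / 2)) * sin (t * M))%:E)%E.
Proof.
move=> s0; rewrite (@shifted_gaussian_integral M s (fun x => 1 + sin (t * x)) 2 s0)//; first last.
- by move=> x /=; have := sin_le1 (t * (x + M)); have := sqr_ge0 x; move: (sin _) (x ^+ 2) => u v; lra.
- by move=> x; apply: is_derive_continuous; der.
congr EFin.
pose p := normal_pdf (0 : R) s.
have ib (h : R -> R) : continuous h -> (forall x, `|h x| <= 1) ->
    mu.-integrable setT (EFin \o (fun x : R => h x * p x)).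
  move=> ch hb; apply: (@gauss_integrable _ s s0 h 1); first exact: continuous_measurable_fun.
  by move=> x; rewrite mul1r (le_trans (hb x))// lerDl sqr_ge0.
have i1 : mu.-integrable setT (EFin \o (fun x : R => 1 * p x)).
  by apply: (ib (cst 1)) => [|x]; [exact: cst_continuous|rewrite normr1].
have i2 : mu.-integrable setT (EFin \o (fun x : R => cos (t * x) * p x)).
  apply: (ib (fun x => cos (t * x))) => x; last exact: cos_max.
  by apply: is_derive_continuous; der.
have i3 : mu.-integrable setT (EFin \o (fun x : R => sin (t * x) * p x)).
  apply: (ib (fun x => sin (t * x))) => x; last exact: sin_max.
  by apply: is_derive_continuous; der.
transitivity (\int[mu]_x (1 * p x + (cos (t * M) * (sin (t * x) * p x) + sin (t * M) * (cos (t * x) * p x)))).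
  by apply: eq_Rintegral => x _; rewrite -/(p x) mulrDr sinD; ring.
rewrite RintegralD//; last by apply: intD; exact: intZ.
rewrite RintegralD//; [|exact: intZ|exact: intZ].
rewrite RintegralZl// RintegralZl// gauss_cos// gauss_sin//.
rewrite (_ : \int[mu]_x (1 * p x) = 1); first by ring.
by under eq_Rintegral do rewrite mul1r; exact: normal_integral1.
Qed.

End shifted_gaussian.

(** * Moments and characteristic functions of Variance-Gamma laws *)

Section VG_law.
Context {R : realType}.
Local Notation mu := (@lebesgue_measure R).
Variables (r theta sigma m : R).
Hypotheses (r0 : 0 < r) (sigma0 : 0 < sigma).

Local Notation C := (vg_const r sigma).
Local Notation k := (r / 2).
Local Notation gk := (gamma_kernel k 2^-1).
Local Notation M := (vg_mean theta m).
Local Notation S := (vg_sd sigma).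

Let k0 : 0 < k. Proof. by rewrite divr_gt0. Qed.
Let h0 : 0 < 2^-1 :> R. Proof. by rewrite invr_gt0. Qed.
Let S0 w : S w != 0. Proof. exact: vg_sd_neq0. Qed.

(** The value of E[1 + Y^2], the summand 1 included. It is left as an integral: what matters is that
    it is finite and depends on the parameters alone, since it enters the constants of the
    theorem. *)
Definition vg_second_moment : R := \int[mu]_w (C * gk w * (1 + S w ^+ 2 + M w ^+ 2)).

Let isec : mu.-integrable setT (EFin \o (fun w => C * gk w * (1 + S w ^+ 2 + M w ^+ 2))).
Proof.
have e (n : nat) w : gk w * expR w ^+ n = gamma_kernel (k + n%:R) 2^-1 w.
  by rewrite /gamma_kernel -expRM_natl -expRD; congr expR; ring.
have -> : (fun w => C * gk w * (1 + S w ^+ 2 + M w ^+ 2)) = (fun w =>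
    C * (1 + m ^+ 2) * gk w + (C * (sigma ^+ 2 + 2 * m * theta) * gamma_kernel (k + 1) 2^-1 w +
    C * theta ^+ 2 * gamma_kernel (k + 2) 2^-1 w)).
  apply/funext => w; rewrite -(e 1) -(e 2) vg_sd2// /vg_mean; ring.
have i (k' : R) (c : R) : 0 < k' -> mu.-integrable setT (EFin \o (fun w => c * gamma_kernel k' 2^-1 w)).
  by move=> k'0; apply: intZ; exact: integrable_gamma_kernel1.
apply: intD; [exact: i|apply: intD; apply: i].
  by rewrite addr_gt0.
by rewrite addr_gt0.
Qed.

Context d (T : measurableType d) (Q : probability T R) (Y : {RV Q >-> R}).
Hypothesis lawY : has_law Y (VG r theta sigma m).

Let mY : measurable_fun setT (Y : T -> R). Proof. exact: measurable_funPT. Qed.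

Lemma VG_expectation (h n : R -> R) : measurable_fun setT h -> (forall x, 0 <= h x) ->
  (forall w, (\int[mu]_x (h x * normal_pdf (M w) (S w) x)%:E = (n w)%:E)%E) ->
  (\int[Q]_w (h (Y w))%:E = \int[mu]_w (C * gk w * n w)%:E)%E.
Proof.
move=> mh hh hn.
rewrite (@ge0_law_density _ _ _ Q Y (VG_density r theta sigma m) mY
  (measurable_VG_density r theta m sigma0) (VG_density_ge0 r theta m sigma0) lawY)//.
rewrite VG_tonelli//; apply: eq_integral => w _.
by rewrite hn.
Qed.

Lemma VG_normalization : C * gamma_int k 2^-1 = 1.
Proof.
have := @VG_expectation (cst 1) (cst 1) (measurable_cst _) (fun=> ler01)
  (fun w => shifted_gaussian1 _ (S0 w)).
have -> : (\int[Q]_w (cst 1 (Y w) : R)%:E = 1%:E)%E.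
  apply: (etrans (@integral_cst _ _ _ Q _ measurableT 1%:E)).
  by rewrite mul1e; exact: (@probability_setT _ _ _ Q).
move=> /esym/(congr1 fine) /=.
rewrite -/(Rintegral mu setT (fun w => C * gk w * 1)).
under eq_Rintegral do rewrite mulr1.
rewrite RintegralZl//; exact: integrable_gamma_kernel1.
Qed.

Lemma VG_second_moment : (\int[Q]_w (1 + Y w ^+ 2)%:E = vg_second_moment%:E)%E.
Proof.
rewrite (@VG_expectation (fun x => 1 + x ^+ 2) (fun w => 1 + S w ^+ 2 + M w ^+ 2)); first last.
- by move=> w; exact: shifted_gaussian_sqr.
- by move=> x; rewrite addr_ge0// sqr_ge0.
- by apply: continuous_measurable_fun => x; apply: is_derive_continuous; der.
exact: (esym (fineK (integrable_fin_num measurableT isec))).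
Qed.

(** Given G = exp w, the Gaussian factor exp(- sigma^2 t^2 G / 2) raises the rate of the Gamma
    kernel from 1/2 to c = (1 + sigma^2 t^2) / 2, and [gamma_cf] is used at frequency t theta. In
    complex form the result is exp(i t m) (1 + sigma^2 t^2 - 2 i t theta)^(- r / 2). *)
Lemma VG_cf t : let y := 2 * (t * theta) / (1 + sigma ^+ 2 * t ^+ 2) in
  let rho := expR (- k * ln (1 + sigma ^+ 2 * t ^+ 2)) * prho k y in
  \int[Q]_w cos (t * Y w) = rho * cos (pang k y + t * m) /\
  \int[Q]_w sin (t * Y w) = rho * sin (pang k y + t * m).
Proof.
move=> y rho.
pose c := 2^-1 * (1 + sigma ^+ 2 * t ^+ 2).
have st0 : 0 < 1 + sigma ^+ 2 * t ^+ 2 by rewrite ltr_pwDl// mulr_ge0 ?sqr_ge0.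
have c0 : 0 < c by rewrite mulr_gt0.
have c2 : 2 * c = 1 + sigma ^+ 2 * t ^+ 2 by rewrite /c; field.
have yE : t * theta / c = y.
  have l (a b : R) : b != 0 -> a / b = 2 * a / (2 * b) by move=> b0; field.
  by rewrite /y -c2 -l// gt_eqF.
have [gc gs] := gamma_cf k0 c0 (t * theta).
have e1 w : gk w * expR (- (S w ^+ 2 * t ^+ 2 / 2)) = gamma_kernel k c w.
  by rewrite vg_sd2// /gamma_kernel -expRD; congr expR; rewrite /c; field.
have e2 w : t * M w = t * theta * expR w + t * m by rewrite /vg_mean; ring.
have mc := continuous_measurable_fun (@continuous_cos R).
have msn := continuous_measurable_fun (@continuous_sin R).
have mtY : measurable_fun setT (fun w => t * Y w) by exact: measurable_funM.
have ic : mu.-integrable setT (EFin \o (fun w => cos (t * theta * expR w) * gamma_kernel k c w)).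
  apply: (@integrable_gamma_kernel _ _ _ (fun w => cos (t * theta * expR w)) 1) => //; last by move=> w; exact: cos_max.
  by apply: continuous_measurable_fun => w; apply: is_derive_continuous; der.
have is_ : mu.-integrable setT (EFin \o (fun w => sin (t * theta * expR w) * gamma_kernel k c w)).
  apply: (@integrable_gamma_kernel _ _ _ (fun w => sin (t * theta * expR w)) 1) => //; last by move=> w; exact: sin_max.
  by apply: continuous_measurable_fun => w; apply: is_derive_continuous; der.
have ig := integrable_gamma_kernel1 k0 h0.
have N := VG_normalization.
have sc : gamma_int k c = expR (- k * ln (1 + sigma ^+ 2 * t ^+ 2)) * gamma_int k 2^-1.
  by rewrite gamma_int_scale// c2.
rewrite yE sc in gc gs.
have J (g h : R -> R) : continuous g -> (forall x, `|g x| <= 1) ->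
    mu.-integrable setT (EFin \o (fun w => h w * gamma_kernel k c w)) ->
    (forall w, (\int[mu]_x ((1 + g x) * normal_pdf (M w) (S w) x)%:E =
       (1 + expR (- (S w ^+ 2 * t ^+ 2 / 2)) * h w)%:E)%E) ->
    \int[Q]_w g (Y w) = C * \int[mu]_w (h w * gamma_kernel k c w).
  move=> cg bg ih gE.
  have mg := continuous_measurable_fun cg.
  have mg1 : measurable_fun setT (fun x => 1 + g x) by exact: measurable_funD.
  have g0 x : 0 <= 1 + g x by have := bg x; rewrite ler_norml => /andP[+ _]; move: (g x) => u; lra.
  have := VG_expectation mg1 g0 gE => /(congr1 fine).
  rewrite -/(Rintegral Q setT (fun w => 1 + g (Y w))).
  rewrite -/(Rintegral mu setT (fun w => C * gk w * (1 + expR (- (S w ^+ 2 * t ^+ 2 / 2)) * h w))).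
  have -> : (fun w => C * gk w * (1 + expR (- (S w ^+ 2 * t ^+ 2 / 2)) * h w)) =
      fun w => C * gk w + C * (h w * gamma_kernel k c w).
    by apply/funext => w; rewrite -e1; ring.
  have igY : Q.-integrable setT (EFin \o (fun w => g (Y w))).
    by apply: (@bounded_integrable _ _ _ _ _ 1) => [|w]; [exact: measurableT_comp|exact: bg].
  have i1 : Q.-integrable setT (EFin \o (fun w : T => 1)).
    by apply: (@bounded_integrable _ _ _ _ _ 1) => // w; rewrite normr1.
  have one : \int[Q]_w (1 : R) = 1.
    rewrite Rintegral_cst// mul1r; exact: (congr1 fine (probability_setT Q)).
  have -> : \int[Q]_w (1 + g (Y w)) = 1 + \int[Q]_w g (Y w).
    by rewrite RintegralD// one.
  rewrite RintegralD//; [|exact: intZ|exact: intZ].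
  rewrite RintegralZl// RintegralZl// -/(gamma_int _ _) N.
  exact: addrI.
have ct (g : R -> R) : continuous g -> continuous (fun x => g (t * x)).
  move=> cg x; apply: (@continuous_comp _ _ _ ( *%R t) g); last exact: cg.
  exact: mulrl_continuous.
pose ch w := cos (t * theta * expR w + t * m).
pose sh w := sin (t * theta * expR w + t * m).
have chE : (fun w => ch w * gamma_kernel k c w) = fun w =>
    cos (t * m) * (cos (t * theta * expR w) * gamma_kernel k c w) -
    sin (t * m) * (sin (t * theta * expR w) * gamma_kernel k c w).
  by apply/funext => w; rewrite /ch cosD; ring.
have shE : (fun w => sh w * gamma_kernel k c w) = fun w =>
    cos (t * m) * (sin (t * theta * expR w) * gamma_kernel k c w) +
    sin (t * m) * (cos (t * theta * expR w) * gamma_kernel k c w).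
  by apply/funext => w; rewrite /sh sinD; ring.
have iC : mu.-integrable setT (EFin \o (fun w => ch w * gamma_kernel k c w)).
  by rewrite chE; apply: intB; exact: intZ.
have iS : mu.-integrable setT (EFin \o (fun w => sh w * gamma_kernel k c w)).
  by rewrite shE; apply: intD; exact: intZ.
split.
- rewrite (J (fun x => cos (t * x)) ch (ct _ (@continuous_cos R)) (fun x => cos_max _) iC); last first.
    by move=> w; rewrite shifted_gaussian_cos// e2.
  rewrite chE RintegralB//; [|exact: intZ|exact: intZ].
  rewrite RintegralZl// RintegralZl// gc gs cosD /rho.
  move: N; move: (gamma_int _ _) => I N; rewrite -[RHS]mul1r -N; ring.
- rewrite (J (fun x => sin (t * x)) sh (ct _ (@continuous_sin R)) (fun x => sin_max _) iS); last first.
    by move=> w; rewrite shifted_gaussian_sin// e2.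
  rewrite shE RintegralD//; [|exact: intZ|exact: intZ].
  rewrite RintegralZl// RintegralZl// gc gs sinD /rho.
  move: N; move: (gamma_int _ _) => I N; rewrite -[RHS]mul1r -N; ring.
Qed.

End VG_law.

(** * Rounding the eigenvalues *)

Section rounding.
Context {R : realType}.

Let sq (u v : R) : 0 <= u -> u <= `|v| -> u ^+ 2 <= v ^+ 2.
Proof. by move=> u0 uv; rewrite -[v ^+ 2]real_normK ?num_real// lerXn2r ?nnegrE. Qed.

Let pr (g u v w : R) : g ^+ 2 <= v -> g ^+ 2 <= w -> 0 <= u -> u * g ^+ 4 <= u * (v * w).
Proof.
move=> gv gw u0; rewrite (_ : g ^+ 4 = g ^+ 2 * g ^+ 2); last by ring.
by rewrite ler_wpM2l// ler_pM// sqr_ge0.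
Qed.

(** As g is at most half of a and of - b, the balls around a and b are disjoint and stay away from
    0. The rounding error is the distance to the chosen one of a, b, 0, and the distances to the
    other two are at least g. Moreover |y| <= 2 |x| in all cases, whence the constants 3 = 1 + 2 and
    7 = 1 + 2 + 4. *)
Let round_bounds_aux (a b g x : R) :
  let y := if `|x - a| < g then a else if `|x - b| < g then b else 0 in
  0 < a -> b < 0 -> 0 < g -> g <= a / 2 -> g <= - b / 2 ->
  [/\ (x - y) ^+ 2 * g ^+ 4 <= x ^+ 2 * (x - a) ^+ 2 * (x - b) ^+ 2,
      `|x + y| <= 3 * `|x| & `|x ^+ 2 + x * y + y ^+ 2| <= 7 * x ^+ 2].
Proof.
move=> y a0 b0 g0 ga gb; rewrite /y.
case: ifPn => [xa|xa].
  have [xl xu] : x - a < g /\ - g < x - a by move: xa; rewrite ltr_norml => /andP[].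
  have x0 : 0 < x by lra.
  split.
  - rewrite [X in _ <= X](_ : _ = (x - a) ^+ 2 * (x ^+ 2 * (x - b) ^+ 2)); last by ring.
    apply: pr; [| |exact: sqr_ge0]; apply: sq; rewrite ?(ltW g0)//.
      by rewrite gtr0_norm//; lra.
    by rewrite gtr0_norm; lra.
  - by rewrite !gtr0_norm; lra.
  - by rewrite ger0_norm; nra.
rewrite -leNgt in xa.
case: ifPn => [xb|xb].
  have [xl xu] : x - b < g /\ - g < x - b by move: xb; rewrite ltr_norml => /andP[].
  have x0 : x < 0 by lra.
  split.
  - rewrite [X in _ <= X](_ : _ = (x - b) ^+ 2 * (x ^+ 2 * (x - a) ^+ 2)); last by ring.
    apply: pr; [| |exact: sqr_ge0]; apply: sq; rewrite ?(ltW g0)//.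
      by rewrite ltr0_norm//; lra.
  - by rewrite !ltr0_norm; lra.
  - by rewrite ger0_norm; nra.
rewrite -leNgt in xb; split.
- rewrite subr0 -mulrA; apply: pr; [| |exact: sqr_ge0]; apply: sq; rewrite ?(ltW g0)//.
- by rewrite addr0 ler_peMl// ler1n.
- by rewrite mulr0 expr0n/= !addr0 ger0_norm ?sqr_ge0// ler_peMl ?sqr_ge0// ler1n.
Qed.

Variables a b : R.
Hypotheses (a0 : 0 < a) (b0 : b < 0).

Definition gap : R := Num.min a (- b) / 2.

Definition round x := if `|x - a| < gap then a else if `|x - b| < gap then b else 0.

Lemma gap_gt0 : 0 < gap.
Proof. by rewrite divr_gt0// lt_min a0 oppr_gt0. Qed.

Let ga : gap <= a / 2. Proof. by rewrite ler_pM2r ?invr_gt0// ge_min lexx. Qed.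
Let gb : gap <= - b / 2. Proof. by rewrite ler_pM2r ?invr_gt0// ge_min lexx orbT. Qed.

Lemma round_bounds x :
  [/\ (x - round x) ^+ 2 * gap ^+ 4 <= x ^+ 2 * (x - a) ^+ 2 * (x - b) ^+ 2,
      `|x + round x| <= 3 * `|x| & `|x ^+ 2 + x * round x + round x ^+ 2| <= 7 * x ^+ 2].
Proof. exact: round_bounds_aux a0 b0 gap_gt0 ga gb. Qed.

Variables (k : nat) (lam : nat -> R).

Definition count_a := (\sum_(0 <= i < k) (`|lam i - a| < gap)%R)%N.
Definition count_b := (\sum_(0 <= i < k) (~~ (`|lam i - a| < gap)%R && (`|lam i - b| < gap)%R))%N.

Lemma sum_round (f : R -> R) : f 0 = 0 ->
  \sum_(0 <= i < k) f (round (lam i)) = count_a%:R * f a + count_b%:R * f b.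
Proof.
move=> f0; rewrite !natr_sum !mulr_suml -big_split/=; apply: eq_bigr => i _.
rewrite /round; case: ifP => _ /=; first by rewrite mul1r mul0r addr0.
by case: ifP => _ /=; rewrite ?mul1r ?mul0r ?add0r// f0.
Qed.

Lemma round_close : gap ^+ 4 * \sum_(0 <= i < k) (lam i - round (lam i)) ^+ 2 <=
  \sum_(0 <= i < k) lam i ^+ 2 * (lam i - a) ^+ 2 * (lam i - b) ^+ 2.
Proof.
by rewrite mulr_sumr ler_sum// => i _; rewrite mulrC; case: (round_bounds (lam i)).
Qed.

(* AM-GM with a free parameter s plays the role of Cauchy-Schwarz. *)
Lemma round_moments (s B : R) : 0 < s -> (forall i, (i < k)%N -> `|lam i| <= B) ->
  let W := (2 * s)^-1 * \sum_(0 <= i < k) (lam i - round (lam i)) ^+ 2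
           + s / 2 * \sum_(0 <= i < k) lam i ^+ 2 in
  `|\sum_(0 <= i < k) lam i ^+ 2 - (count_a%:R * a ^+ 2 + count_b%:R * b ^+ 2)| <= 3 * W /\
  `|\sum_(0 <= i < k) lam i ^+ 3 - (count_a%:R * a ^+ 3 + count_b%:R * b ^+ 3)| <= 7 * B * W.
Proof.
move=> s0 lB W.
rewrite -(@sum_round (fun x => x ^+ 2)) ?expr0n//.
rewrite -(@sum_round (fun x => x ^+ 3)) ?expr0n//.
have WE : W = \sum_(0 <= i < k) ((2 * s)^-1 * (lam i - round (lam i)) ^+ 2 + s / 2 * lam i ^+ 2).
  by rewrite big_split/= /W !mulr_sumr.
have key i : `|lam i - round (lam i)| * `|lam i| <=
    (2 * s)^-1 * (lam i - round (lam i)) ^+ 2 + s / 2 * lam i ^+ 2.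
  rewrite -(real_normK (num_real (lam i - round (lam i)))) -(real_normK (num_real (lam i))).
  move: `|_ - _| `|lam i| => u v; rewrite -subr_ge0.
  rewrite (_ : _ - _ = (2 * s)^-1 * (u - s * v) ^+ 2); last by field; rewrite gt_eqF.
  by rewrite mulr_ge0 ?sqr_ge0// invr_ge0 mulr_ge0// ltW.
split; rewrite -sumrB (le_trans (ler_norm_sum _ _ _))// WE mulr_sumr big_nat [leRHS]big_nat ler_sum// => i /andP[_ ik];
  have [_ h2 h3] := round_bounds (lam i).
- rewrite subr_sqr normrM (le_trans (ler_wpM2l _ h2))//.
  by rewrite mulrCA ler_wpM2l.
- rewrite subrXX !big_ord_recr big_ord0/= add0r !expr0 mulr1 mul1r expr1.
  rewrite [X in _ * X](_ : _ = lam i ^+ 2 + lam i * round (lam i) + round (lam i) ^+ 2); last by rewrite /=; ring.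
  rewrite normrM (le_trans (ler_wpM2l _ h3))//.
  have e : `|lam i - round (lam i)| * (7 * lam i ^+ 2) = 7 * `|lam i| * (`|lam i - round (lam i)| * `|lam i|).
    by rewrite -[lam i ^+ 2]real_normK ?num_real//; ring.
  rewrite e; apply: ler_pM => //; rewrite ?mulr_ge0//.
  by rewrite ler_wpM2l// lB.
Qed.

End rounding.

Section multiplicities.
Context {R : realType}.

(** If r is an integer, tau = 1 works. Otherwise tau is at most the distance from r to the
    neighbouring integers and no n satisfies the premise. Thus an approximate multiplicity r forces
    r to be an integer. *)
Lemma nat_isolated (r : R) : 0 < r -> exists2 tau : R, 0 < tau &
  forall n : nat, `|n%:R - r| < tau -> r = n%:R.
Proof.
move=> r0; have [n0 n1] := andP (truncn_itv (ltW r0)).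
set n := Num.trunc r in n0 n1.
have key (e : R) (j : nat) : e <= n.+1%:R - r -> e <= r - n%:R \/ r = n%:R -> e <= 1 -> `|j%:R - r| < e -> r = j%:R.
  move=> e1 e2 e3; rewrite ltr_norml => /andP[l u].
  have jn1 : (j < n.+1)%N by rewrite -(ltr_nat R); lra.
  have nj : (n <= j)%N.
    by rewrite -ltnS -(ltr_nat R) -natr1; lra.
  have jn : j = n by apply/eqP; rewrite eqn_leq nj -ltnS jn1.
  by case: e2 => // e2; move: l; rewrite jn; lra.
have [rn|rn] := eqVneq r n%:R.
- exists 1 => // j; apply: key; rewrite ?rn -?natr1//; first by lra.
  by right.
- have n0' : n%:R < r by rewrite lt_neqAle eq_sym rn.
  exists (Num.min 1 (Num.min (n.+1%:R - r) (r - n%:R))).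
    by rewrite !lt_min ltr01 !subr_gt0 n1.
  move=> j; apply: key; rewrite ?ge_min ?lexx ?orbT//.
  by left.
Qed.

(* The expression under the root in (a), in terms of the eigenvalues. *)
Definition stein_defect (r s2 theta : R) k (lam : nat -> R) : R :=
  2 * (\sum_(0 <= i < k) lam i ^+ 2 * (s2 + 4 * theta * lam i - 4 * lam i ^+ 2) ^+ 2) +
  (s2 * r * theta + 4 * theta * (\sum_(0 <= i < k) lam i ^+ 2)
   - 4 * (\sum_(0 <= i < k) lam i ^+ 3)) ^+ 2.

(** Here sigma^2 + 4 theta x - 4 x^2 = - 4 (x - a)(x - b), so the first sum of the defect is 16
    times the sum in [round_close]; its coefficient 2 makes 32. *)
Lemma stein_defect_round (r a b : R) k lam : 0 < a -> b < 0 ->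
  32 * gap a b ^+ 4 * (\sum_(0 <= i < k) (lam i - round a b (lam i)) ^+ 2)
    <= stein_defect r (- 4 * a * b) (a + b) k lam.
Proof.
move=> a0 b0; set s2 : R := - 4 * a * b; set theta : R := a + b.
have h := round_close a0 b0 k lam.
rewrite /stein_defect (_ : \sum_(0 <= i < k) lam i ^+ 2 * (s2 + 4 * theta * lam i - 4 * lam i ^+ 2) ^+ 2
  = 16 * \sum_(0 <= i < k) lam i ^+ 2 * (lam i - a) ^+ 2 * (lam i - b) ^+ 2).
  move: h; set V := \sum_(0 <= i < k) _; set G := \sum_(0 <= i < k) _ => h.
  by apply: (@le_trans _ _ (2 * (16 * G))); [nra|rewrite lerDl sqr_ge0].
by rewrite mulr_sumr; apply: eq_bigr => i _; rewrite /s2 /theta; ring.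
Qed.

(** With m and n the two counts, the residuals u for p_2 and v for p_3 satisfy v - b u = (m - r) a^2
    (a - b) and a u - v = (n - r) b^2 (a - b). Small residuals bring both counts within [tau] of r,
    and [nat_isolated] turns this into equality. *)
Lemma multiplicities (r a b : R) : 0 < r -> 0 < a -> b < 0 ->
  exists2 e : R, 0 < e & forall k lam,
  Num.sqrt (stein_defect r (- 4 * a * b) (a + b) k lam) +
    `|2 * r * (a ^+ 2 + b ^+ 2) - 2 * \sum_(0 <= i < k) lam i ^+ 2| < e ->
  exists N : nat, [/\ r = N%:R, count_a a b k lam = N & count_b a b k lam = N].
Proof.
move=> r0 a0 b0; have [tau tau0 tauP] := nat_isolated r0.
have ab0 : 0 < a - b by lra.
have a20 : 0 < a ^+ 2 by rewrite exprn_gt0.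
have b20 : 0 < b ^+ 2 by rewrite exprn_even_gt0//= lt_eqF.
pose s2 : R := - 4 * a * b; pose theta : R := a + b; pose gap : R := gap a b.
pose den := Num.min (a ^+ 2 * (a - b)) (b ^+ 2 * (a - b)).
have den0 : 0 < den by rewrite lt_min (mulr_gt0 a20 ab0) (mulr_gt0 b20 ab0).
pose c := 2 * r * (a ^+ 2 + b ^+ 2).
have c0 : 0 < c by apply: mulr_gt0; [exact: mulr_gt0|exact: addr_gt0].
(* B bounds p_2 as well as every eigenvalue, the latter by |x| <= 1 + x^2 <= 1 + p_2. *)
pose B := c + 2.
have B0 : 0 < B by rewrite addr_gt0.
pose K := 7 * B + 1 + `|theta| + (`|a| + `|b|) * 4.
have K0 : 0 < K.
  rewrite /K; have := normr_ge0 theta; have := normr_ge0 a; have := normr_ge0 b.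
  by move: (`|a|) (`|b|) (`|theta|) => x y z; lra.
(* K is the constant in the bound of v - x u by W + sD + del for x = a, b. Keeping that sum below t1
   keeps the counts within [tau] of r. *)
pose t1 := tau * den / K.
have t10 : 0 < t1 by rewrite divr_gt0// mulr_gt0.
(* With this s the part s / 2 * p_2 of W is at most t1 / 4. *)
pose s := t1 / (2 * B).
have s0 : 0 < s by rewrite divr_gt0// mulr_gt0.
have g0 : 0 < gap ^+ 4 by apply: exprn_gt0; exact: gap_gt0.
(* The three entries give, in this order, D <= sD + del, then sD + del < t1 / 4, and, through 32
   gap^4 V <= D, a bound t1 / 4 for the part of W containing V. *)
exists (Num.min 1 (Num.min (t1 / 4) (16 * gap ^+ 4 * s * t1))).
  rewrite !lt_min ltr01 divr_gt0//=; apply: mulr_gt0 => //; apply: mulr_gt0 => //; exact: mulr_gt0.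
move=> k lam; rewrite -/s2 -/theta; have := stein_defect_round r k lam a0 b0; rewrite -/s2 -/theta -/gap => Dr.
set D := stein_defect _ _ _ _ _ in Dr *; set sD := Num.sqrt D.
set p2 := \sum_(0 <= i < k) lam i ^+ 2; rewrite -/c; set del := `|_|.
rewrite !lt_min => /and3P[e1 e2 e3].
have D0 : 0 <= D.
  rewrite addr_ge0 ?sqr_ge0// mulr_ge0// sumr_ge0// => i _.
  by rewrite mulr_ge0 ?sqr_ge0.
have sD0 : 0 <= sD := sqrtr_ge0 _.
have sD2 : sD ^+ 2 = D by rewrite sqr_sqrtr.
have del0 : 0 <= del := normr_ge0 _.
have De : D <= sD + del by rewrite -sD2; nra.
have /andP[dl du] : - del <= c - 2 * p2 <= del by rewrite -ler_norml.
have p2B : p2 <= B by rewrite /B; lra.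
have p20 : 0 <= p2 by rewrite sumr_ge0// => i _; exact: sqr_ge0.
have lB i : (i < k)%N -> `|lam i| <= B.
  move=> ik; have : lam i ^+ 2 <= p2.
    rewrite /p2 big_mkord (bigD1 (Ordinal ik))//= lerDl sumr_ge0// => j _; exact: sqr_ge0.
  rewrite -[lam i ^+ 2]real_normK ?num_real//; move: `|lam i| (normr_ge0 (lam i)) => x x0 xp.
  have : x <= 1 + x ^+ 2 by nra.
  by rewrite /B; lra.
have := round_moments a0 b0 s0 lB.
rewrite -/p2; set V := \sum_(0 <= i < k) _ in Dr *; set W := _ + s / 2 * p2.
set p3 := \sum_(0 <= i < k) lam i ^+ 3.
set m := (count_a a b k lam)%:R; set n := (count_b a b k lam)%:R => - [h2 h3].
have V0 : 0 <= V by rewrite sumr_ge0// => i _; exact: sqr_ge0.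
have WB : W + (sD + del) < t1.
  have w1 : (2 * s)^-1 * V < t1 / 4.
    have s20 : 0 < 2 * s by exact: mulr_gt0.
    rewrite mulrC ltr_pdivrMr//.
    have : 32 * gap ^+ 4 * V < 16 * gap ^+ 4 * s * t1 by lra.
    move: (gap ^+ 4) g0 => g g0 h.
    have {}h : g * (2 * V - s * t1) < 0 by nra.
    move: h; rewrite pmulr_rlt0//; nra.
  have w2 : s / 2 * p2 <= t1 / 4.
    rewrite (_ : t1 / 4 = s / 2 * B); first by rewrite ler_wpM2l// divr_ge0// ltW.
    by rewrite /s; field; rewrite gt_eqF.
  by rewrite /W; lra.
have W0 : 0 <= W.
  apply: addr_ge0; apply: mulr_ge0 => //; last by apply: divr_ge0 => //; exact: ltW.
  by rewrite invr_ge0; apply: mulr_ge0 => //; exact: ltW.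
pose u := (m - r) * a ^+ 2 + (n - r) * b ^+ 2.
pose v := (m - r) * a ^+ 3 + (n - r) * b ^+ 3.
have ub : `|u| <= 3 * W + del / 2.
  rewrite (_ : u = - (p2 - (m * a ^+ 2 + n * b ^+ 2)) - (c - 2 * p2) / 2); last first.
    by rewrite /u /c; field.
  by rewrite (le_trans (ler_normB _ _))// normrN normrM [`|2^-1|]gtr0_norm ?invr_gt0//; apply: lerD.
have Zb : `|s2 * r * theta + 4 * theta * p2 - 4 * p3| <= sD.
  rewrite -sqrtr_sqr ler_wsqrtr// lerDr mulr_ge0// sumr_ge0// => i _.
  by rewrite mulr_ge0 ?sqr_ge0.
have vb : `|v| <= 7 * B * W + sD / 4 + `|theta| * del / 2.
  rewrite (_ : v = - (p3 - (m * a ^+ 3 + n * b ^+ 3)) - (s2 * r * theta + 4 * theta * p2 - 4 * p3) / 4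
     + - (theta * (c - 2 * p2) / 2)); last first.
    by rewrite /v /c /s2 /theta; field.
  rewrite (le_trans (ler_normD _ _))// normrN; apply: lerD; last first.
    by rewrite !normrM [`|2^-1|]gtr0_norm ?invr_gt0.
  rewrite (le_trans (ler_normB _ _))// normrN; apply: lerD => //.
  by rewrite normrM [`|4^-1|]gtr0_norm ?invr_gt0// ler_pM2r ?invr_gt0.
have fin (z w x : R) : w = z * x -> den <= z -> `|w| <= K * (W + (sD + del)) -> `|x| < tau.
  move=> -> dz; rewrite normrM => H.
  have z0 : 0 < z by rewrite (lt_le_trans den0).
  rewrite (gtr0_norm z0) in H.
  have : K * (W + (sD + del)) < tau * den.
    by rewrite mulrC -ltr_pdivlMr.
  move: (normr_ge0 x); move: `|x| H => y; nra.
have Kb (x : R) : `|x| <= `|a| + `|b| -> `|v - x * u| <= K * (W + (sD + del)).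
  move=> xb; rewrite (le_trans (ler_normB _ _))// normrM.
  have h4 : `|x| * `|u| <= (`|a| + `|b|) * (3 * W + del / 2) by rewrite ler_pM.
  rewrite (le_trans (lerD vb h4))// /K.
  move: (`|a| + `|b|) (le_trans (normr_ge0 _) xb) `|theta| (normr_ge0 theta) => A A0 T T0.
  rewrite -subr_ge0.
  rewrite (_ : _ - _ = W * (1 + T + A) + sD * (7 * B + 3/4 + T + 4 * A) + del * (7 * B + 1 + T / 2 + 7 / 2 * A)); last by field.
  by rewrite !addr_ge0// mulr_ge0// !addr_ge0// ?mulr_ge0// ?divr_ge0// ltW.
have rm : r = m.
  apply: tauP; apply: (fin (a ^+ 2 * (a - b)) (v - b * u)); first by rewrite /u /v; ring.
    by rewrite ge_min lexx.
  by apply: Kb; rewrite lerDr.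
have rn : r = n.
  apply: tauP; apply: (fin (b ^+ 2 * (a - b)) (- (v - a * u))); first by rewrite /u /v; ring.
    by rewrite ge_min lexx orbT.
  by rewrite normrN; apply: Kb; rewrite lerDl.
exists (count_a a b k lam); split => //.
by apply/eqP; rewrite -(eqr_nat R) -/n -/m -rm rn.
Qed.

End multiplicities.

(** * First moments and Lipschitz functions *)

Section moments.
Context {R : realType} d (T : measurableType d) (P : probability T R).

Lemma Rintegral_prob_cst (c : R) : \int[P]_w c = c.
Proof.
by rewrite Rintegral_cst// (congr1 fine (probability_setT P)) mulr1.
Qed.

(* AM-GM replaces Cauchy-Schwarz. *)
Lemma L1_le_L2 (G : T -> R) (q : R) : measurable_fun setT G ->
  (\int[P]_w (G w ^+ 2)%:E = q%:E)%E ->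
  P.-integrable setT (EFin \o G) /\ \int[P]_w `|G w| <= Num.sqrt q.
Proof.
move=> mG GE; have GR : \int[P]_w (G w ^+ 2) = q := congr1 fine GE.
have i2 : P.-integrable setT (EFin \o (fun w => G w ^+ 2)).
  apply/integrableP; split; first by apply/measurable_EFinP; exact: measurable_funX.
  rewrite (eq_integral (fun w => (G w ^+ 2)%:E)); last first.
    by move=> w _; rewrite /= ger0_norm ?sqr_ge0.
  by rewrite GE ltry.
have ic (c : R) : P.-integrable setT (EFin \o (fun _ : T => c)).
  by apply: (@bounded_integrable _ _ _ _ _ `|c|).
have b (s : R) w : 0 < s -> `|G w| <= (2 * s)^-1 * G w ^+ 2 + s / 2.
  move=> s0; rewrite -[G w ^+ 2]real_normK ?num_real//; move: `|G w| => u; rewrite -subr_ge0.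
  rewrite (_ : _ - _ = (2 * s)^-1 * (u - s) ^+ 2); last by field; rewrite gt_eqF.
  by rewrite mulr_ge0 ?sqr_ge0// invr_ge0 mulr_ge0// ltW.
have ib (s : R) : P.-integrable setT (EFin \o (fun w => (2 * s)^-1 * G w ^+ 2 + s / 2)).
  by apply: intD => //; exact: intZ.
have iG : P.-integrable setT (EFin \o G).
  by apply: (@int_le _ _ _ _ _ _ mG (ib 1)) => w; exact: b.
split => //.
have ie (s : R) : 0 < s -> \int[P]_w `|G w| <= (2 * s)^-1 * q + s / 2.
  move=> s0; have -> : (2 * s)^-1 * q + s / 2 = \int[P]_w ((2 * s)^-1 * G w ^+ 2 + s / 2).
    rewrite RintegralD//; last exact: intZ.
    by rewrite (RintegralZl _ measurableT i2) GR Rintegral_prob_cst.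
  apply: le_Rintegral => //.
  - exact: integrable_norm iG.
  - by move=> w _; exact: b.
have q0 : 0 <= q by rewrite -lee_fin -GE integral_ge0// => w _; rewrite lee_fin sqr_ge0.
(* The optimal parameter s = sqrt q is not admissible for q = 0; there the bound holds up to every e
   > 0. *)
have [q0'|qn0] := eqVneq q 0.
  rewrite q0' sqrtr0; apply/ler_addgt0Pl => e e0; rewrite addr0.
  have e20 : 0 < 2 * e by exact: mulr_gt0.
  by have := ie _ e20; rewrite q0' mulr0 add0r mulrAC divff// mul1r.
have sq0 : 0 < Num.sqrt q by rewrite sqrtr_gt0 lt_neqAle eq_sym qn0.
apply: (le_trans (ie _ sq0)); rewrite -{2}[q]sqr_sqrtr//.
by rewrite le_eqVlt; apply/orP; left; apply/eqP; field; rewrite gt_eqF.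
Qed.

Lemma lipschitz_continuous (h : R -> R) : (forall x y, `|h x - h y| <= `|x - y|) -> continuous h.
Proof.
move=> hl x; apply/cvgrPdist_lt => e e0; near=> y.
by rewrite (le_lt_trans (hl _ _))//; near: y; apply: cvgr_dist_lt.
Unshelve. all: by end_near. Qed.

Lemma lipschitz_integrable (h : R -> R) (Z : T -> R) : (forall x y, `|h x - h y| <= `|x - y|) ->
  P.-integrable setT (EFin \o Z) -> P.-integrable setT (EFin \o (fun w => h (Z w))).
Proof.
move=> hl iZ.
have mZ : measurable_fun setT Z by exact: int_measurable iZ.
have mh := continuous_measurable_fun (lipschitz_continuous hl).
apply: (@int_le _ _ _ _ _ (fun w => `|Z w| + `|h 0|)).
- exact: measurableT_comp.
- apply: intD; first exact: integrable_norm iZ.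
  by apply: (@bounded_integrable _ _ _ _ _ `|h 0|) => // w; rewrite normr_id.
- move=> w; rewrite -{1}[h _](subrK (h 0)) (le_trans (ler_normD _ _))// lerD2r.
  by rewrite (le_trans (hl _ _))// subr0.
Qed.

Lemma lipschitz_dist (h : R -> R) (Z Z' : T -> R) : (forall x y, `|h x - h y| <= `|x - y|) ->
  P.-integrable setT (EFin \o Z) -> P.-integrable setT (EFin \o Z') ->
  `|\int[P]_w h (Z w) - \int[P]_w h (Z' w)| <= \int[P]_w `|Z w - Z' w|.
Proof.
move=> hl iZ iZ'.
have i1 := lipschitz_integrable hl iZ; have i2 := lipschitz_integrable hl iZ'.
rewrite -RintegralB//; apply: (le_trans (le_normr_Rintegral _ _)) => //.
  exact: intB.
apply: le_Rintegral => //.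
- exact: integrable_norm (intB i1 i2).
- exact: integrable_norm (intB iZ iZ').
Qed.

End moments.

(* The truncations max(-n, min(n, h)) reduce h to bounded functions. *)
Lemma fourier_unique_lipschitz (R : realType) d (T : measurableType d) (P : probability T R) (Z : T -> R)
    d' (T' : measurableType d') (P' : probability T' R) (Z' : T' -> R) :
  P.-integrable setT (EFin \o Z) -> P'.-integrable setT (EFin \o Z') ->
  (forall t, \int[P]_w cos (t * Z w) = \int[P']_w cos (t * Z' w)) ->
  (forall t, \int[P]_w sin (t * Z w) = \int[P']_w sin (t * Z' w)) ->
  forall h : R -> R, (forall x y, `|h x - h y| <= `|x - y|) ->
  \int[P]_w h (Z w) = \int[P']_w h (Z' w).
Proof.
move=> iZ iZ' ec es h hl.
have mZ : measurable_fun setT Z by exact: int_measurable iZ.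
have mZ' : measurable_fun setT Z' by exact: int_measurable iZ'.
have ch := lipschitz_continuous hl.
pose g n x : R := Num.max (- n%:R) (Num.min n%:R (h x)).
have cg n : continuous (g n).
  move=> x; apply: (@continuous_max _ _ (cst (- n%:R)) (fun x => Num.min n%:R (h x))).
    exact: cst_continuous.
  by apply: (@continuous_min _ _ (cst (n%:R)) h); [exact: cst_continuous|exact: ch].
have gn n x : `|g n x| <= n%:R.
  rewrite ler_norml le_max lexx/= ge_max ge_min lexx/= andbT.
  by rewrite (@le_trans _ _ 0)// oppr_le0.
have gh n x : `|g n x| <= `|h x|.
  have n0 : 0 <= n%:R :> R by [].
  rewrite /g; case: (leP n%:R (h x)) => [nh|hn].
    have nn : - n%:R <= n%:R :> R by rewrite (@le_trans _ _ 0)// oppr_le0.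
    by rewrite max_r// ger0_norm// (le_trans nh)// ler_norm.
  case: (leP (- n%:R) (h x)) => [//|hn'].
  by rewrite normrN ger0_norm// -normrN (le_trans _ (ler_norm _))// lerNr ltW.
have gl x : g n x @[n --> \oo] --> h x.
  apply: cvg_near_cst; near=> n.
  have hn : `|h x| <= n%:R by near: n; exact: nbhs_infty_ger.
  by move: hn; rewrite ler_norml => /andP[h1 h2]; rewrite /g min_r// max_r.
have E n : \int[P]_w g n (Z w) = \int[P']_w g n (Z' w).
  have e d0 (S : measurableType d0) (m : probability S R) (u : S -> R) :
      \int[m]_w (1 * u w) = \int[m]_w u w by apply: eq_Rintegral => w _; rewrite mul1r.
  rewrite -(e _ _ P) -(e _ _ P').
  apply: (@fourier_unique _ _ _ P (fun=> 1) Z _ _ P' (fun=> 1) Z' 1 _ _ _ _ _ _ _ _ (g n) n%:R) => //.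
  - by move=> _; rewrite normr1.
  - by move=> _; rewrite normr1.
  - by move=> t; rewrite !e.
  - by move=> t; rewrite !e.
have L d0 (S : measurableType d0) (m : probability S R) (u : S -> R) :
    m.-integrable setT (EFin \o u) -> (\int[m]_w g n (u w)) @[n --> \oo] --> \int[m]_w h (u w).
  move=> iu; have mu : measurable_fun setT u by exact: int_measurable iu.
  apply: (@dominated_cvgR _ _ _ m (fun n w => g n (u w)) (fun w => h (u w)) (fun w => `|h (u w)|) _ _ _ _).2.
  - by move=> n; apply: (measurableT_comp (continuous_measurable_fun (cg n))).
  - exact: integrable_norm (lipschitz_integrable hl iu).
  - by move=> w; exact: gl.
  - by move=> n w; exact: gh.
have LZ := L _ _ P Z iZ; have LZ' := L _ _ P' Z' iZ'.
rewrite (funext E) in LZ.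
exact: (cvg_unique _ LZ LZ').
Unshelve. all: by end_near. Qed.

(** * Matching a pair of roots with the Variance-Gamma characteristic function *)

Section matching.
Context {R : realType}.

(** The two angles have opposite signs and lie strictly between - pi/2 and pi/2, so their sum does
    too and the addition formula needs no multiple of pi. This is where the opposite signs of a and
    b help. *)
Lemma atan_add_opp (u v : R) : 0 <= u -> v <= 0 -> atan u + atan v = atan ((u + v) / (1 - u * v)).
Proof.
move=> u0 v0.
have au : 0 <= atan u by rewrite -(@atan0 R) le_atan.
have av : atan v <= 0 by rewrite -(@atan0 R) le_atan.
have u1 := atan_ltpi2 u; have v1 := atan_gtNpi2 v; have pi0 := @pi_gt0 R.
have cn (x : R) : cos (atan x) != 0.
  by rewrite gt_eqF// cos_gt0_pihalf// atan_gtNpi2 atan_ltpi2.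
rewrite -[LHS]tanK; first by rewrite tanD// !atanK.
by rewrite in_itv/=; apply/andP; split; lra.
Qed.

Variables (a b : R) (t : R).
Hypotheses (a0 : 0 < a) (b0 : b < 0).
Let s2 := - 4 * a * b.
Let y := 2 * (t * (a + b)) / (1 + s2 * t ^+ 2).

Let den0 : 0 < 1 + s2 * t ^+ 2.
Proof.
rewrite ltr_pwDl// mulr_ge0 ?sqr_ge0// /s2 -mulrA mulNr oppr_ge0 mulr_ge0_le0//.
by rewrite mulr_ge0_le0 ?ltW.
Qed.

Let denE : 1 - (2 * (t * a)) * (2 * (t * b)) = 1 + s2 * t ^+ 2.
Proof. by rewrite /s2; ring. Qed.

(** This and [matching_modulus] express (1 - 2 i t a)(1 - 2 i t b) = (1 + s2 t^2)(1 - i y) by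
    arguments and by moduli. The sign of t decides which of the two angles is nonnegative. *)
Lemma matching_arg : atan (2 * (t * a)) + atan (2 * (t * b)) = atan y.
Proof.
have numE (x z : R) : 2 * (t * x) + 2 * (t * z) = 2 * (t * (x + z)) by ring.
have [t0|t0] := leP 0 t.
- rewrite atan_add_opp; first by rewrite denE numE.
    by rewrite mulr_ge0// mulr_ge0// ltW.
  by rewrite mulr_ge0_le0// mulr_ge0_le0// ltW.
- rewrite addrC atan_add_opp; first by rewrite [2 * (t * b) * _]mulrC denE numE [b + a]addrC.
    by rewrite mulr_ge0// mulr_le0// ltW.
  by rewrite mulr_ge0_le0// mulr_le0_ge0// ltW.
Qed.

Lemma matching_modulus : ln (1 + (2 * (t * a)) ^+ 2) + ln (1 + (2 * (t * b)) ^+ 2) =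
  2 * ln (1 + s2 * t ^+ 2) + ln (1 + y ^+ 2).
Proof.
rewrite -lnM ?posrE ?sqr1_gt0//.
rewrite (_ : 2 * ln _ = ln ((1 + s2 * t ^+ 2) ^+ 2)); last by rewrite lnXn// mulr_natl.
rewrite -lnM ?posrE ?sqr1_gt0 ?exprn_gt0//; congr ln.
rewrite /y; move: den0 (erefl (1 + s2 * t ^+ 2)); move: {1 3 4 5}(1 + _) => D D0 DE.
transitivity (D ^+ 2 + (2 * (t * (a + b))) ^+ 2); last by field; rewrite gt_eqF.
by rewrite -DE /s2; ring.
Qed.

End matching.

Lemma VG_roots (R : realType) (theta sigma : R) : 0 < sigma -> exists a b : R,
  [/\ 0 < a, b < 0, a + b = theta & - 4 * a * b = sigma ^+ 2].
Proof.
move=> s0; pose D := Num.sqrt (theta ^+ 2 + sigma ^+ 2).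
have s20 : 0 < sigma ^+ 2 by rewrite exprn_gt0.
have D2 : D ^+ 2 = theta ^+ 2 + sigma ^+ 2 by rewrite sqr_sqrtr// addr_ge0 ?sqr_ge0.
have D0 : 0 <= D := sqrtr_ge0 _.
exists ((theta + D) / 2), ((theta - D) / 2); split.
- by rewrite divr_gt0//; nra.
- by rewrite pmulr_llt0 ?invr_gt0//; nra.
- by field.
- rewrite (_ : - 4 * _ * _ = D ^+ 2 - theta ^+ 2); last by field.
  by rewrite D2; ring.
Qed.

(** * The bound for finite chaos sums *)

Section finite_chaos.
Context {R : realType} d (T : measurableType d) (P : probability T R).
Variables (k : nat) (X : nat -> T -> R).
Hypotheses (mX : forall i, measurable_fun setT (X i)) (gX : std_gauss P k X).

Definition chaos (lam : nat -> R) w := \sum_(0 <= i < k) lam i * (X i w ^+ 2 - 1).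

(** The isometry is a hypothesis because [chaos_isometry] will inherit it from the double integral,
    which spares computing fourth moments of the Gaussian coordinates. *)
Hypothesis isoX : forall lam,
  (\int[P]_w (chaos lam w ^+ 2)%:E = (2 * \sum_(0 <= i < k) lam i ^+ 2)%:E)%E.

Lemma measurable_chaos lam : measurable_fun setT (chaos lam).
Proof.
apply: measurable_fun_sum_nat => i; apply: measurable_funM => //.
by apply: measurable_funB => //; exact: measurable_funX.
Qed.

Lemma chaos_integrable lam : P.-integrable setT (EFin \o chaos lam).
Proof. by have [] := L1_le_L2 (measurable_chaos lam) (isoX lam). Qed.

Lemma chaos_dist lam mu : \int[P]_w `|chaos lam w - chaos mu w| <=
  Num.sqrt (2 * \sum_(0 <= i < k) (lam i - mu i) ^+ 2).
Proof.
have e w : chaos lam w - chaos mu w = chaos (fun i => lam i - mu i) w.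
  by rewrite /chaos -sumrB; apply: eq_bigr => i _; ring.
under eq_Rintegral do rewrite e.
by have [] := L1_le_L2 (measurable_chaos _) (isoX (fun i => lam i - mu i)).
Qed.

Variables (r theta sigma : R).
Hypotheses (r0 : 0 < r) (sigma0 : 0 < sigma).
Context d' (T' : measurableType d') (Q : probability T' R) (Y : {RV Q >-> R}).
Hypothesis lawY : has_law Y (VGc r theta sigma).

Lemma VGc_integrable : Q.-integrable setT (EFin \o Y) /\
  \int[Q]_w `|Y w| <= Num.sqrt (vg_second_moment r theta sigma (- (r * theta)) - 1).
Proof.
have mY : measurable_fun setT (Y : T' -> R) by exact: measurable_funPT.
apply: L1_le_L2 => //.
have := VG_second_moment r0 sigma0 lawY.
set K := vg_second_moment _ _ _ _ => E.
have i1 : Q.-integrable setT (EFin \o (fun w : T' => 1 : R)).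
  by apply: (@bounded_integrable _ _ _ _ _ 1) => // w; rewrite normr1.
have i2 : Q.-integrable setT (EFin \o (fun w => 1 + Y w ^+ 2)).
  apply/integrableP; split.
    by apply/measurable_EFinP; apply: measurable_funD => //; exact: measurable_funX.
  rewrite (eq_integral (fun w => (1 + Y w ^+ 2)%:E)); last first.
    by move=> w _; rewrite /= ger0_norm ?addr_ge0 ?sqr_ge0.
  by rewrite E ltry.
have i3 : Q.-integrable setT (EFin \o (fun w => Y w ^+ 2)).
  have := intB i2 i1; congr integrable; apply/funext => w /=; congr EFin; ring.
apply: etrans (esym (fineK (integrable_fin_num measurableT i3))) _; congr EFin.
have : \int[Q]_w (1 + Y w ^+ 2) = K by exact: (congr1 fine E).
rewrite RintegralD// Rintegral_prob_cst => <-; rewrite addrAC subrr add0r.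
by [].
Qed.

(* Both laws have the same characteristic function. *)
Lemma VG_coupling (a b : R) lam (N : nat) : 0 < a -> b < 0 -> a + b = theta ->
  - 4 * a * b = sigma ^+ 2 -> r = N%:R -> count_a a b k lam = N -> count_b a b k lam = N ->
  forall h : R -> R, (forall x y, `|h x - h y| <= `|x - y|) ->
  \int[P]_w h (chaos (fun i => round a b (lam i)) w) = \int[Q]_w h (Y w).
Proof.
move=> a0 b0 abt abs rN ca cb.
(* Each root occurs N = r times, so the log-modulus and the argument are r times the joint
   contribution of a and b, which the matching identities express through y. *)
have key t : let y := 2 * (t * theta) / (1 + sigma ^+ 2 * t ^+ 2) in
    - (4^-1 * \sum_(0 <= i < k) ln (1 + (2 * (t * round a b (lam i))) ^+ 2)) =
      - (r / 2) * ln (1 + sigma ^+ 2 * t ^+ 2) + - (r / 2 / 2) * ln (1 + y ^+ 2) /\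
    \sum_(0 <= i < k) (2^-1 * atan (2 * (t * round a b (lam i))) - t * round a b (lam i)) =
      pang (r / 2) y + t * - (r * theta).
  move=> y; have M1 := matching_modulus t a0 b0; have M2 := matching_arg t a0 b0.
  rewrite abt abs -/y in M1 M2.
  rewrite (sum_round _ _ k lam (f := fun x => ln (1 + (2 * (t * x)) ^+ 2))); last first.
    by rewrite !mulr0 expr0n addr0 ln1.
  rewrite (sum_round _ _ k lam (f := fun x => 2^-1 * atan (2 * (t * x)) - t * x)); last first.
    by rewrite !mulr0 atan0 mulr0 subr0.
  rewrite ca cb -rN -!mulrDr M1; split; first by field.
  rewrite (_ : _ - _ + _ = 2^-1 * (atan (2 * (t * a)) + atan (2 * (t * b))) - t * (a + b)); last by ring.
  by rewrite M2 abt /pang; field.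
apply: fourier_unique_lipschitz.
- exact: chaos_integrable.
- by have [] := VGc_integrable.
- move=> t; have [k1 k2] := key t.
  have [e1 _] := chaos_cf (fun i => round a b (lam i)) t mX gX.
  have [e2 _] := VG_cf r0 sigma0 lawY t.
  apply: (etrans e1); apply: (etrans _ (esym e2)).
  by rewrite k1 k2 /prho expRD.
- move=> t; have [k1 k2] := key t.
  have [_ e1] := chaos_cf (fun i => round a b (lam i)) t mX gX.
  have [_ e2] := VG_cf r0 sigma0 lawY t.
  apply: (etrans e1); apply: (etrans _ (esym e2)).
  by rewrite k1 k2 /prho expRD.
Qed.

(** Both expectations are compared with h 0. The inequality x <= 1 + x^2 replaces the L^2 norm of
    the sum by a bound linear in its variance 2 p_2, whose excess over the target variance is
    controlled by the second term of the theorem. *)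
Lemma VG_trivial_bound lam (h : R -> R) : (forall x y, `|h x - h y| <= `|x - y|) ->
  `|\int[P]_w h (chaos lam w) - \int[Q]_w h (Y w)| <=
  1 + 2 * (\sum_(0 <= i < k) lam i ^+ 2) + Num.sqrt (vg_second_moment r theta sigma (- (r * theta)) - 1).
Proof.
move=> hl; have [iY bY] := VGc_integrable.
have [iF bF] := L1_le_L2 (measurable_chaos lam) (isoX lam).
have B d0 (S : measurableType d0) (m : probability S R) (u : S -> R) :
    m.-integrable setT (EFin \o u) -> `|\int[m]_w h (u w) - h 0| <= \int[m]_w `|u w|.
  move=> iu; have i0 : m.-integrable setT (EFin \o (fun _ : S => (0 : R))).
    by apply: (@bounded_integrable _ _ _ _ _ 0) => // w; rewrite normr0.
  have := lipschitz_dist hl iu i0; rewrite Rintegral_prob_cst.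
  by under [X in _ <= X -> _]eq_Rintegral do rewrite subr0.
have -> : \int[P]_w h (chaos lam w) - \int[Q]_w h (Y w) =
  (\int[P]_w h (chaos lam w) - h 0) - (\int[Q]_w h (Y w) - h 0) by ring.
rewrite (le_trans (ler_normB _ _))// lerD//; last first.
  exact: le_trans (B _ _ _ _ iY) bY.
apply: (le_trans (B _ _ _ _ iF)); apply: (le_trans bF).
set q := 2 * _; have q0 : 0 <= q by rewrite mulr_ge0// sumr_ge0// => i _; exact: sqr_ge0.
rewrite -[X in _ + X](sqr_sqrtr q0); have := sqrtr_ge0 q; move: (Num.sqrt q) => x x0; nra.
Qed.

End finite_chaos.

(* Small defects force r to be an integer and exactly r eigenvalues to be near each root,
   so that rounding the eigenvalues yields a coupling; otherwise the trivial bound suffices. *)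
Lemma finite_chaos_VG (R : realType) (r theta sigma : R) : 0 < r -> 0 < sigma ->
  exists C1 C2 : R, [/\ 0 < C1, 0 < C2 &
  forall d (T : measurableType d) (P : probability T R) k (X : nat -> T -> R)
    d' (T' : measurableType d') (Q : probability T' R) (Y : {RV Q >-> R}) lam (h : R -> R),
  (forall i, measurable_fun setT (X i)) -> std_gauss P k X ->
  (forall lam, (\int[P]_w (chaos k X lam w ^+ 2)%:E = (2 * \sum_(0 <= i < k) lam i ^+ 2)%:E)%E) ->
  has_law Y (VGc r theta sigma) -> (forall x y, `|h x - h y| <= `|x - y|) ->
  `|\int[P]_w h (chaos k X lam w) - \int[Q]_w h (Y w)| <=
   C1 * Num.sqrt (stein_defect r (sigma ^+ 2) theta k lam) +
   C2 * `|r * (sigma ^+ 2 + 2 * theta ^+ 2) - 2 * \sum_(0 <= i < k) lam i ^+ 2|].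
Proof.
move=> r0 sigma0; have [a [b [a0 b0 abt abs]]] := VG_roots theta sigma0.
have [e e0 eP] := multiplicities r0 a0 b0.
have cE : 2 * r * (a ^+ 2 + b ^+ 2) = r * (sigma ^+ 2 + 2 * theta ^+ 2) by rewrite -abt -abs; ring.
rewrite abt abs cE in eP.
set c := r * (_ + _) in cE eP *.
have c0 : 0 < c by rewrite mulr_gt0// ltr_pwDl ?exprn_gt0// mulr_ge0 ?sqr_ge0.
pose K := Num.sqrt (vg_second_moment r theta sigma (- (r * theta)) - 1).
have K0 : 0 <= K := sqrtr_ge0 _.
have g0 : 0 < gap a b := gap_gt0 a0 b0.
(* If sqrt D + del is at least e, then C times this sum dominates 1 + c + K. The excess of 2 p_2
   over c is at most [del], which accounts for the 1 in C + 1. *)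
pose C := (1 + c + K) / e.
have cK0 : 0 < 1 + c + K by apply: ltr_pwDl => //; exact: addr_gt0.
have C0 : 0 < C by exact: divr_gt0.
(* Chosen so that G^2 times 32 gap^4 equals 2, the factor in the L^2 distance of two chaos sums. *)
pose G := (4 * gap a b ^+ 2)^-1.
have G0 : 0 < G by rewrite invr_gt0 mulr_gt0// exprn_gt0.
exists (C + G), (C + 1); split; rewrite ?addr_gt0//.
move=> d T P k X d' T' Q Y lam h mX gX isoX lawY hl.
set D := stein_defect _ _ _ _ _; set del := `|_ - 2 * _|.
have sD0 : 0 <= Num.sqrt D := sqrtr_ge0 _.
have del0 : 0 <= del := normr_ge0 _.
have [small|large] := ltP (Num.sqrt D + del) e.
- have [N [rN ca cb]] := eP k lam small.
  have cp := VG_coupling mX gX isoX r0 sigma0 lawY a0 b0 abt abs rN ca cb hl.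
  rewrite -cp.
  apply: (le_trans (lipschitz_dist hl (chaos_integrable mX isoX _) (chaos_integrable mX isoX _))).
  apply: (le_trans (chaos_dist mX isoX _ _)).
  apply: (@le_trans _ _ (G * Num.sqrt D)); last first.
    rewrite mulrDl -addrA addrCA -[leLHS]addr0; apply: lerD => //.
    by rewrite addr_ge0// mulr_ge0// ltW// addr_gt0.
  have Dr := stein_defect_round r k lam a0 b0; rewrite abt abs -/D in Dr.
  have -> : G * Num.sqrt D = Num.sqrt (G ^+ 2 * D) by rewrite sqrtrM ?sqr_ge0// sqrtr_sqr gtr0_norm.
  apply: ler_wsqrtr; move: Dr; set V := \sum_(0 <= i < k) _ => Dr.
  have -> : 2 * V = G ^+ 2 * (32 * gap a b ^+ 4 * V) by rewrite /G; field; rewrite gt_eqF.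
  by rewrite ler_wpM2l// sqr_ge0.
- apply: (le_trans (VG_trivial_bound mX isoX r0 sigma0 lawY lam hl)); rewrite -/K.
  set q := 2 * _.
  have qd : q <= c + del.
    by rewrite -lerBlDl /del distrC ler_norm.
  have : 1 + c + K <= C * (Num.sqrt D + del).
    by rewrite /C mulrAC ler_pdivlMr// ler_wpM2l// ltW.
  have := mulr_ge0 (ltW G0) sD0.
  rewrite !mulrDl mul1r mulrDr; move: (C * _) (C * _) (G * _) => u1 u2 u3; lra.
Qed.

(** * Spectral theorem and finite-rank approximation *)

Section real_spectral.
Context {R : rcfType}.
Local Open Scope complex_scope.

Lemma row_dotE n (z : 'rV[R]_n) : (z *m z^T) 0 0 = \sum_j z 0 j ^+ 2.
Proof. by rewrite mxE; apply: eq_bigr => j _; rewrite mxE expr2. Qed.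

Lemma row_dotC n (y z : 'rV[R]_n) : (y *m z^T) 0 0 = (z *m y^T) 0 0.
Proof. by rewrite !mxE; apply: eq_bigr => j _; rewrite !mxE mulrC. Qed.

Lemma row_dotBl n (x y z : 'rV[R]_n) : ((x - y) *m z^T) 0 0 = (x *m z^T) 0 0 - (y *m z^T) 0 0.
Proof. by rewrite mulmxBl !mxE. Qed.

Lemma row_dotBr n (x y z : 'rV[R]_n) : (z *m (x - y)^T) 0 0 = (z *m x^T) 0 0 - (z *m y^T) 0 0.
Proof. by rewrite linearB mulmxBr !mxE. Qed.

Lemma row_sqr_eq0 n (z : 'rV[R]_n) : \sum_j z 0 j ^+ 2 = 0 -> z = 0.
Proof.
move=> /eqP; rewrite psumr_eq0 => [/allP h|j _]; last exact: sqr_ge0.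
by apply/rowP => j; have := h j (mem_index_enum _); rewrite sqrf_eq0 mxE => /eqP.
Qed.

(** Over the complex numbers there is an eigenvector x + i y with some eigenvalue al + i be.
    Comparing x M y^T with its transpose gives be (|x|^2 + |y|^2) = 0, so the eigenvalue is real,
    and a nonzero one among x and y can be normalized. *)
Lemma sym_eigenvector n (M : 'M[R]_n.+1) : M^T = M ->
  exists (mu : R) (x : 'rV[R]_n.+1), x *m x^T = 1%:M /\ x *m M = mu *: x.
Proof.
move=> sM; pose toC := real_complex R.
have [a /eigenvalueP[v va v0]] := @eigenvalue_closed R[i] n.+1 (map_mx toC M) isT.
pose x := map_mx (@complex.Re R) v; pose y := map_mx (@complex.Im R) v.
pose al := complex.Re a; pose be := complex.Im a.
have rS (f : R[i] -> R) (I : finType) (g : I -> R[i]) : {morph f : u w / u + w} -> f 0 = 0 ->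
  f (\sum_i g i) = \sum_i f (g i) by move=> fD f0; exact: big_morph.
have ReM (z w : R[i]) : complex.Re (z * w) = complex.Re z * complex.Re w - complex.Im z * complex.Im w.
  by case: z w => [? ?] [? ?].
have ImM (z w : R[i]) : complex.Im (z * w) = complex.Re z * complex.Im w + complex.Im z * complex.Re w.
  by case: z w => [? ?] [? ?].
have Rex : x *m M = al *: x - be *: y.
  apply/rowP => j; have := congr1 (fun w : 'rV[R[i]]_n.+1 => complex.Re (w 0 j)) va.
  rewrite !mxE (rS _ _ _ _ _) //; last by move=> [? ?] [? ?].
  rewrite ReM -/al -/be => <-; apply: eq_bigr => i _.
  by rewrite ReM !mxE /= mulr0 subr0.
have Imx : y *m M = be *: x + al *: y.
  apply/rowP => j; have := congr1 (fun w : 'rV[R[i]]_n.+1 => complex.Im (w 0 j)) va.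
  rewrite !mxE (rS _ _ _ _ _) //; last by move=> [? ?] [? ?].
  rewrite ImM -/al -/be [RHS]addrC => <-; apply: eq_bigr => i _.
  by rewrite ImM !mxE /= mulr0 add0r.
pose sq (z : 'rV[R]_n.+1) := (z *m z^T) 0 0.
have sqE z : sq z = \sum_j z 0 j ^+ 2 by exact: row_dotE.
have sq0 z : 0 <= sq z by rewrite sqE sumr_ge0// => j _; exact: sqr_ge0.
have sqz z : sq z = 0 -> z = 0 by rewrite sqE; exact: row_sqr_eq0.
have be0 : be = 0.
  have E : x *m M *m y^T = (y *m M *m x^T)^T.
    by rewrite !trmx_mul trmxK sM mulmxA.
  rewrite Rex Imx in E.
  have xy : (x *m y^T) 0 0 = (y *m x^T) 0 0.
    exact: row_dotC.
  have := congr1 (fun A : 'M[R]_1 => A 0 0) E.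
  have dD (z w u : 'rV[R]_n.+1) : ((z + w) *m u^T) 0 0 = (z *m u^T) 0 0 + (w *m u^T) 0 0.
    by rewrite mulmxDl mxE.
  have dZ c (z u : 'rV[R]_n.+1) : ((c *: z) *m u^T) 0 0 = c * (z *m u^T) 0 0.
    by rewrite -scalemxAl mxE.
  have tE (A : 'M[R]_1) : A^T 0 0 = A 0 0 by rewrite mxE.
  rewrite tE -scaleNr !dD !dZ xy -/(sq x) -/(sq y) => E2.
  have E3 : be * (sq x + sq y) = 0.
    have lem (u p q : R) : u + - be * q = be * p + u -> be * (p + q) = 0.
      move=> h; have -> : be * (p + q) = (be * p + u) - (u + - be * q) by ring.
      by rewrite h subrr.
    exact: lem E2.
  move/eqP: E3; rewrite mulf_eq0 => /orP[/eqP//|].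
  rewrite paddr_eq0// => /andP[/eqP/sqz x0 /eqP/sqz y0].
  case/negP: v0; apply/eqP/rowP => j; rewrite !mxE.
  have := congr1 (fun w : 'rV[R]_n.+1 => w 0 j) x0; have := congr1 (fun w : 'rV[R]_n.+1 => w 0 j) y0.
  by rewrite !mxE; case: (v 0 j) => ? ? /= -> ->.
have normalize (z : 'rV[R]_n.+1) : z != 0 -> z *m M = al *: z ->
    exists (mu : R) (x : 'rV[R]_n.+1), x *m x^T = 1%:M /\ x *m M = mu *: x.
  move=> z0 zM; exists al, ((Num.sqrt (sq z))^-1 *: z).
  have sz : 0 < sq z by rewrite lt_neqAle sq0 andbT eq_sym; apply: contraNneq z0 => /sqz ->.
  split; last by rewrite -scalemxAl zM !scalerA mulrC.
  rewrite [LHS]mx11_scalar; congr _%:M.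
  have qE (c : R) : ((c *: z) *m (c *: z)^T) 0 0 = c ^+ 2 * sq z.
    by rewrite linearZ/= -scalemxAr -scalemxAl scalerA mxE.
  by rewrite qE exprVn sqr_sqrtr// mulVf// gt_eqF.
have [x0|xn0] := eqVneq x 0; last by apply: normalize xn0 _; rewrite Rex be0 scale0r subr0.
apply: (normalize y); last by rewrite Imx be0 scale0r add0r.
apply: contraNneq v0 => y0; apply/eqP/rowP => j; rewrite !mxE.
have := congr1 (fun w : 'rV[R]_n.+1 => w 0 j) x0; have := congr1 (fun w : 'rV[R]_n.+1 => w 0 j) y0.
by rewrite !mxE; case: (v 0 j) => ? ? /= -> ->.
Qed.

(* The Householder reflection exchanging an eigenvector with the first basis vector
   deflates the matrix. *)
Lemma sym_spectral n (M : 'M[R]_n) : M^T = M ->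
  exists (U : 'M[R]_n) (D : 'rV[R]_n), U *m U^T = 1%:M /\ M = U^T *m diag_mx D *m U.
Proof.
elim: n M => [|n IH] M sM.
  by exists 0, 0; split; [apply/matrixP => [[]]|apply/matrixP => [[]]].
have [mu [x [x1 xM]]] := sym_eigenvector sM.
pose e : 'rV[R]_n.+1 := delta_mx 0 0.
have [w wE] : exists w : 'rV[R]_n.+1, w = x - e by exists (x - e).
have [c cE'] : exists c : R, c = (w *m w^T) 0 0 by exists ((w *m w^T) 0 0).
have cE : w *m w^T = c%:M by rewrite cE' [LHS]mx11_scalar.
have eE : e *m e^T = 1%:M.
  by rewrite trmx_delta mul_delta_mx; apply/matrixP => i j; rewrite !mxE !ord1 eqxx.
(* The reflection in the hyperplane orthogonal to w = x - e. If x = e then w = 0 and this is the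
   identity, whatever value [2 / c] takes. *)
pose Hh := 1%:M - (2 / c) *: (w^T *m w).
have HT : Hh^T = Hh by rewrite /Hh linearB/= trmx1 linearZ/= trmx_mul trmxK.
have c0 : c = 0 -> w = 0.
  by rewrite cE' row_dotE => /row_sqr_eq0.
have HH : Hh *m Hh = 1%:M.
  have PP : (w^T *m w) *m (w^T *m w) = c *: (w^T *m w).
    by rewrite mulmxA -(mulmxA _ w) cE mul_mx_scalar -scalemxAl.
  have [cz|cn] := eqVneq c 0.
    by rewrite /Hh (c0 cz) mulmx0 scaler0 subr0 mulmx1.
  rewrite /Hh; move: (w^T *m w) PP => A PP.
  rewrite mulmxBl mul1mx mulmxBr mulmx1 -scalemxAl -scalemxAr scalerA PP scalerA.
  have -> : 2 / c * (2 / c) * c = 2 / c + 2 / c by field.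
  by rewrite scalerDl opprB addrK subrK.
have eH : e *m Hh = x.
  rewrite /Hh mulmxBr mulmx1 -scalemxAr mulmxA.
  (* Since x and e have norm 1, c = 2 - 2 <e, x> and <e, w> = - c / 2, so the reflection sends e to
     e + w = x. *)
  have ew : e *m w^T = (- (c / 2))%:M.
    have xx : (x *m x^T) 0 0 = 1 by rewrite x1 mxE.
    have ee : (e *m e^T) 0 0 = 1 by rewrite eE mxE.
    have -> : c = 2 - 2 * (e *m x^T) 0 0.
      by rewrite cE' wE row_dotBl !row_dotBr xx ee (row_dotC x); ring.
    rewrite wE [LHS]mx11_scalar; congr _%:M.
    by rewrite row_dotBr ee; field.
  rewrite ew mul_scalar_mx scalerA.
  have [/c0 w0|cn] := eqVneq c 0.
    by rewrite w0 scaler0 subr0; move: wE; rewrite w0 => /eqP; rewrite eq_sym subr_eq0 => /eqP.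
  have -> : 2 / c * - (c / 2) = -1 by field.
  by rewrite scaleN1r opprK wE addrC subrK.
have xH : x *m Hh = e by rewrite -eH -mulmxA HH mulmx1.
pose N := Hh *m M *m Hh.
have NT : N^T = N by rewrite /N !trmx_mul HT sM mulmxA.
have eN : e *m N = mu *: e by rewrite /N !mulmxA eH xM -scalemxAl xH.
have ME : M = Hh *m N *m Hh by rewrite /N !mulmxA HH mul1mx -!mulmxA HH mulmx1.
clearbody N.
have N0 j : N 0 j = mu * (0 == j)%:R.
  have := congr1 (fun A : 'rV[R]_n.+1 => A 0 j) eN.
  by rewrite -rowE !mxE eqxx eq_sym.
have Nj0 j : N j 0 = mu * (0 == j)%:R by rewrite -N0 -{1}NT mxE.
pose N' : 'M[R]_n := \matrix_(i, j) N (lift 0 i) (lift 0 j).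
have N'T : N'^T = N' by apply/matrixP => i j; rewrite !mxE -{1}NT mxE.
have [U' [D' [U'1 N'E]]] := IH N' N'T.
pose B : 'M[R]_(1 + n) := block_mx 1%:M 0 0 U'.
pose D : 'rV[R]_(1 + n) := row_mx mu%:M D'.
have BB : B *m B^T = 1%:M.
  rewrite /B tr_block_mx mulmx_block !trmx0 !mulmx0 !mul0mx !addr0 !add0r trmx1 mulmx1 U'1.
  by rewrite -scalar_mx_block.
have BD : B^T *m diag_mx D *m B = block_mx (mu%:M : 'M[R]_1) 0 0 N'.
  rewrite (_ : diag_mx D = block_mx (mu%:M : 'M[R]_1) 0 0 (diag_mx D')); last first.
    by rewrite /D diag_mx_row; congr block_mx; apply/matrixP => i j; rewrite !mxE !ord1 eqxx.
  rewrite /B tr_block_mx !mulmx_block !trmx0 trmx1 !mulmx0 !mul0mx !addr0 !add0r mul1mx mulmx1 N'E.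
  by rewrite !mul0mx ?addr0 ?add0r.
pose U : 'M[R]_n.+1 := (B : 'M[R]_n.+1) *m Hh.
exists U, D.
have l0 (i : 'I_1) : lshift n i = 0 :> 'I_n.+1 by apply/val_inj; rewrite ord1.
have rl (i : 'I_n) : rshift 1 i = lift 0 i :> 'I_n.+1 by apply/val_inj.
have NE : N = block_mx (mu%:M : 'M[R]_1) 0 0 N' :> 'M[R]_(1 + n).
  rewrite -[LHS](@submxK _ 1 n 1 n); congr block_mx; apply/matrixP => i j; rewrite !mxE.
  - by rewrite !l0 N0 eqxx mulr1 !ord1 eqxx.
  - by rewrite l0 rl N0 mulr0.
  - by rewrite l0 rl Nj0 mulr0.
  - by rewrite !rl.
split.
  rewrite /U trmx_mul HT mulmxA -(mulmxA _ Hh Hh) HH mulmx1; exact: BB.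
have NB : N = (B : 'M[R]_n.+1)^T *m diag_mx (D : 'rV[R]_n.+1) *m (B : 'M[R]_n.+1).
  by rewrite NE -BD.
by rewrite /U trmx_mul HT {1}ME NB !mulmxA.
Qed.

End real_spectral.

(** * Finite orthonormal families *)

Section hilbert.
Context {R : realType} (H : hilbertSpace R).
Local Notation ip := (inner H).

Lemma innerC (x y : H) : ip x y = ip y x.
Proof. by rewrite hermC/= expr0 mul1r. Qed.

Lemma innerDl (x y z : H) : ip (x + y) z = ip x z + ip y z.
Proof. exact: linearDl. Qed.

Lemma innerZl a (x z : H) : ip (a *: x) z = a * ip x z.
Proof. exact: linearZl_LR. Qed.

Lemma innerZr a (x z : H) : ip z (a *: x) = a * ip z x.
Proof. by rewrite innerC innerZl (innerC z). Qed.

Lemma inner0l (z : H) : ip 0 z = 0.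
Proof. exact: linear0l. Qed.

Lemma inner_suml (I : Type) (s : seq I) (p : pred I) (u : I -> H) z :
  ip (\sum_(i <- s | p i) u i) z = \sum_(i <- s | p i) ip (u i) z.
Proof. by apply: (big_morph (fun x => ip x z)) => [x y|]; [exact: innerDl|exact: inner0l]. Qed.

Lemma inner_sumr (I : Type) (s : seq I) (p : pred I) (u : I -> H) z :
  ip z (\sum_(i <- s | p i) u i) = \sum_(i <- s | p i) ip z (u i).
Proof. by rewrite innerC inner_suml; apply: eq_bigr => i _; rewrite innerC. Qed.

Definition orthonormal (k : nat) (e : nat -> H) :=
  forall i j, (i < k)%N -> (j < k)%N -> ip (e i) (e j) = (i == j)%:R.

(** The family grows only when the residue w of the new vector is nonzero, so the list may be
    linearly dependent. *)
Lemma gram_schmidt (s : seq H) : exists k e, orthonormal k e /\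
  forall x, x \in s -> exists c : nat -> R, x = \sum_(0 <= i < k) c i *: e i.
Proof.
elim: s => [|x s [k [e [on IH]]]]; first by exists 0%N, (fun=> 0); split.
pose w := x - \sum_(0 <= i < k) ip x (e i) *: e i.
have ow j : (j < k)%N -> ip w (e j) = 0.
  move=> jk; rewrite /w -scaleN1r innerDl innerZl inner_suml big_mkord (bigD1 (Ordinal jk))//=.
  rewrite innerZl on// eqxx mulr1 big1 ?addr0 ?mulN1r ?subrr// => i ij.
  by rewrite innerZl on// (_ : (_ == _) = false) ?mulr0//; apply/negbTE.
have [w0|wn0] := eqVneq w 0.
  exists k, e; split => // y; rewrite inE => /orP[/eqP ->|]; last exact: IH.
  by exists (fun i => ip x (e i)); apply/eqP; rewrite -subr_eq0 -/w w0.
have nw : 0 < `|w| by rewrite normr_gt0.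
pose e' i := if (i < k)%N then e i else `|w|^-1 *: w.
exists k.+1, e'; split.
  move=> i j; rewrite !ltnS /e' => ik jk; case: ltnP => ik'; case: ltnP => jk'.
  - exact: on.
  - by rewrite innerZr innerC ow// mulr0 (_ : (i == j) = false)//; apply/negbTE; rewrite neq_ltn (leq_trans ik').
  - by rewrite innerZl ow// mulr0 (_ : (i == j) = false)//; apply/negbTE; rewrite neq_ltn (leq_trans jk') ?orbT.
  - have -> : i = k by apply/eqP; rewrite eqn_leq ik.
    have -> : j = k by apply/eqP; rewrite eqn_leq jk.
    by rewrite eqxx innerZl innerZr inner_norm mulrA -expr2 exprVn mulVf// expf_neq0// gt_eqF.
have e'E (c : nat -> R) : \sum_(0 <= i < k) c i *: e' i = \sum_(0 <= i < k) c i *: e i.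
  by rewrite big_nat [RHS]big_nat; apply: eq_bigr => i /andP[_ ik]; rewrite /e' ik.
move=> y; rewrite inE => /orP[/eqP ->|/IH[c ->]].
  exists (fun i => if (i < k)%N then ip x (e i) else `|w|).
  rewrite big_nat_recr//= ltnn /e' ltnn scalerA divff ?gt_eqF// scale1r.
  rewrite (_ : \sum_(0 <= i < k) _ = \sum_(0 <= i < k) ip x (e i) *: e i); first by rewrite /w addrC subrK.
  by rewrite big_nat [RHS]big_nat; apply: eq_bigr => i /andP[_ ik]; rewrite ik.
exists (fun i => if (i < k)%N then c i else 0).
rewrite big_nat_recr//= ltnn scale0r addr0 -e'E.
by apply: eq_big_nat => i /andP[_ ik]; rewrite ik.
Qed.

End hilbert.

(** * Symmetric tensors and the double integral *)

Section tensor_square.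
Context {R : realType} (H : hilbertSpace R).
Variable HH : tensorSquare H.
Local Notation "x (x) y" := (tensor HH x y) (at level 40).

Definition diag_tensor k (lam : nat -> R) (e : nat -> H) : HH :=
  \sum_(0 <= i < k) lam i *: tensor HH (e i) (e i).

Lemma tensor_sum k (c d : 'I_k -> R) (e : nat -> H) :
  tensor HH (\sum_(i < k) c i *: e i) (\sum_(j < k) d j *: e j) =
  \sum_(i < k) \sum_(j < k) (c i * d j) *: tensor HH (e i) (e j).
Proof.
rewrite linear_sumlz; apply: eq_bigr => i _.
rewrite linear_sumr; apply: eq_bigr => j _.
by rewrite linearZl_LR linearZr_LR scalerA.
Qed.

(** All vectors involved lie in the span of one finite orthonormal family, in which g is given by a
    symmetric matrix. Rotating the family by the orthogonal matrix of [sym_spectral] makes g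
    diagonal. *)
Lemma diag_tensor_span (g : HH) :
  linear_span [set 2^-1 *: (tensor HH a b + tensor HH b a) | a in setT & b in setT] g ->
  exists k lam e, orthonormal k e /\ g = diag_tensor k lam e.
Proof.
move=> [n [a [s [sS gE]]]].
have /choice[uv uvE] : forall l, exists uv : H * H,
    s l = 2^-1 *: (tensor HH uv.1 uv.2 + tensor HH uv.2 uv.1).
  by move=> l; have [x _ [y _ <-]] := sS l; exists (x, y).
have [k [e [on sp]]] := gram_schmidt ([seq (uv l).1 | l : 'I_n] ++ [seq (uv l).2 | l : 'I_n]).
have /choice[c cE] : forall l, exists c : nat -> R, (uv l).1 = \sum_(0 <= i < k) c i *: e i.
  by move=> l; apply: sp; rewrite mem_cat (codom_f (fun l => (uv l).1)).
have /choice[d dE] : forall l, exists c : nat -> R, (uv l).2 = \sum_(0 <= i < k) c i *: e i.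
  by move=> l; apply: sp; rewrite mem_cat orbC (codom_f (fun l => (uv l).2)).
pose M : 'M[R]_k := \matrix_(i, j) \sum_l a l * 2^-1 * (c l i * d l j + d l i * c l j).
have MT : M^T = M.
  by apply/matrixP => i j; rewrite !mxE; apply: eq_bigr => l _; ring.
have gM : g = \sum_(i < k) \sum_(j < k) M i j *: tensor HH (e i) (e j).
  transitivity (\sum_l \sum_(i < k) \sum_(j < k)
      (a l * 2^-1 * (c l i * d l j + d l i * c l j)) *: tensor HH (e i) (e j)).
    rewrite gE; apply: eq_bigr => l _.
    rewrite uvE cE dE !big_mkord !tensor_sum -big_split/= !scaler_sumr; apply: eq_bigr => i _.
    rewrite -big_split/= !scaler_sumr; apply: eq_bigr => j _.
    by rewrite -scalerDl !scalerA.
  rewrite exchange_big; apply: eq_bigr => i _; rewrite exchange_big; apply: eq_bigr => j _.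
  by rewrite mxE scaler_suml.
have [U [D [U1 MU]]] := sym_spectral MT.
pose e' (m : nat) := if insub m is Some m' then \sum_(j < k) U m' j *: e j else 0.
pose lam (m : nat) := if insub m is Some m' then D 0 m' else 0.
have e'E (m : 'I_k) : e' m = \sum_(j < k) U m j *: e j by rewrite /e' valK.
exists k, lam, e'; split.
  move=> i j ik jk; rewrite (e'E (Ordinal ik)) (e'E (Ordinal jk)).
  have <- : (U *m U^T) (Ordinal ik) (Ordinal jk) = (i == j)%:R by rewrite U1 mxE.
  rewrite mxE inner_suml; apply: eq_bigr => m _; rewrite innerZl inner_sumr (bigD1 m)//= mxE.
  rewrite innerZr on// eqxx mulr1 big1 ?addr0// => m' mm'.
  by rewrite innerZr on// (_ : (_ == _) = false) ?mulr0//; apply/negbTE; rewrite eq_sym.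
rewrite /diag_tensor big_mkord gM.
transitivity (\sum_(m < k) \sum_(i < k) \sum_(j < k) (D 0 m * (U m i * U m j)) *: tensor HH (e i) (e j)).
  rewrite [RHS]exchange_big; apply: eq_bigr => i _; rewrite [RHS]exchange_big; apply: eq_bigr => j _.
  rewrite -scaler_suml; congr (_ *: _); rewrite MU mul_mx_diag mxE; apply: eq_bigr => m _.
  by rewrite !mxE; ring.
apply: eq_bigr => m _; rewrite e'E /lam valK tensor_sum scaler_sumr; apply: eq_bigr => i _.
by rewrite scaler_sumr; apply: eq_bigr => j _; rewrite scalerA.
Qed.

Lemma diag_tensor_dot k lam e : orthonormal k e ->
  `|diag_tensor k lam e| ^+ 2 = \sum_(0 <= i < k) lam i ^+ 2.
Proof.
move=> on; rewrite -inner_norm /diag_tensor.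
rewrite inner_suml big_nat [RHS]big_nat; apply: eq_bigr => i /andP[_ ik].
rewrite inner_sumr big_mkord (bigD1 (Ordinal ik))//= innerZl innerZr tensor_inner on// eqxx.
rewrite big1 => [|j ij]; first by rewrite addr0 !mulr1 expr2.
rewrite innerZl innerZr tensor_inner on// (_ : (_ == _) = false) ?mul0r ?mulr0//.
by apply/negbTE; rewrite eq_sym.
Qed.

Local Notation sym := (symmetric_tensors HH).

Lemma symmetricP (f : HH) : sym f <-> forall e : R, 0 < e ->
  exists2 g, linear_span [set 2^-1 *: (tensor HH a b + tensor HH b a) | a in setT & b in setT] g
    & `|f - g| < e.
Proof.
split=> [cf e e0|h B].
  have [g [sg]] := cf _ (nbhsx_ballx f e e0); rewrite -ball_normE/= => fg.
  by exists g.
rewrite -nbhs_ballE => -[e /= e0 eB]; have [g sg fg] := h e e0.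
by exists g; split => //; apply: eB; rewrite -ball_normE.
Qed.

Lemma linear_spanD (A : set HH) (c : R) (f g : HH) :
  linear_span A f -> linear_span A g -> linear_span A (c *: f + g).
Proof.
move=> [n [a [u [Au ->]]]] [m [b [v [Av ->]]]].
exists (n + m)%N, (fun i => match fintype.split i with inl i => c * a i | inr j => b j end),
  (fun i => match fintype.split i with inl i => u i | inr j => v j end); split.
  by move=> i; case: fintype.split.
rewrite big_split_ord/= scaler_sumr; congr (_ + _); apply: eq_bigr => i _.
  by rewrite (unsplitK (inl i)) scalerA.
by rewrite (unsplitK (inr i)).
Qed.

Lemma symmetricD (c : R) (f g : HH) : sym f -> sym g -> sym (c *: f + g).
Proof.
move=> /symmetricP sf /symmetricP sg; apply/symmetricP => e e0.
have c0 : 0 < `|c| + 1 by rewrite ltr_wpDl.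
have e20 : 0 < e / 2 by exact: divr_gt0.
have [f' sf' ff'] := sf (e / 2 / (`|c| + 1)) (divr_gt0 e20 c0).
have [g' sg' gg'] := sg (e / 2) e20.
exists (c *: f' + g'); first exact: linear_spanD.
rewrite opprD addrACA -scalerBr (le_lt_trans (ler_normD _ _))// [e]splitr.
apply: ler_ltD => //; rewrite normrZ.
apply: (@le_trans _ _ ((`|c| + 1) * `|f - f'|)); first by rewrite ler_wpM2r// lerDl.
by rewrite mulrC -ler_pdivlMr// ltW.
Qed.

Lemma symmetric0 : sym 0.
Proof.
apply/symmetricP => e e0; exists 0; last by rewrite subr0 normr0.
exists 0%N, (fun=> 0), (fun=> 0); split; first by case.
by rewrite big_ord0.
Qed.

Lemma symmetric_square (h : H) : sym (tensor HH h h).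
Proof.
apply/symmetricP => e e0; exists (tensor HH h h); last by rewrite subrr normr0.
exists 1%N, (fun=> 1), (fun=> tensor HH h h); split; last by rewrite big_ord1 scale1r.
move=> _; exists h => //; exists h => //.
move: (tensor HH h h) => t; rewrite -{1 2}[t]scale1r -scalerDl scalerA.
by rewrite (_ : 2^-1 * (1 + 1) = 1) ?scale1r//; field.
Qed.

Lemma symmetric_diag k lam e : sym (diag_tensor k lam e).
Proof.
elim: k => [|k IH]; first by rewrite /diag_tensor big_geq//; exact: symmetric0.
rewrite /diag_tensor big_nat_recr//= addrC; apply: symmetricD => //.
exact: symmetric_square.
Qed.

Lemma diag_tensor_approx (f : HH) (eps : R) : sym f -> 0 < eps ->
  exists k lam e, orthonormal k e /\ `|f - diag_tensor k lam e| < eps.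
Proof.
move=> /symmetricP sf e0; have [g sg fg] := sf _ e0.
have [k [lam [e [on gE]]]] := diag_tensor_span sg.
by exists k, lam, e; split => //; rewrite -gE.
Qed.

Context d (T : measurableType d) (P : probability T R).
Variables (X : H -> {RV P >-> R}) (I2 : HH -> {RV P >-> R}).
Hypotheses (iX : isonormal X) (dI : double_wiener_integral X I2).

Lemma I2_isometry (f : HH) : sym f ->
  (\int[P]_w (I2 f w ^+ 2)%:E = (2 * `|f| ^+ 2)%:E)%E.
Proof. by case: dI => _ + _ => /[apply]; rewrite unlock. Qed.

Lemma I2_diag k lam e : orthonormal k e ->
  {ae P, forall w, I2 (diag_tensor k lam e) w = chaos k (fun i => X (e i)) lam w}.
Proof.
have [lin iso sq] := dI.
elim: k => [_|k IH on].
  (* Additivity at 0 forces [I2 0] to vanish almost surely. *)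
  have := lin 1 0 0 symmetric0 symmetric0; apply: filterS => w.
  rewrite /diag_tensor /chaos !big_geq// scaler0 add0r mul1r => /eqP.
  by rewrite -subr_eq0 opprD addNKr oppr_eq0 => /eqP.
have on' : orthonormal k e by move=> i j ik jk; apply: on; exact: ltnW.
have n1 : `|e k| = 1.
  have := inner_norm (e k); rewrite on// eqxx => /esym/eqP.
  by rewrite sqrf_eq1 => /orP[/eqP//|/eqP h]; have := normr_ge0 (e k); rewrite h oppr_ge0 ler10.
have := lin (lam k) _ _ (@symmetric_square (e k)) (@symmetric_diag k lam e).
have := sq _ n1; have := IH on'; apply: filterS3 => w h1 h2.
have -> : diag_tensor k.+1 lam e = lam k *: tensor HH (e k) (e k) + diag_tensor k lam e.
  by rewrite /diag_tensor big_nat_recr//= addrC.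
by move=> ->; rewrite h2 h1 /chaos big_nat_recr//= addrC.
Qed.

Lemma measurable_X (e : nat -> H) i : measurable_fun setT (X (e i) : T -> R).
Proof. exact: measurable_funPT. Qed.

Lemma chaos_isometry k e : orthonormal k e -> forall lam,
  (\int[P]_w (chaos k (fun i => X (e i)) lam w ^+ 2)%:E = (2 * \sum_(0 <= i < k) lam i ^+ 2)%:E)%E.
Proof.
move=> on lam; rewrite -(diag_tensor_dot lam on) -(I2_isometry (@symmetric_diag k lam e)).
apply: ae_eq_integral => //.
- apply/measurable_EFinP; apply: measurable_funX.
  by apply: measurable_chaos => i; exact: measurable_X.
- by apply/measurable_EFinP; apply: measurable_funX; exact: measurable_funPT.
- by apply: filterS (I2_diag lam on) => w h _; rewrite h.
Qed.

(** By linearity the difference is, up to a null set, the double integral of the symmetric tensor f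
    minus the diagonal one, to which the isometry applies. *)
Lemma I2_chaos_dist k e lam f : orthonormal k e -> sym f ->
  P.-integrable setT (EFin \o I2 f) /\
  \int[P]_w `|I2 f w - chaos k (fun i => X (e i)) lam w| <=
    Num.sqrt (2 * `|f - diag_tensor k lam e| ^+ 2).
Proof.
move=> on sf; have [lin _ _] := dI.
have mI g : measurable_fun setT (I2 g : T -> R) by exact: measurable_funPT.
split; first by have [] := L1_le_L2 (mI f) (I2_isometry sf).
pose g := diag_tensor k lam e.
have sg : sym g by exact: symmetric_diag.
have sfg : sym (f - g) by rewrite -scaleN1r addrC; exact: symmetricD.
have [_] := L1_le_L2 (mI (f - g)) (I2_isometry sfg); apply: le_trans.
rewrite le_eqVlt; apply/orP; left; apply/eqP; rewrite /Rintegral; congr fine.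
apply: ae_eq_integral => //.
- apply/measurable_EFinP; apply: measurableT_comp => //; apply: measurable_funB => //.
  by apply: measurable_chaos => i; exact: measurable_X.
- by apply/measurable_EFinP; apply: measurableT_comp.
- have := lin (-1) _ _ sg sf; have := I2_diag lam on; apply: filterS2 => w h1.
  by rewrite scaleN1r addrC -/g h1 => -> _; rewrite mulN1r addrC.
Qed.

End tensor_square.

(** * Power series and cumulants *)

Section power_series.
Context {R : realType}.

Definition psum (c : nat -> R) (x : R) : R := limn (pseries c x).

(** An explicit geometric bound in place of a radius of convergence. It survives limits of the
    coefficients with the same M and B, and differentiation with 2B instead of B because n + 1 <=
    2^n. *)
Definition geom_bounded (c : nat -> R) (M B : R) := forall n, `|c n| <= M * B ^+ n.

Lemma geom_bounded_ge0 c (M B : R) : geom_bounded c M B -> 0 <= M.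
Proof. by move=> /(_ 0%N); rewrite mulr1; exact: le_trans. Qed.

Lemma geom_term c (M B x : R) n : geom_bounded c M B -> `|c n * x ^+ n| <= M * (`|x| * B) ^+ n.
Proof.
move=> cM; rewrite normrM normrX exprMn mulrCA mulrC ler_wpM2l ?exprn_ge0//.
Qed.

Lemma psum_cvg c (M B x : R) : 0 <= B -> geom_bounded c M B -> `|x| * B < 1 -> cvgn (pseries c x).
Proof.
move=> B0 cM xB; have M0 := geom_bounded_ge0 cM.
have q0 : 0 <= `|x| * B by rewrite mulr_ge0.
apply: normed_cvg => /=.
apply: (@series_le_cvg _ _ (geometric M (`|x| * B))) => [n|n|n|] /=.
- by [].
- by rewrite mulr_ge0// exprn_ge0.
- exact: geom_term.
- by apply: is_cvg_geometric_series; rewrite ger0_norm.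
Qed.

Lemma geom_tail (q : R) (N n : nat) : 0 <= q -> q < 1 ->
  \sum_(N <= i < n) q ^+ i <= q ^+ N / (1 - q).
Proof.
move=> q0 q1; have d0 : 0 < 1 - q by rewrite subr_gt0.
have [nN|Nn] := leqP n N; first by rewrite big_geq// divr_ge0 ?exprn_ge0// ltW.
rewrite ler_pdivlMr//; have -> : (\sum_(N <= i < n) q ^+ i) * (1 - q) = q ^+ N - q ^+ n.
  rewrite mulr_suml (eq_bigr (fun i => - (q ^+ i.+1 - q ^+ i))) => [|i _]; last by rewrite exprS; ring.
  by rewrite sumrN telescope_sumr ?opprB// ltnW.
by rewrite gerBl exprn_ge0.
Qed.

Lemma psum_tail c (M B x : R) N : 0 <= B -> geom_bounded c M B -> `|x| * B < 1 ->
  `|psum c x - \sum_(0 <= i < N) c i * x ^+ i| <= M * ((`|x| * B) ^+ N / (1 - `|x| * B)).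
Proof.
move=> B0 cM xB; have cv := psum_cvg B0 cM xB.
have M0 := geom_bounded_ge0 cM.
have cvs : pseries c x n - \sum_(0 <= i < N) c i * x ^+ i @[n --> \oo] --> psum c x - \sum_(0 <= i < N) c i * x ^+ i.
  by apply: cvgB => //; exact: cvg_cst.
have cvn : `|pseries c x n - \sum_(0 <= i < N) c i * x ^+ i| @[n --> \oo] -->
    `|psum c x - \sum_(0 <= i < N) c i * x ^+ i| by exact: cvg_norm.
apply: (cvgr_to_le cvn); near=> n.
have Nn : (N <= n)%N by near: n; exact: nbhs_infty_ge.
rewrite /pseries /series/= (big_cat_nat (leq0n N) Nn)/= addrAC subrr add0r.
rewrite (le_trans (ler_norm_sum _ _ _))//.
apply: (@le_trans _ _ (\sum_(N <= i < n) M * (`|x| * B) ^+ i)).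
  by apply: ler_sum => i _; exact: geom_term.
by rewrite -mulr_sumr ler_wpM2l// geom_tail// mulr_ge0.
Unshelve. all: by end_near. Qed.

Lemma psum0 c : psum c 0 = c 0%N.
Proof.
apply: cvg_lim => //; apply: cvg_near_cst; near=> n.
have n0 : (0 < n)%N by near: n; exact: nbhs_infty_gt.
rewrite /pseries /series/= big_ltn// big_nat big1 ?expr0 ?mulr1 ?addr0// => i /andP[i0 _].
by rewrite expr0n gtn_eqF// mulr0.
Unshelve. all: by end_near. Qed.

Lemma geom_bounded_diffs c (M B : R) : 0 <= B -> geom_bounded c M B ->
  geom_bounded (pseries_diffs c) (M * B) (2 * B).
Proof.
move=> B0 cM n; have M0 := geom_bounded_ge0 cM.
rewrite /pseries_diffs normrM normr_nat.
apply: (@le_trans _ _ ((2 ^ n)%:R * (M * B ^+ n.+1))).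
  by apply: ler_pM => //; rewrite ler_nat; exact: ltn_expl.
by rewrite natrX exprS exprMn le_eqVlt; apply/orP; left; apply/eqP; ring.
Qed.

(** Term-by-term differentiation is justified by convergence of the series differentiated twice;
    each differentiation doubles B, whence the factor 4. *)
Lemma psum_derive c (M B x : R) : 0 <= B -> geom_bounded c M B -> `|x| * (4 * B) < 1 ->
  is_derive x 1 (psum c) (psum (pseries_diffs c) x).
Proof.
move=> B0 cM xB.
have B40 : 0 <= 4 * B by rewrite mulr_ge0.
have [K xK KB] : exists2 K : R, `|x| < K & K * (4 * B) < 1.
  have [->|Bn] := eqVneq B 0; first by exists (`|x| + 1); rewrite ?ltrDl// !mulr0.
  have Bp : 0 < 4 * B by rewrite mulr_gt0// lt_neqAle eq_sym Bn.
  exists ((`|x| + (4 * B)^-1) / 2); first by rewrite midf_lt// -[ltRHS]mul1r ltr_pdivlMr.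
  by rewrite -ltr_pdivlMr// mul1r midf_lt// -[ltRHS]mul1r ltr_pdivlMr.
have K0 : 0 <= K by rewrite (le_trans (normr_ge0 x))// ltW.
have KK : `|K| = K by rewrite ger0_norm.
have KB2 : K * (2 * B) < 1 by rewrite (le_lt_trans _ KB)// ler_wpM2l// ler_wpM2r// ler_nat.
have KB1 : K * B < 1 by rewrite (le_lt_trans _ KB)// ler_wpM2l// ler_peMl// ler1n.
have c1 := geom_bounded_diffs B0 cM.
have B20 : 0 <= 2 * B by rewrite mulr_ge0.
have c2 := geom_bounded_diffs B20 c1.
have E4 : 2 * (2 * B) = 4 * B by ring.
apply: (@pseries_snd_diffs _ c K x).
- by apply: (psum_cvg B0 cM); rewrite KK.
- by apply: (psum_cvg B20 c1); rewrite KK.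
- by apply: (psum_cvg _ c2); rewrite ?KK E4.
- by rewrite KK.
Qed.

Lemma near0_lt (e : R) : 0 < e -> \forall x \near (0 : R), `|x| < e.
Proof.
move=> e0; have := @nbhs0_lt R R e e0; exact.
Qed.

(** Agreement with the series on a neighbourhood of 0 passes to the derivative and the derived
    series, which is the induction on j. *)
Lemma derive1n_psum (f : R -> R) j c (M B : R) : 0 <= B -> geom_bounded c M B ->
  (\forall x \near (0 : R), f x = psum c x) -> derive1n j f 0 = j`!%:R * c j.
Proof.
elim: j f c M B => [|j IH] f c M B B0 cM fE.
  by rewrite derive1n0 (nbhs_singleton fE) psum0 fact0 mul1r.
rewrite derive1Sn (IH _ (pseries_diffs c) (M * B) (2 * B)).
- by rewrite /pseries_diffs factS natrM; ring.
- by rewrite mulr_ge0.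
- exact: geom_bounded_diffs.
have e0 : 0 < (4 * B + 1)^-1 by rewrite invr_gt0 ltr_wpDl// mulr_ge0.
near=> x.
have fx : \forall y \near x, f y = psum c y.
  near: x; have := nbhs_interior fE; exact.
have xB : `|x| * (4 * B) < 1.
  have : `|x| < (4 * B + 1)^-1 by near: x; exact: near0_lt.
  move=> /ltW xe; rewrite (le_lt_trans (ler_wpM2r _ xe))//; first by rewrite mulr_ge0.
  by rewrite mulrC ltr_pdivrMr ?ltr_wpDl ?mulr_ge0// mul1r ltrDl.
rewrite derive1E (near_eq_derive _ fx).
by have [_ ->] := psum_derive B0 cM xB.
Unshelve. all: by end_near. Qed.

(** The common geometric bound makes the tails uniformly small, and the finitely many remaining
    terms converge. The filter is arbitrary so that it can be an ultrafilter. *)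
Lemma psum_cvg_coef (I : Type) (F : set_system I) {FF : ProperFilter F}
    (c_ : I -> nat -> R) c (M B x : R) : 0 <= B -> (forall i, geom_bounded (c_ i) M B) ->
  `|x| * B < 1 -> (forall n, c_ i n @[i --> F] --> c n) ->
  geom_bounded c M B /\ psum (c_ i) x @[i --> F] --> psum c x.
Proof.
move=> B0 cM xB cc.
have cM' : geom_bounded c M B.
  move=> n; have cn : `|c_ i n| @[i --> F] --> `|c n| by exact: cvg_norm.
  by apply: (cvgr_to_le cn); near=> i; exact: cM.
split=> //; apply/cvgrPdist_lt => e e0.
have q0 : 0 <= `|x| * B by rewrite mulr_ge0.
have tail : M * ((`|x| * B) ^+ N / (1 - `|x| * B)) @[N --> \oo] --> M * (0 / (1 - `|x| * B)).
  apply: cvgM; first exact: cvg_cst.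
  by apply: cvgM; [apply: cvg_expr; rewrite ger0_norm|exact: cvg_cst].
rewrite mul0r mulr0 in tail.
have e30 : 0 < e / 3 by rewrite divr_gt0.
have /cvgrPdist_lt/(_ _ e30)[N _ /(_ N (leqnn N))] := tail.
rewrite /= sub0r normrN => tN.
have {}tN := le_lt_trans (ler_norm _) tN.
have fin : \sum_(0 <= n < N) c_ i n * x ^+ n @[i --> F] --> \sum_(0 <= n < N) c n * x ^+ n.
  apply: cvg_big => [|n _]; first exact: add_continuous.
  by apply: cvgM => //; exact: cvg_cst.
move/cvgrPdist_lt : fin => /(_ _ e30) fin; near=> i.
have h1 := psum_tail N B0 cM' xB; have h2 := psum_tail N B0 (cM i) xB.
have h3 : `|\sum_(0 <= n < N) c n * x ^+ n - \sum_(0 <= n < N) c_ i n * x ^+ n| < e / 3 by near: i.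
have {}h1 := le_lt_trans h1 tN; have {}h2 := le_lt_trans h2 tN.
move: h1 h2 h3; rewrite -![_ < e / 3]/(_ < e / 3).
move: (psum c x) (psum (c_ i) x) (\sum_(0 <= n < N) c n * x ^+ n) (\sum_(0 <= n < N) c_ i n * x ^+ n).
move=> p q u v; rewrite !ltr_norml => /andP[? ?] /andP[? ?] /andP[? ?].
by apply/andP; split; lra.
Unshelve. all: by end_near. Qed.

Lemma psum_sum (J : Type) (r : seq J) (c : J -> nat -> R) (x : R) :
  (forall j, cvgn (pseries (c j) x)) ->
  psum (fun n => \sum_(j <- r) c j n) x = \sum_(j <- r) psum (c j) x.
Proof.
move=> cc; apply: cvg_lim => //.
have -> : pseries (fun n => \sum_(j <- r) c j n) x = fun n => \sum_(j <- r) pseries (c j) x n.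
  apply/funext => n; rewrite /pseries /series/= exchange_big; apply: eq_bigr => i _.
  by rewrite mulr_suml.
by apply: cvg_big => [|j _]; [exact: add_continuous|exact: cc].
Qed.

(* Since d (n+2) = - d n for n > 0, the series multiplied by 1 + y^2 telescopes. *)
Fixpoint alternating (d0 d1 d2 : R) n : R :=
  match n with
  | 0 => d0
  | 1 => d1
  | 2 => d2
  | (m.+1 as m').+2 => - alternating d0 d1 d2 m'
  end.

Definition primitive_coef (d : nat -> R) n := if n is m.+1 then d m / m.+1%:R else 0.

Lemma alternatingS d0 d1 d2 n : alternating d0 d1 d2 n.+3 = - alternating d0 d1 d2 n.+1.
Proof. by []. Qed.

Lemma alternating_le1 d0 d1 d2 n : `|d0| <= 1 -> `|d1| <= 1 -> `|d2| <= 1 ->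
  `|alternating d0 d1 d2 n| <= 1.
Proof.
move=> h0 h1 h2; elim/ltn_ind: n => -[|[|[|n]]] IH //=.
by rewrite normrN; apply: (IH n.+1).
Qed.

Lemma primitive_coef_le1 d n : (forall n, `|d n| <= 1) -> `|primitive_coef d n| <= 1.
Proof.
move=> dl; case: n => [|n] /=; first by rewrite normr0.
by rewrite normrM normfV normr_nat ler_pdivrMr// mul1r (le_trans (dl n))// ler1n.
Qed.

Lemma alternating_psum d0 d1 d2 y : `|d0| <= 1 -> `|d1| <= 1 -> `|d2| <= 1 -> `|y| < 1 ->
  psum (alternating d0 d1 d2) y = (d0 + d1 * y + (d2 + d0) * y ^+ 2) / (1 + y ^+ 2).
Proof.
move=> h0 h1 h2 y1; set d := alternating d0 d1 d2.
have dl n : `|d n| <= 1 by exact: alternating_le1.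
have gb : geom_bounded d 1 1 by move=> n; rewrite expr1n mulr1.
have y1' : `|y| * 1 < 1 by rewrite mulr1.
have cv : pseries d y n @[n --> \oo] --> psum d y := psum_cvg ler01 gb y1'.
have ct : d n * y ^+ n @[n --> \oo] --> (0 : R) := cvg_series_cvg_0 (psum_cvg ler01 gb y1').
have part n : (1 + y ^+ 2) * pseries d y n.+3 =
    d0 + d1 * y + (d2 + d0) * y ^+ 2 + (d n.+1 * y ^+ n.+3 + d n.+2 * y ^+ n.+4).
  elim: n => [|n IH].
    by rewrite /pseries /series/= !big_nat_recr//= big_geq// /d/=; ring.
  have -> : pseries d y n.+4 = pseries d y n.+3 + d n.+3 * y ^+ n.+3.
    by rewrite /pseries /series/= big_nat_recr.
  by rewrite mulrDr IH /d alternatingS !exprS; ring.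
have y20 : 1 + y ^+ 2 != 0 by rewrite gt_eqF// ltr_pwDl// sqr_ge0.
apply/esym/(canLR (mulfK y20)); rewrite [psum d y * _]mulrC.
have c1 : (1 + y ^+ 2) * pseries d y n.+3 @[n --> \oo] --> (1 + y ^+ 2) * psum d y.
  apply: cvgM; first exact: cvg_cst.
  have -> : (fun n => pseries d y n.+3) = (fun n => pseries d y (n + 3)%N).
    by apply/funext => n; rewrite addn3.
  by rewrite (cvg_shiftn 3).
apply/esym; apply: (cvg_unique _ c1); first exact: norm_hausdorff.
rewrite /=; have -> : (fun n => (1 + y ^+ 2) * pseries d y n.+3) = (fun n =>
    d0 + d1 * y + (d2 + d0) * y ^+ 2 + (d n.+1 * y ^+ n.+3 + d n.+2 * y ^+ n.+4)).
  by apply/funext.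
rewrite -[X in _ --> X]addr0; apply: cvgD; first exact: cvg_cst.
rewrite -[X in _ --> X]addr0; apply: cvgD.
- have -> : (fun n => d n.+1 * y ^+ n.+3) = (fun n => y ^+ 2 * (d (n + 1)%N * y ^+ (n + 1))).
    by apply/funext => n; rewrite addn1 !exprS; ring.
  by rewrite -[X in _ --> X](mulr0 (y ^+ 2)); apply: cvgM; [exact: cvg_cst|rewrite (cvg_shiftn 1 (fun n => d n * y ^+ n))].
- have -> : (fun n => d n.+2 * y ^+ n.+4) = (fun n => y ^+ 2 * (d (n + 2)%N * y ^+ (n + 2))).
    by apply/funext => n; rewrite addn2 !exprS; ring.
  by rewrite -[X in _ --> X](mulr0 (y ^+ 2)); apply: cvgM; [exact: cvg_cst|rewrite (cvg_shiftn 2 (fun n => d n * y ^+ n))].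
Qed.

(** Both sides vanish at 0 and have the same derivative for |x| < 1/4, the range of [psum_derive]
    with B = 1; the mean value theorem concludes. *)
Lemma primitive_psum (d : nat -> R) (f f' : R -> R) y : (forall n, `|d n| <= 1) ->
  f 0 = 0 -> (forall x : R, is_derive x 1 f (f' x)) -> (forall x, `|x| < 1 -> psum d x = f' x) ->
  `|y| < 4^-1 -> psum (primitive_coef d) y = f y.
Proof.
move=> dl f0 df dE y4.
have gb : geom_bounded (primitive_coef d) 1 1.
  by move=> n; rewrite expr1n mulr1; exact: primitive_coef_le1.
have dd : pseries_diffs (primitive_coef d) = d.
  by apply/funext => n; rewrite /pseries_diffs/= mulrC divfK// pnatr_eq0.
have dg (x : R) : `|x| < 4^-1 -> is_derive x 1 (fun x => psum (primitive_coef d) x - f x) 0.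
  move=> x4.
  have := psum_derive (x := x) ler01 gb; rewrite mulr1 -ltr_pdivlMr// mul1r => /(_ x4).
  have x1 : `|x| < 1 by rewrite (lt_le_trans x4)// invf_le1// ler1n.
  rewrite dd dE// => dp; have dfx := df x.
  by have := is_deriveB dp dfx; rewrite subrr.
pose g := fun x => psum (primitive_coef d) x - f x.
have g0 : g 0 = 0 by rewrite /g psum0/= f0 subrr.
suff : g y = 0 by move/subr0_eq.
have cg (a b : R) : `|a| < 4^-1 -> `|b| < 4^-1 -> {within `[a, b], continuous g}.
  move=> a4 b4; apply: continuous_in_subspaceT => x; rewrite inE/= in_itv/= => /andP[ax xb].
  apply: is_derive_continuous; apply: dg.
  by move: a4 b4; rewrite !ltr_norml => /andP[? ?] /andP[? ?]; apply/andP; split; lra.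
have q4 : `|0 : R| < 4^-1 by rewrite normr0 invr_gt0.
have inn (a b x : R) : `|a| < 4^-1 -> `|b| < 4^-1 -> x \in `]a, b[ -> is_derive x 1 g 0.
  move=> a4 b4; rewrite in_itv/= => /andP[ax xb]; apply: dg.
  by move: a4 b4; rewrite !ltr_norml => /andP[? ?] /andP[? ?]; apply/andP; split; lra.
have [y0|y0|->] := ltgtP y 0; last exact: g0.
- have [z _] := @MVT R g (fun=> 0) y 0 y0 (fun x => inn y 0 x y4 q4) (cg y 0 y4 q4).
  by rewrite mul0r g0 sub0r => /eqP; rewrite oppr_eq0 => /eqP.
- have [z _] := @MVT R g (fun=> 0) 0 y y0 (fun x => inn 0 y x q4 y4) (cg 0 y q4 y4).
  by rewrite mul0r g0 subr0.
Qed.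

(* The Taylor coefficients of - ln (1 + y^2) / 4 and of (atan y - y) / 2. *)
Definition log_coef := primitive_coef (alternating 0 (- 2^-1) 0).
Definition arg_coef := primitive_coef (alternating 0 0 (- 2^-1)).

Let h2 : `|- 2^-1 : R| <= 1.
Proof. by rewrite normrN gtr0_norm ?invr_gt0// invf_le1// ler1n. Qed.
Let h0 : `|0 : R| <= 1. Proof. by rewrite normr0. Qed.

Lemma log_coef_le1 n : `|log_coef n| <= 1.
Proof. by apply: primitive_coef_le1 => m; exact: alternating_le1. Qed.

Lemma arg_coef_le1 n : `|arg_coef n| <= 1.
Proof. by apply: primitive_coef_le1 => m; exact: alternating_le1. Qed.

Lemma log_psum y : `|y| < 4^-1 -> psum log_coef y = - (4^-1 * ln (1 + y ^+ 2)).
Proof.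
apply: (@primitive_psum (alternating 0 (- 2^-1) 0) (fun y => - (4^-1 * ln (1 + y ^+ 2)))
  (fun y => - (2^-1 * y / (1 + y ^+ 2))) y) => [n||x|x x1].
- exact: alternating_le1.
- by rewrite expr0n addr0 ln1 mulr0 oppr0.
- have x0 : 0 < 1 + x ^+ 2 by rewrite ltr_pwDl// sqr_ge0.
  der_tac => //; field; by rewrite gt_eqF.
- rewrite alternating_psum//; field; by rewrite gt_eqF// ltr_pwDl// sqr_ge0.
Qed.

Lemma arg_psum y : `|y| < 4^-1 -> psum arg_coef y = 2^-1 * atan y - 2^-1 * y.
Proof.
apply: (@primitive_psum (alternating 0 0 (- 2^-1)) (fun y => 2^-1 * atan y - 2^-1 * y)
  (fun y => 2^-1 / (1 + y ^+ 2) - 2^-1) y) => [n||x|x x1].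
- exact: alternating_le1.
- by rewrite atan0 !mulr0 subrr.
- have x0 : 0 < 1 + x ^+ 2 by rewrite ltr_pwDl// sqr_ge0.
  der_tac => //; field; by rewrite gt_eqF.
- rewrite alternating_psum//; field; by rewrite gt_eqF// ltr_pwDl// sqr_ge0.
Qed.

End power_series.

(** * Limits along an ultrafilter *)

Section ultrafilter_limits.
Context {R : realType}.

Lemma ultra_limit (U : set_system nat) (u : nat -> R) (B : R) : UltraFilter U ->
  (forall n, `|u n| <= B) -> exists l : R, u n @[n --> U] --> l.
Proof.
move=> UU uB.
have FU : ProperFilter (u @ U) by exact: fmap_proper_filter.
have uU : (u @ U) `[- B, B]%classic.
  by apply: (@filterS _ U _ setT) filterT => n _ /=; rewrite in_itv/= -ler_norml.
have [l [_ cl]] := @segment_compact R (- B) B (u @ U) FU uU.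
exists l => A Al; have [//|nA] := in_ultra_setVsetC (u @^-1` A) UU.
have [x [/= Ax xA]] := cl (~` A) A nA Al.
by case: Ax.
Qed.

(** One ultrafilter finer than convergence at infinity serves all j at once, in place of a diagonal
    extraction. *)
Lemma ultra_limits (u : nat -> nat -> R) (B : nat -> R) : (forall n j, `|u n j| <= B j) ->
  exists (U : set_system nat) (l : nat -> R), [/\ ProperFilter U, \oo `<=` U &
    forall j, u n j @[n --> U] --> l j].
Proof.
move=> uB; have [U [UU sU]] := @ultraFilterLemma nat \oo _.
have /choice[l lP] : forall j, exists l : R, u n j @[n --> U] --> l.
  by move=> j; apply: (ultra_limit UU) => n; exact: uB.
by exists U, l; split => //; case: UU.
Qed.

End ultrafilter_limits.

Section trig_lipschitz.
Context {R : realType}.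

Lemma derive_lipschitz (f f' : R -> R) : (forall x : R, is_derive x 1 f (f' x)) ->
  (forall x, `|f' x| <= 1) -> forall x y, `|f x - f y| <= `|x - y|.
Proof.
move=> df bf; have key x y : x <= y -> `|f y - f x| <= `|y - x|.
  move=> xy; have cf : {within `[x, y], continuous f}.
    by apply: continuous_subspaceT => z; exact: is_derive_continuous (df z).
  have [c _ ->] := MVT_segment xy (fun z _ => df z) cf.
  by rewrite normrM ler_piMl.
move=> x y; have [xy|yx] := leP x y; last exact: key (ltW yx).
by rewrite distrC (distrC x); exact: key.
Qed.

(** The 1-Lipschitz bound turns L^1 convergence into convergence of characteristic functions for
    small t, which is all that cumulants depend on. *)
Lemma cosM_lipschitz (t : R) : `|t| <= 1 -> forall x y, `|cos (t * x) - cos (t * y)| <= `|x - y|.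
Proof.
move=> t1; apply: (@derive_lipschitz (fun x => cos (t * x)) (fun x => - (t * sin (t * x)))) => x.
  by der_tac; ring.
by rewrite normrN normrM mulr_ile1// sin_max.
Qed.

Lemma sinM_lipschitz (t : R) : `|t| <= 1 -> forall x y, `|sin (t * x) - sin (t * y)| <= `|x - y|.
Proof.
move=> t1; apply: (@derive_lipschitz (fun x => sin (t * x)) (fun x => t * cos (t * x))) => x.
  by der_tac; ring.
by rewrite normrM mulr_ile1// cos_max.
Qed.

End trig_lipschitz.

(** * Power series in the power sums *)

Section power_sums.
Context {R : realType}.

(* The power sums of order 0 and 1 need not converge; their coefficients in
   [log_coef] and [arg_coef] vanish. *)
Definition power_sum k (lam : nat -> R) m : R :=
  if (m < 2)%N then 0 else \sum_(0 <= i < k) lam i ^+ m.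

Lemma le_of_sum_sqr k (lam : nat -> R) (B : R) i : 0 <= B -> \sum_(0 <= i < k) lam i ^+ 2 <= B ^+ 2 ->
  (i < k)%N -> `|lam i| <= B.
Proof.
move=> B0 lB ik; rewrite -(ler_pXn2r (isT : (0 < 2)%N)) ?nnegrE// real_normK ?num_real//.
apply: le_trans lB; rewrite big_mkord (bigD1 (Ordinal ik))//= lerDl sumr_ge0// => j _; exact: sqr_ge0.
Qed.

Lemma power_sum_le k (lam : nat -> R) (B : R) m : 0 <= B -> \sum_(0 <= i < k) lam i ^+ 2 <= B ^+ 2 ->
  `|power_sum k lam m| <= B ^+ m.
Proof.
move=> B0 lB; rewrite /power_sum; case: ltnP => [|m2]; first by rewrite normr0 exprn_ge0.
rewrite -(subnK m2) (le_trans (ler_norm_sum _ _ _))//.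
apply: (@le_trans _ _ (\sum_(0 <= i < k) B ^+ (m - 2) * lam i ^+ 2)).
  rewrite big_nat [leRHS]big_nat; apply: ler_sum => i /andP[_ ik].
  rewrite exprD normrM [`|lam i ^+ 2|]ger0_norm ?sqr_ge0// ler_wpM2r ?sqr_ge0// normrX.
  by apply: lerXn2r; rewrite ?nnegrE//; exact: le_of_sum_sqr lB ik.
by rewrite -mulr_sumr exprD ler_wpM2l// exprn_ge0.
Qed.

(** The coefficient of t^m in the sum over i of the series of c at 2 t lam_i, with q m for the power
    sum of order m. In this form it also makes sense for limits of power sums. *)
Definition series_coef (c q : nat -> R) m := c m * 2 ^+ m * q m.

Lemma series_coef_bounded c q (B : R) : (forall m, `|c m| <= 1) -> (forall m, `|q m| <= B ^+ m) ->
  geom_bounded (series_coef c q) 1 (2 * B).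
Proof.
move=> c1 qB m; rewrite /series_coef !normrM normrX [`|2|]gtr0_norm// mul1r exprMn.
rewrite ler_pM// ?mulr_ge0// ?exprn_ge0//.
by rewrite ler_piMl// ?exprn_ge0.
Qed.

Lemma psum_series_coef (c : nat -> R) k (lam : nat -> R) (t B : R) : (forall m, `|c m| <= 1) -> c 0%N = 0 -> c 1%N = 0 ->
  0 <= B -> \sum_(0 <= i < k) lam i ^+ 2 <= B ^+ 2 -> `|t| * (2 * B) < 1 ->
  psum (series_coef c (power_sum k lam)) t = \sum_(0 <= i < k) psum c (2 * (t * lam i)).
Proof.
move=> c1 c00 c10 B0 lB tB.
have psE (x y : R) : pseries (fun m => c m * y ^+ m) x = pseries c (y * x).
  by apply/funext => n; apply: eq_bigr => m _ /=; rewrite exprMn mulrA.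
have cv i : (i < k)%N -> cvgn (pseries c (2 * lam i * t)).
  move=> ik; apply: (@psum_cvg _ c 1 1) => // [m|]; first by rewrite expr1n mulr1.
  rewrite mulr1 normrM (le_lt_trans _ tB)// mulrC ler_wpM2l// normrM gtr0_norm//.
  by rewrite ler_wpM2l//; exact: le_of_sum_sqr lB ik.
have -> : series_coef c (power_sum k lam) = fun m => \sum_(i < k) c m * (2 * lam i) ^+ m.
  apply/funext => m; rewrite /series_coef /power_sum.
  case: ltnP => [m2|m2]; last first.
    by rewrite big_mkord mulr_sumr; apply: eq_bigr => i _; rewrite exprMn mulrA.
  rewrite mulr0 big1// => i _.
  by case: m m2 => [|[|]]//; rewrite ?c00 ?c10 mul0r.
rewrite (@psum_sum _ 'I_k _ (fun i m => c m * (2 * lam i) ^+ m)).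
  rewrite big_mkord; apply: eq_bigr => i _; rewrite /psum psE; congr (limn (pseries c _)); ring.
by move=> i; rewrite psE; exact: cv.
Qed.

(** The formula tan(x / 2) = sin x / (1 + cos x), in the shape in which [clog] computes the
    principal argument. *)
Lemma half_angle (x : R) : `|x| < pi -> 2 * atan (sin x / (1 + cos x)) = x.
Proof.
move=> xpi; pose y := x / 2; have xE : x = y + y by rewrite /y; field.
have yB : - (pi / 2) < y < pi / 2.
  by move: xpi; rewrite ltr_norml /y => /andP[? ?]; apply/andP; split; lra.
have cy : cos y != 0 by rewrite gt_eqF// cos_gt0_pihalf.
have -> : sin x / (1 + cos x) = tan y.
  have := cos2Dsin2 y; rewrite /tan xE sinD cosD => h.
  rewrite -h; field; rewrite cy /=.
  have -> : cos y ^+ 2 + sin y ^+ 2 + (cos y * cos y - sin y * sin y) = 2 * cos y ^+ 2 by ring.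
  by rewrite mulf_neq0// expf_neq0.
by rewrite tanK ?in_itv// xE; ring.
Qed.

End power_sums.

(** * Cumulants of an L^1 limit of chaos sums *)

Section chaos_limit.
Context {R : realType} d (T : measurableType d) (P : probability T R).
Variables (F : {RV P >-> R}) (k : nat -> nat) (X : nat -> nat -> T -> R) (lam : nat -> nat -> R) (B : R).
Hypotheses (mX : forall n i, measurable_fun setT (X n i)) (gX : forall n, std_gauss P (k n) (X n)).
Local Notation Fn n := (chaos (k n) (X n) (lam n)).
Hypothesis iF : P.-integrable setT (EFin \o F).
Hypothesis iFn : forall n, P.-integrable setT (EFin \o Fn n).
Hypothesis Fcvg : \int[P]_w `|F w - Fn n w| @[n --> \oo] --> (0 : R).
Hypothesis B0 : 0 <= B.
Hypothesis lB : forall n, \sum_(0 <= i < k n) lam n i ^+ 2 <= B ^+ 2.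
Variables (U : set_system nat) (q : nat -> R).
Hypotheses (UF : ProperFilter U) (sU : \oo `<=` U).
Hypothesis qU : forall m, power_sum (k n) (lam n) m @[n --> U] --> q m.

Lemma lipschitz_cvg (h : R -> R) : (forall x y, `|h x - h y| <= `|x - y|) ->
  \int[P]_w h (Fn n w) @[n --> U] --> \int[P]_w h (F w).
Proof.
move=> hl; apply/cvgrPdist_lt => e e0; apply: sU.
move/cvgrPdist_lt : Fcvg => /(_ _ e0); apply: filterS => n.
rewrite sub0r normrN => h1.
rewrite (le_lt_trans (lipschitz_dist hl iF (iFn n)))// (le_lt_trans (ler_norm _) h1)//.
Qed.

(** For |t| < rad one has |t| <= 1 for the Lipschitz estimates, 2 B |t| < 1 for convergence of the
    series, and |2 t lam| < 1/4 for [log_psum] and [arg_psum]. *)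
Let rad : R := (16 * (B + 1))^-1.
Let B10 : 0 < 16 * (B + 1). Proof. by rewrite mulr_gt0// ltr_wpDl. Qed.
Let rad0 : 0 < rad. Proof. by rewrite invr_gt0. Qed.

Let radP (t : R) : `|t| < rad -> [/\ `|t| <= 1, `|t| * (2 * B) < 1 & forall x : R, `|x| <= B -> `|2 * (t * x)| < 4^-1].
Proof.
rewrite /rad -[X in _ < X]mul1r ltr_pdivlMr// => tr.
have t0 := normr_ge0 t; have tB : 0 <= `|t| * B by rewrite mulr_ge0.
have tr' : 16 * (`|t| * B) + 16 * `|t| < 1 by move: tr; congr (_ < _); ring.
have E : `|t| * (2 * B) = 2 * (`|t| * B) by ring.
split; rewrite ?E; [lra|lra|] => x xB.
rewrite normrM gtr0_norm// normrM.
have : `|t| * `|x| <= `|t| * B by rewrite ler_wpM2l.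
by move: tB tr'; move: (`|t| * B) (`|t| * `|x|) => u v; lra.
Qed.

Let cL := series_coef log_coef q.
Let cA := series_coef arg_coef q.

Let cvg_psum (c : nat -> R) t : (forall m, `|c m| <= 1) -> `|t| * (2 * B) < 1 ->
  geom_bounded (series_coef c q) 1 (2 * B) /\
  psum (series_coef c (power_sum (k n) (lam n))) t @[n --> U] --> psum (series_coef c q) t.
Proof.
move=> c1 tB; apply: psum_cvg_coef => //.
- by rewrite mulr_ge0.
- by move=> n; apply: series_coef_bounded => // m; apply: power_sum_le.
- by move=> m; apply: cvgM; [exact: cvg_cst|exact: qU].
Qed.

Let bounded_coef (c : nat -> R) : (forall m, `|c m| <= 1) -> geom_bounded (series_coef c q) 1 (2 * B).
Proof. by move=> c1; have [] := @cvg_psum c 0 c1 _; rewrite // normr0 mul0r. Qed.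

(** Along U, the characteristic functions of the approximations converge to that of F by L^1
    convergence, and to the right-hand side by convergence of the power sums. *)
Lemma chaos_limit_cf (t : R) : `|t| < rad ->
  \int[P]_w cos (t * F w) = expR (psum cL t) * cos (psum cA t) /\
  \int[P]_w sin (t * F w) = expR (psum cL t) * sin (psum cA t).
Proof.
move=> tr; have [t1 tB xB] := radP tr.
have lb n i : (i < k n)%N -> `|2 * (t * lam n i)| < 4^-1.
  by move=> ik; apply: xB; exact: le_of_sum_sqr (lB n) ik.
have EL n : - (4^-1 * \sum_(0 <= i < k n) ln (1 + (2 * (t * lam n i)) ^+ 2)) =
    psum (series_coef log_coef (power_sum (k n) (lam n))) t.
  rewrite (psum_series_coef log_coef_le1 _ _ B0 (lB n) tB)//; last by rewrite /log_coef/= mul0r.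
  rewrite mulr_sumr -sumrN big_nat [RHS]big_nat; apply: eq_bigr => i /andP[_ ik].
  by rewrite log_psum// lb.
have EA n : \sum_(0 <= i < k n) (2^-1 * atan (2 * (t * lam n i)) - t * lam n i) =
    psum (series_coef arg_coef (power_sum (k n) (lam n))) t.
  rewrite (psum_series_coef arg_coef_le1 _ _ B0 (lB n) tB)//; last by rewrite /arg_coef/= mul0r.
  rewrite big_nat [RHS]big_nat; apply: eq_bigr => i /andP[_ ik].
  by rewrite arg_psum ?lb//; congr (_ - _); field.
have [_ cvL] := cvg_psum log_coef_le1 tB; have [_ cvA] := cvg_psum arg_coef_le1 tB.
have cvE : expR (psum (series_coef log_coef (power_sum (k n) (lam n))) t) @[n --> U] --> expR (psum cL t).
  exact: (continuous_cvg _ (@continuous_expR R _) cvL).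
have cf n := chaos_cf (lam n) t (mX n) (gX n).
split.
- apply: (cvg_unique _ (lipschitz_cvg (cosM_lipschitz t1))); first exact: norm_hausdorff.
  have -> : (fun n => \int[P]_w cos (t * Fn n w)) = fun n =>
      expR (psum (series_coef log_coef (power_sum (k n) (lam n))) t) *
      cos (psum (series_coef arg_coef (power_sum (k n) (lam n))) t).
    by apply/funext => n; have [h _] := cf n; rewrite -EL -EA; exact: h.
  by apply: cvgM cvE _; exact: (continuous_cvg _ (@continuous_cos R _) cvA).
- apply: (cvg_unique _ (lipschitz_cvg (sinM_lipschitz t1))); first exact: norm_hausdorff.
  have -> : (fun n => \int[P]_w sin (t * Fn n w)) = fun n =>
      expR (psum (series_coef log_coef (power_sum (k n) (lam n))) t) *
      sin (psum (series_coef arg_coef (power_sum (k n) (lam n))) t).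
    by apply/funext => n; have [_ h] := cf n; rewrite -EL -EA; exact: h.
  by apply: cvgM cvE _; exact: (continuous_cvg _ (@continuous_sin R _) cvA).
Qed.

Local Open Scope complex_scope.

Lemma clog_polar (L A : R) : `|A| < pi -> clog ((expR L * cos A) +i* (expR L * sin A)) = L +i* A.
Proof.
move=> Api; rewrite /clog /=.
have -> : (expR L * cos A) ^+ 2 + (expR L * sin A) ^+ 2 = expR L ^+ 2.
  by rewrite !exprMn -mulrDr cos2Dsin2 mulr1.
rewrite sqrtr_sqr ger0_norm ?expR_ge0// expRK; congr (_ +i* _).
rewrite (_ : expR L + expR L * cos A = expR L * (1 + cos A)); last by ring.
rewrite -mulf_div divff ?gt_eqF ?expR_gt0// mul1r.
exact: half_angle.
Qed.

Let char_funE t : char_fun F t = (\int[P]_w cos (t * F w)) +i* (\int[P]_w sin (t * F w)).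
Proof. by rewrite /char_fun unlock. Qed.

Let clogE : \forall t \near (0 : R), clog (char_fun F t) = psum cL t +i* psum cA t.
Proof.
have B20 : 0 <= 2 * B by rewrite mulr_ge0.
have cA0 : continuous_at (0 : R) (psum cA).
  have := psum_derive (x := 0) B20 (bounded_coef arg_coef_le1); rewrite normr0 mul0r => /(_ ltr01).
  exact: is_derive_continuous.
have c0 : psum cA 0 = 0 by rewrite psum0 /cA /series_coef /arg_coef/= !mul0r.
(* The argument series is continuous and vanishes at 0, so near 0 it is the principal argument
   returned by [clog]. *)
have npi : \forall t \near (0 : R), `|psum cA t| < pi.
  have pi0 := @pi_gt0 R; move/cvgrPdist_lt : cA0 => /(_ _ pi0); apply: filterS => t.
  by rewrite c0 sub0r normrN.
near=> t.
have tr : `|t| < rad by near: t; exact: near0_lt.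
have [h1 h2] := chaos_limit_cf tr.
rewrite char_funE h1 h2 clog_polar//; near: t; exact: npi.
Unshelve. all: by end_near. Qed.

Lemma cumulantE j : cumulant F j =
  complex.Re ((- 'i) ^+ j * ((j`!%:R * cL j) +i* (j`!%:R * cA j))).
Proof.
have B20 : 0 <= 2 * B by rewrite mulr_ge0.
rewrite /cumulant /cderive1n; congr (complex.Re (_ * (_ +i* _))).
- apply: (@derive1n_psum _ _ j _ 1 (2 * B)) => //; first exact: bounded_coef log_coef_le1.
  by apply: filterS clogE => t ->.
- apply: (@derive1n_psum _ _ j _ 1 (2 * B)) => //; first exact: bounded_coef arg_coef_le1.
  by apply: filterS clogE => t ->.
Qed.

Let Ni2 : (- 'i) ^+ 2 = -1 :> R[i].
Proof. by rewrite sqrrN sqr_i. Qed.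

(** The log-modulus is even in t and the argument odd, so even cumulants are read off [cL] and odd
    ones off [cA]. *)
Let coefs : [/\ cL 2%N = - q 2%N, cL 4%N = 2 * q 4%N & cL 6%N = - (16 / 3) * q 6%N] /\
  (cA 3%N = - (4 / 3) * q 3%N /\ cA 5%N = 16 / 5 * q 5%N).
Proof. by rewrite /cL /cA /series_coef /log_coef /arg_coef/=; split; split; field. Qed.

Lemma chaos_cumulants : [/\ cumulant F 2%N = 2 * q 2%N, cumulant F 3%N = 8 * q 3%N,
  cumulant F 4%N = 48 * q 4%N, cumulant F 5%N = 384 * q 5%N & cumulant F 6%N = 3840 * q 6%N].
Proof.
have [[l2 l4 l6] [a3 a5]] := coefs.
have ReN (z : R[i]) : complex.Re (- z) = - complex.Re z by case: z.
have ReNi (z : R[i]) : complex.Re (- 'i * z) = complex.Im z.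
  rewrite mulNr ReN -complexiE; case: z => a b /=; ring.
have e3 : (- 'i) ^+ 3 = 'i :> R[i] by rewrite exprS Ni2 mulrN1 opprK.
have e4 : (- 'i) ^+ 4 = 1 :> R[i] by rewrite (exprM _ 2 2) Ni2 sqrrN expr1n.
have Rei (z : R[i]) : complex.Re ('i * z) = - complex.Im z.
  by rewrite -[LHS]opprK -ReN -mulNr ReNi.
split; rewrite cumulantE.
- by rewrite Ni2 mulN1r ReN/= l2; rewrite /factorial/=; ring.
- by rewrite e3 Rei/= a3; rewrite /factorial/=; field.
- by rewrite e4 mul1r/= l4; rewrite /factorial/=; ring.
- by rewrite exprS e4 mulr1 ReNi/= a5; rewrite /factorial/=; field.
- by rewrite (exprD _ 4 2) e4 mul1r Ni2 mulN1r ReN/= l6; rewrite /factorial/=; field.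
Qed.

End chaos_limit.

(** * Passage to the limit *)

Section wasserstein_bound.
Context {R : realType}.

(** The defect expanded in power sums. The limit comes with the limits q of the power sums rather
    than with a list of eigenvalues, and a polynomial in finitely many of them is continuous. *)
Definition stein_poly (r s2 theta : R) (q : nat -> R) : R :=
  2 * (s2 ^+ 2 * q 2%N + 8 * s2 * theta * q 3%N + (16 * theta ^+ 2 - 8 * s2) * q 4%N
       - 32 * theta * q 5%N + 16 * q 6%N)
  + (s2 * r * theta + 4 * theta * q 2%N - 4 * q 3%N) ^+ 2.

Lemma stein_defectE (r s2 theta : R) k lam :
  stein_defect r s2 theta k lam = stein_poly r s2 theta (power_sum k lam).
Proof.
rewrite /stein_defect /stein_poly /power_sum /=; congr (_ * _ + _).
rewrite !mulr_sumr -!sumrN -!big_split/=.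
by apply: eq_bigr => i _; ring.
Qed.

Context (H : hilbertSpace R) (HH : tensorSquare H).
Context d (T : measurableType d) (P : probability T R).
Variables (X : H -> {RV P >-> R}) (I2 : HH -> {RV P >-> R}).
Hypotheses (iX : isonormal X) (dI : double_wiener_integral X I2).
Context d' (T' : measurableType d') (Q : probability T' R) (Y : {RV Q >-> R}).
Hypothesis iY : Q.-integrable setT (EFin \o Y).

(** The bound is abstracted into [Phi] to serve both parts of the theorem. A single q carries the
    cumulants and the bound because both are obtained along the same filter. *)
Lemma wasserstein_chaos_limit (Phi : (nat -> R) -> R) (f : HH) :
  (forall (U : set_system nat) (q_ : nat -> nat -> R) (q : nat -> R), ProperFilter U ->
    (forall m, q_ n m @[n --> U] --> q m) -> Phi (q_ n) @[n --> U] --> Phi q) ->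
  (forall k (e : nat -> H) lam (h : R -> R), orthonormal k e -> (forall x y, `|h x - h y| <= `|x - y|) ->
    `|\int[P]_w h (chaos k (fun i => X (e i)) lam w) - \int[Q]_w h (Y w)| <= Phi (power_sum k lam)) ->
  symmetric_tensors HH f ->
  exists q, [/\ cumulant (I2 f) 2%N = 2 * q 2%N, cumulant (I2 f) 3%N = 8 * q 3%N,
    cumulant (I2 f) 4%N = 48 * q 4%N, cumulant (I2 f) 5%N = 384 * q 5%N &
    cumulant (I2 f) 6%N = 3840 * q 6%N] /\
  (wasserstein (I2 f) Y <= (Phi q)%:E)%E.
Proof.
move=> cPhi bPhi sf.
have /choice[kle kleP] : forall n, exists kle : nat * (nat -> R) * (nat -> H),
    orthonormal kle.1.1 kle.2 /\ `|f - diag_tensor HH kle.1.1 kle.1.2 kle.2| < n.+1%:R^-1.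
  move=> n; have n0 : 0 < n.+1%:R^-1 :> R by rewrite invr_gt0.
  by have [k [lam [e h]]] := diag_tensor_approx sf n0; exists (k, lam, e).
pose k n := (kle n).1.1; pose lam n := (kle n).1.2; pose e n := (kle n).2.
have on n : orthonormal (k n) (e n) by have [] := kleP n.
pose g n := diag_tensor HH (k n) (lam n) (e n).
have fg n : `|f - g n| < n.+1%:R^-1 by have [] := kleP n.
(* The diagonal approximants are within distance 1 of f, so their eigenvalues have square sum at
   most B^2 uniformly in n. *)
pose B := `|f| + 1; have B0 : 0 <= B by rewrite addr_ge0.
have lB n : \sum_(0 <= i < k n) lam n i ^+ 2 <= B ^+ 2.
  rewrite -(diag_tensor_dot HH (lam n) (on n)) lerXn2r ?nnegrE//.
  rewrite -/(g n) -[g n](subKr f) (le_trans (ler_normB _ _))// lerD2l.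
  by rewrite (le_trans (ltW (fg n)))// invf_le1// ler1n.
have [U [q [UF sU qU]]] := ultra_limits (u := fun n => power_sum (k n) (lam n))
  (fun n j => power_sum_le j B0 (lB n)).
have mX n i : measurable_fun setT (X (e n i) : T -> R) by exact: measurable_funPT.
have gX n := isonormal_std_gauss iX (on n).
have iF : P.-integrable setT (EFin \o I2 f).
  by have [] := I2_chaos_dist dI (lam 0%N) (on 0%N) sf.
have iFn n : P.-integrable setT (EFin \o chaos (k n) (fun i => X (e n i)) (lam n)).
  exact: (chaos_integrable (mX n) (chaos_isometry dI (on n))).
have Fcvg : \int[P]_w `|I2 f w - chaos (k n) (fun i => X (e n i)) (lam n) w| @[n --> \oo] --> (0 : R).
  apply: (@squeeze_cvgr _ _ _ _ (fun=> 0) (fun n => Num.sqrt 2 * n.+1%:R^-1)).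
  - near=> n; apply/andP; split; first by apply: Rintegral_ge0 => w _.
    have [_] := I2_chaos_dist dI (lam n) (on n) sf; move=> /le_trans; apply.
    rewrite sqrtrM// sqrtr_sqr normr_id ler_wpM2l ?sqrtr_ge0//.
    exact: ltW (fg n).
  - exact: cvg_cst.
  - by rewrite -[X in _ --> X](mulr0 (Num.sqrt 2)); apply: cvgM; [exact: cvg_cst|exact: cvg_harmonic].
exists q; split.
  exact: (chaos_cumulants mX gX iF iFn Fcvg B0 lB UF sU qU).
apply: ub_ereal_sup => _ [h hl <-].
have hint dd (S : measurableType dd) (m : probability S R) (Z : S -> R) :
    m.-integrable setT (EFin \o Z) -> ('E_m[(fun w => h (Z w))%R] = (\int[m]_w h (Z w))%:E)%E.
  move=> iZ; rewrite unlock -[LHS]fineK//.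
  exact: (integrable_fin_num measurableT (lipschitz_integrable hl iZ)).
rewrite (hint _ _ P (I2 f) iF) (hint _ _ Q Y iY) -EFinB abse_EFin lee_fin.
have cvh := lipschitz_cvg iF iFn Fcvg UF sU hl.
have cvl : `|\int[P]_w h (chaos (k n) (fun i => X (e n i)) (lam n) w) - \int[Q]_w h (Y w)| @[n --> U] -->
    `|\int[P]_w h (I2 f w) - \int[Q]_w h (Y w)|.
  by apply: cvg_norm; apply: cvgB => //; exact: cvg_cst.
apply: (ler_cvg_to cvl (cPhi U _ q UF qU)).
by near=> n; apply: bPhi.
Unshelve. all: by end_near. Qed.

End wasserstein_bound.

(** * The symmetrized Gamma case *)

Section symmetrized_gamma.
Context {R : realType}.

(** The expression under the root in (b), with 2^(j-1) (j-1)! q_j in place of the cumulant of order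
    j. *)
Definition gamma_poly (r : R) (q : nat -> R) : R :=
  32 * q 6%N - 16 / r * q 4%N * q 2%N + 2 / r ^+ 2 * q 2%N ^+ 3 + 32 / 3 * q 3%N ^+ 2.

(* [gamma_poly] is the defect with sigma^2 replaced by its empirical value p2 / r. *)
Lemma stein_defect_gamma (r s2 : R) k lam : r != 0 ->
  let p2 := \sum_(0 <= i < k) lam i ^+ 2 in
  0 <= gamma_poly r (power_sum k lam) /\
  stein_defect (2 * r) s2 0 k lam <= 2 * gamma_poly r (power_sum k lam) + 4 * (s2 - p2 / r) ^+ 2 * p2.
Proof.
move=> rn0 p2; pose s := p2 / r; pose p3 := \sum_(0 <= i < k) lam i ^+ 3.
pose V (u : R) := \sum_(0 <= i < k) lam i ^+ 2 * (u - 4 * lam i ^+ 2) ^+ 2.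
have DV u : stein_defect (2 * r) u 0 k lam = 2 * V u + 16 * p3 ^+ 2.
  rewrite /stein_defect /V -/p3; congr (_ * _ + _); last by ring.
  by apply: eq_bigr => i _; ring.
have gE : gamma_poly r (power_sum k lam) = 2 * V s + 32 / 3 * p3 ^+ 2.
  have -> : 2 * V s = stein_poly (2 * r) s 0 (power_sum k lam) - 16 * p3 ^+ 2.
    by rewrite -stein_defectE DV addrK.
  rewrite /gamma_poly /stein_poly /power_sum/= -/p3 -/p2 /s.
  by field.
have V0 u : 0 <= V u by rewrite sumr_ge0// => i _; rewrite mulr_ge0 ?sqr_ge0.
have p30 : 0 <= p3 ^+ 2 := sqr_ge0 _.
(* The inequality (x + y)^2 <= 2 x^2 + 2 y^2 moves s2 to s. The resulting 4 V s + 16 p_3^2 is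
   covered by twice [gamma_poly], in which p_3^2 has coefficient 32/3. *)
have VV : V s2 <= 2 * V s + 2 * (s2 - s) ^+ 2 * p2.
  rewrite /V /p2 !mulr_sumr -big_split/=; apply: ler_sum => i _.
  rewrite -subr_ge0 (_ : _ - _ = lam i ^+ 2 * (2 * s - s2 - 4 * lam i ^+ 2) ^+ 2); last by ring.
  by rewrite mulr_ge0 ?sqr_ge0.
rewrite gE DV; have := V0 s; rewrite -/s.
have E : 4 * (s2 - s) ^+ 2 * p2 = 2 * (2 * (s2 - s) ^+ 2 * p2) by ring.
rewrite E; move: VV p30; move: (V s) (V s2) (p3 ^+ 2) (2 * _ * p2) => a b x y VV x0 a0.
by split; lra.
Qed.

Lemma sqrt_le1D (x : R) : 0 <= x -> Num.sqrt x <= 1 + x.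
Proof.
move=> x0; rewrite -{2}[x]sqr_sqrtr//; have := sqrtr_ge0 x; move: (Num.sqrt x) => y y0; nra.
Qed.

Lemma sqrtD_le (x y : R) : 0 <= x -> 0 <= y -> Num.sqrt (x + y) <= Num.sqrt x + Num.sqrt y.
Proof.
move=> x0 y0; rewrite -[leRHS]ger0_norm ?addr_ge0 ?sqrtr_ge0// -sqrtr_sqr ler_wsqrtr//.
by rewrite sqrrD !sqr_sqrtr// addrAC lerDl mulrn_wge0// mulr_ge0 ?sqrtr_ge0.
Qed.

(** The error made in replacing sigma^2 carries a factor p_2, which is bounded as long as p_2 <= c.
    If p_2 > c, then del = 2 p_2 - c exceeds both c and p_2, and the trivial bound is at most a
    multiple of [del]. *)
Lemma finite_chaos_gamma (lambda r : R) : 0 < lambda -> 0 < r ->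
  exists C1 C2 : R, [/\ 0 < C1, 0 < C2 &
  forall d (T : measurableType d) (P : probability T R) k (X : nat -> T -> R)
    d' (T' : measurableType d') (Q : probability T' R) (Y : {RV Q >-> R}) lam (h : R -> R),
  (forall i, measurable_fun setT (X i)) -> std_gauss P k X ->
  (forall lam, (\int[P]_w (chaos k X lam w ^+ 2)%:E = (2 * \sum_(0 <= i < k) lam i ^+ 2)%:E)%E) ->
  has_law Y (Gamma_sym lambda r) -> (forall x y, `|h x - h y| <= `|x - y|) ->
  `|\int[P]_w h (chaos k X lam w) - \int[Q]_w h (Y w)| <=
   C1 * Num.sqrt (gamma_poly r (power_sum k lam)) +
   C2 * `|2 * r / lambda ^+ 2 - 2 * \sum_(0 <= i < k) lam i ^+ 2|].
Proof.
move=> lambda0 r0; have r20 : 0 < 2 * r by exact: mulr_gt0.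
have s0 : 0 < lambda^-1 by rewrite invr_gt0.
have [D1 [D2 [D10 D20 bnd]]] := finite_chaos_VG 0 r20 s0.
set s2 := lambda^-1 ^+ 2 in bnd; have s20 : 0 < s2 by exact: exprn_gt0.
pose K := Num.sqrt (vg_second_moment (2 * r) 0 lambda^-1 (- (2 * r * 0)) - 1).
have K0 : 0 <= K := sqrtr_ge0 _.
pose c := 2 * r * s2; have c0 : 0 < c by exact: mulr_gt0.
have cE : 2 * r / lambda ^+ 2 = c by rewrite /c /s2 exprVn.
have cE' : 2 * r * (s2 + 2 * 0 ^+ 2) = c by rewrite expr0n/= mulr0 addr0.
rewrite cE' in bnd; rewrite cE.
(* A accounts for the correction del (1 + c) / r to the root, where sqrt p_2 <= 1 + c; E turns 1 + K
   into a multiple of [del] when del > c. *)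
pose A := D1 * (1 + c) / r; pose E := (1 + K) / c.
have A0 : 0 < A by rewrite divr_gt0// mulr_gt0// addr_gt0.
have E0 : 0 < E by rewrite divr_gt0// ltr_pwDl.
exists (2 * D1), (A + D2 + E + 2); split; [by rewrite mulr_gt0|by rewrite !addr_gt0|].
move=> d T P k X d' T' Q Y lam h mX gX isoX lawY hl.
set G := gamma_poly _ _; set p2 := \sum_(0 <= i < k) lam i ^+ 2; set del := `|c - _|.
have del0 : 0 <= del := normr_ge0 _.
have p20 : 0 <= p2 by rewrite sumr_ge0// => i _; exact: sqr_ge0.
have sG0 : 0 <= Num.sqrt G := sqrtr_ge0 _.
have [small|large] := leP p2 c.
- apply: (le_trans (bnd _ _ _ _ _ _ _ _ _ _ _ mX gX isoX lawY hl)).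
  have [G0 Db] := stein_defect_gamma s2 k lam (lt0r_neq0 r0).
  rewrite -/p2 -/del -/G in G0 Db *.
  have sD : Num.sqrt (stein_defect (2 * r) s2 0 k lam) <= 2 * Num.sqrt G + del * ((1 + c) / r).
    apply: (le_trans (ler_wsqrtr Db)); apply: (le_trans (sqrtD_le _ _)).
    + by rewrite mulr_ge0.
    + by apply: mulr_ge0 => //; apply: mulr_ge0 => //; exact: sqr_ge0.
    apply: lerD.
      rewrite sqrtrM// ler_wpM2r//.
      by rewrite -[leRHS]ger0_norm// -sqrtr_sqr ler_wsqrtr// expr2 ler_peMr// ler1n.
    have -> : 4 * (s2 - p2 / r) ^+ 2 * p2 = (2 * (s2 - p2 / r)) ^+ 2 * p2 by ring.
    rewrite sqrtrM ?sqr_ge0// sqrtr_sqr.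
    have -> : 2 * (s2 - p2 / r) = (c - 2 * p2) * r^-1.
      by rewrite /c; field; rewrite gt_eqF.
    rewrite normrM -/del [`|r^-1|]gtr0_norm ?invr_gt0// -mulrA ler_wpM2l// mulrC.
    rewrite ler_pM2r ?invr_gt0//; apply: le_trans (sqrt_le1D p20) _.
    by rewrite lerD2l.
  have h1 : D1 * Num.sqrt (stein_defect (2 * r) s2 0 k lam) <= D1 * (2 * Num.sqrt G + del * ((1 + c) / r)).
    by rewrite ler_wpM2l// ltW.
  have -> : 2 * D1 * Num.sqrt G + (A + D2 + E + 2) * del =
    D1 * (2 * Num.sqrt G + del * ((1 + c) / r)) + D2 * del + (E + 2) * del by rewrite /A; ring.
  rewrite -[leLHS]addr0; apply: lerD; last by rewrite mulr_ge0// addr_ge0// ltW.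
  by rewrite lerD2r.
- apply: (le_trans (VG_trivial_bound mX isoX r20 s0 lawY lam hl)); rewrite -/K -/p2.
  have dE : del = 2 * p2 - c by rewrite /del ltr0_norm ?opprB//; lra.
  have h1 : 1 + K <= E * del.
    rewrite /E mulrAC ler_pdivlMr// ler_wpM2l ?addr_ge0//; lra.
  have h2 : 0 <= (A + D2) * del by rewrite mulr_ge0// addr_ge0// ltW.
  have h3 : 0 <= 2 * D1 * Num.sqrt G by rewrite !mulr_ge0// ltW.
  have -> : (A + D2 + E + 2) * del = (A + D2) * del + E * del + 2 * del by ring.
  move: h1 h2 h3; move: (E * del) ((A + D2) * del) (2 * D1 * Num.sqrt G) => u1 u2 u3 h1 h2 h3.
  lra.
Qed.

End symmetrized_gamma.

Ltac cvg_poly H :=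
  lazymatch goal with
  | |- context [fmap (fun n => @?f n + @?g n) _] => refine (@cvgD _ _ _ _ _ f g _ _ _ _); cvg_poly H
  | |- context [fmap (fun n => - @?f n) _] => refine (@cvgN _ _ _ _ _ f _ _); cvg_poly H
  | |- context [fmap (fun n => @?f n * @?g n) _] => refine (@cvgM _ _ _ _ f g _ _ _ _); cvg_poly H
  | |- context [fmap (fun _ => ?c) _] => exact: cvg_cst
  | _ => exact: H
  end.

Theorem theorem5p10 (R : realType) :
  (forall r theta sigma : R, 0 < r -> 0 < sigma ->
   exists C1 C2 : R, 0 < C1 /\ 0 < C2 /\
   forall (H : hilbertSpace R) (HH : tensorSquare H)
     (d : measure_display) (T : measurableType d) (P : probability T R)
     (X : H -> {RV P >-> R}) (I2 : HH -> {RV P >-> R}) (f : nat -> HH)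
     (d' : measure_display) (T' : measurableType d') (Q : probability T' R)
     (Y : {RV Q >-> R}),
   separable_space H -> isonormal X -> generated_by X ->
   double_wiener_integral X I2 ->
   (forall n, symmetric_tensors HH (f n)) ->
   has_law Y (VGc r theta sigma) ->
   'E_P[(fun w => I2 (f n) w ^+ 2)%R]%E @[n --> \oo]
     --> (r * (sigma ^+ 2 + 2 * theta ^+ 2))%:E ->
   forall n, let k := cumulant (I2 (f n)) in
   (wasserstein (I2 (f n)) Y <=
     (C1 * Num.sqrt
        (120^-1 * k 6%N - theta / 6 * k 5%N
         + 3^-1 * (2 * theta ^+ 2 - sigma ^+ 2) * k 4%N
         + (2 - r) * theta * sigma ^+ 2 * k 3%N + 4^-1 * k 3%N ^+ 2
         - 2 * theta * k 2%N * k 3%N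
         + (sigma ^+ 4 + 4 * r * theta ^+ 2 * sigma ^+ 2) * k 2%N
         + 4 * theta ^+ 2 * k 2%N ^+ 2 + r ^+ 2 * theta ^+ 2 * sigma ^+ 4)
      + C2 * `|r * (sigma ^+ 2 + 2 * theta ^+ 2) - k 2%N|)%:E)%E) /\
  (forall lambda r : R, 0 < lambda -> 0 < r ->
   exists C1 C2 : R, 0 < C1 /\ 0 < C2 /\
   forall (H : hilbertSpace R) (HH : tensorSquare H)
     (d : measure_display) (T : measurableType d) (P : probability T R)
     (X : H -> {RV P >-> R}) (I2 : HH -> {RV P >-> R}) (f : nat -> HH)
     (d' : measure_display) (T' : measurableType d') (Q : probability T' R)
     (Y : {RV Q >-> R}),
   separable_space H -> isonormal X -> generated_by X ->
   double_wiener_integral X I2 ->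
   (forall n, symmetric_tensors HH (f n)) ->
   has_law Y (Gamma_sym lambda r) ->
   'E_P[(fun w => I2 (f n) w ^+ 2)%R]%E @[n --> \oo]
     --> (2 * r / lambda ^+ 2)%:E ->
   forall n, let k := cumulant (I2 (f n)) in
   (wasserstein (I2 (f n)) Y <=
     (C1 * Num.sqrt
        (120^-1 * k 6%N - (6 * r)^-1 * k 4%N * k 2%N
         + (4 * r ^+ 2)^-1 * k 2%N ^+ 3 + 6^-1 * k 3%N ^+ 2)
      + C2 * `|2 * r / lambda ^+ 2 - k 2%N|)%:E)%E).

Proof.
split=> [r theta sigma r0 s0|lambda r lambda0 r0].
- have [C1 [C2 [C10 C20 bnd]]] := finite_chaos_VG theta r0 s0.
  exists C1, C2; split=> //; split=> //.
  move=> H HH d T P X I2 f d' T' Q Y _ iX _ dI sf lawY _ n; cbv zeta.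
  have [iY _] := VGc_integrable r0 s0 lawY.
  pose c := r * (sigma ^+ 2 + 2 * theta ^+ 2).
  pose Phi (q : nat -> R) : R := C1 * Num.sqrt (stein_poly r (sigma ^+ 2) theta q) + C2 * `|c - 2 * q 2%N|.
  have cPhi (U : set_system nat) (q_ : nat -> nat -> R) (q : nat -> R) : ProperFilter U ->
      (forall m, q_ n m @[n --> U] --> q m) -> Phi (q_ n) @[n --> U] --> Phi q.
    move=> UF cq; apply: cvgD; apply: cvgM; try exact: cvg_cst.
      apply: (continuous_cvg _ (@sqrt_continuous R _)); rewrite /stein_poly.
      by under eq_fun do rewrite !expr2; rewrite !expr2; cvg_poly cq.
    by apply: cvg_norm; cvg_poly cq.
  have bPhi k' (e : nat -> H) lam (h : R -> R) : orthonormal k' e ->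
      (forall x y, `|h x - h y| <= `|x - y|) ->
      `|\int[P]_w h (chaos k' (fun i => X (e i)) lam w) - \int[Q]_w h (Y w)| <= Phi (power_sum k' lam).
    move=> on hl; rewrite /Phi -stein_defectE.
    apply: (bnd _ _ _ _ _ _ _ _ _ _ _ _ (isonormal_std_gauss iX on) (chaos_isometry dI on) lawY hl) => i.
    exact: measurable_funPT.
  have [q [[k2 k3 k4 k5 k6] W]] := wasserstein_chaos_limit iX dI iY cPhi bPhi (sf n).
  apply: (le_trans W); rewrite lee_fin /Phi k2 k3 k4 k5 k6 le_eqVlt; apply/orP; left; apply/eqP.
  (* With the cumulants written as multiples of q, the expression under the root is exactly
     [stein_poly], so the constants of the finite case carry over unchanged. *)
  congr (_ * Num.sqrt _ + _); by rewrite /stein_poly; field.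
- have [C1 [C2 [C10 C20 bnd]]] := finite_chaos_gamma lambda0 r0.
  exists C1, C2; split=> //; split=> //.
  move=> H HH d T P X I2 f d' T' Q Y _ iX _ dI sf lawY _ n; cbv zeta.
  have r20 : 0 < 2 * r by exact: mulr_gt0.
  have l0 : 0 < lambda^-1 by rewrite invr_gt0.
  have [iY _] := VGc_integrable r20 l0 lawY.
  pose Phi (q : nat -> R) : R := C1 * Num.sqrt (gamma_poly r q) + C2 * `|2 * r / lambda ^+ 2 - 2 * q 2%N|.
  have cPhi (U : set_system nat) (q_ : nat -> nat -> R) (q : nat -> R) : ProperFilter U ->
      (forall m, q_ n m @[n --> U] --> q m) -> Phi (q_ n) @[n --> U] --> Phi q.
    move=> UF cq; apply: cvgD; apply: cvgM; try exact: cvg_cst.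
      apply: (continuous_cvg _ (@sqrt_continuous R _)); rewrite /gamma_poly.
      have -> : (fun n => 32 * q_ n 6%N - 16 / r * q_ n 4%N * q_ n 2%N + 2 / r ^+ 2 * q_ n 2%N ^+ 3 + 32 / 3 * q_ n 3%N ^+ 2) =
        fun n => 32 * q_ n 6%N - 16 / r * q_ n 4%N * q_ n 2%N +
          2 / r ^+ 2 * (q_ n 2%N * (q_ n 2%N * q_ n 2%N)) + 32 / 3 * (q_ n 3%N * q_ n 3%N) by [].
      have -> : 32 * q 6%N - 16 / r * q 4%N * q 2%N + 2 / r ^+ 2 * q 2%N ^+ 3 + 32 / 3 * q 3%N ^+ 2 =
        32 * q 6%N - 16 / r * q 4%N * q 2%N +
          2 / r ^+ 2 * (q 2%N * (q 2%N * q 2%N)) + 32 / 3 * (q 3%N * q 3%N) by [].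
      by cvg_poly cq.
    by apply: cvg_norm; cvg_poly cq.
  have bPhi k' (e : nat -> H) lam (h : R -> R) : orthonormal k' e ->
      (forall x y, `|h x - h y| <= `|x - y|) ->
      `|\int[P]_w h (chaos k' (fun i => X (e i)) lam w) - \int[Q]_w h (Y w)| <= Phi (power_sum k' lam).
    move=> on hl; rewrite /Phi.
    apply: (bnd _ _ _ _ _ _ _ _ _ _ _ _ (isonormal_std_gauss iX on) (chaos_isometry dI on) lawY hl) => i.
    exact: measurable_funPT.
  have [q [[k2 k3 k4 _ k6] W]] := wasserstein_chaos_limit iX dI iY cPhi bPhi (sf n).
  apply: (le_trans W); rewrite lee_fin /Phi k2 k3 k4 k6 le_eqVlt; apply/orP; left; apply/eqP.
  congr (_ * Num.sqrt _ + _); by rewrite /gamma_poly; field; rewrite gt_eqF.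
Qed.
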